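(* Let $0<\alpha<2$ and let $X(t)$, $t\in T$ ($T\ne\emptyset$), be a separable symmetric $\alpha$-stable process. Let $\rho(s,t)$ be the scale parameter of $X(t)-X(s)$, assume $\sigma=\operatorname{diam}(T,\rho)<\infty$ and $(T,\rho)$ relatively compact, and let $N(\varepsilon)$ be the covering numbers of $(T,\rho)$. Assume that for some $C>0$ and $\beta>\max(1,\alpha)$, $$N(\varepsilon)\le C\varepsilon^{-\alpha}|\log\varepsilon|^{-\beta}\qquad\text{for }\varepsilon<\sigma.$$ Then there is a constant $K>0$ such that for all sufficiently small $\varepsilon>0$, $$\log\mathbb{P}\Big(\sup_{s,t\in T}|X(s)-X(t)|\le\varepsilon\Big)\ge\begin{cases}-K\varepsilon^{-1/(\beta/\alpha-1)}, & \max(1,\alpha)<\beta<1+\alpha,\\ -K\varepsilon^{-\alpha}|\log\varepsilon|^{1+\alpha}, & \beta=1+\alpha,\\ -K\varepsilon^{-\alpha}|\log\varepsilon|^{-\beta+1+\alpha}, & \beta>1+\alpha.\end{cases}$$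
   Context: The scale parameter $\rho(s,t)$ is defined by $\mathbb{E}\exp\{iu(X(t)-X(s))\}=\exp\{-\rho(t,s)^\alpha|u|^\alpha\}$. A process is symmetric $\alpha$-stable if all finite-dimensional distributions are symmetric $\alpha$-stable vectors. $N(\varepsilon)$ is the minimal number of points $t_1,\dots,t_n\in T$ such that every $t\in T$ has $\rho(t,t_i)\le\varepsilon$ for some $i$. *)

(* Defs.v *)
From HB Require Import structures.
From mathcomp Require Import all_boot all_order all_algebra.
From mathcomp Require Import all_classical all_reals all_analysis.
Set Implicit Arguments. Unset Strict Implicit. Unset Printing Implicit Defensive.
Import Order.TTheory GRing.Theory Num.Theory.
Import numFieldNormedType.Exports.
Local Open Scope classical_set_scope.
Local Open Scope ring_scope.

Section defs.
Context {R : realType}.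

(* A symmetric alpha-stable random vector (Y_1,...,Y_n) on (Omega, P):
   there is a finite symmetric measure Gamma on R^n concentrated on the unit
   sphere S^{n-1} (spectral measure) such that for every u in R^n
     E exp(i <u,Y>) = exp( - \int_{S^{n-1}} |<u,s>|^alpha Gamma(ds) ),
   the complex expectation being written via its real and imaginary parts. *)
Definition SaS_vector {d} {Omega : measurableType d}
    (P : probability Omega R) (alpha : R) (n : nat) (Y : 'I_n -> Omega -> R) : Prop :=
  (forall i, measurable_fun setT (Y i)) /\
  exists Gamma : {finite_measure set (n.-tuple R) -> \bar R},
    Gamma [set s | \sum_(i < n) tnth s i ^+ 2 != 1] = 0%E /\
    (forall A : set (n.-tuple R), measurable A ->
       Gamma [set s | A (map_tuple (fun x => - x) s)] = Gamma A) /\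
    forall u : n.-tuple R,
      (\int[P]_w (cos (\sum_(i < n) tnth u i * Y i w))%:E
        = (expR (- fine (\int[Gamma]_s
              ((`|\sum_(i < n) tnth u i * tnth s i| `^ alpha)%:E))))%:E)%E /\
      (\int[P]_w (sin (\sum_(i < n) tnth u i * Y i w))%:E = 0)%E.

Definition SaS_process {d} {Omega : measurableType d} {T : Type}
    (P : probability Omega R) (alpha : R) (X : T -> Omega -> R) : Prop :=
  forall (n : nat) (t : 'I_n -> T), SaS_vector P alpha (fun i => X (t i)).

Definition separable_process {d} {Omega : measurableType d} {T : Type}
    (P : probability Omega R) (rho : T -> T -> R) (X : T -> Omega -> R) : Prop :=
  exists (T0 : set T) (N : set Omega),
    countable T0 /\ measurable N /\ P N = 0%E /\
    forall w, ~ N w -> forall t, forall e delta, 0 < e -> 0 < delta ->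
      exists s, T0 s /\ rho s t < e /\ `|X s w - X t w| < delta.

Definition diam {T : Type} (rho : T -> T -> R) : R :=
  sup [set r | exists s t, r = rho s t].

Definition covers {T : Type} (rho : T -> T -> R) (e : R) (n : nat) : Prop :=
  exists c : 'I_n -> T, forall t, exists i, rho t (c i) <= e.

Lemma covers_ex_bool {T : Type} (rho : T -> T -> R) (e : R) :
  (exists n, covers rho e n) -> exists n, `[< covers rho e n >].
Proof. by move=> [n h]; exists n; apply/asboolP. Qed.

Definition covnum {T : Type} (rho : T -> T -> R) (e : R) : nat :=
  match pselect (exists n, covers rho e n) with
  | left h => ex_minn (covers_ex_bool h)
  | right _ => 0%N
  end.

(* (T, rho) relatively compact = totally bounded *)
Definition totally_bounded_pm {T : Type} (rho : T -> T -> R) : Prop :=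
  forall e, 0 < e -> exists n, covers rho e n.

End defs.

(* Main.v *)
Require Import Defs.
From HB Require Import structures.
From mathcomp Require Import all_boot all_order all_algebra.
From mathcomp Require Import all_classical all_reals all_analysis.
From mathcomp Require Import measurable_realfun ring lra.
Import Order.TTheory GRing.Theory Num.Theory.
Import numFieldNormedType.Exports.
Local Open Scope classical_set_scope.
Local Open Scope ring_scope.

Set Implicit Arguments.
Unset Strict Implicit.
Unset Printing Implicit Defensive.

(* Let [k] be a cubic B-spline supported in [-2, 2] with values in [0, 1]; it is a
   mixture of cosines.  For a symmetric alpha-stable vector, the exponent
   [psi = - ln (E cos)] satisfies [psi (V + W) + psi (V - W) <= 2 psi V + 2 psi W],
   hence [E (cos V cos W) >= E cos V * E cos W], and by Fubini
   [E (k Y_1 ... k Y_n)] is at least [\prod_i E (k Y_i)]: a Sidak inequality up to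
   constants, in which a slab of width [a] for an increment of scale [r] costs at
   most [M (r / a)^alpha] in the exponent.
   Chain along nets of radius [2^-n] having [N_n <= C 2^(n alpha) n^-beta] points,
   starting at [n0] of order [- ln e].  Slabs of width proportional to
   [n^(- beta / (1 + alpha))] are imposed on the links up to [n1] of order
   [x = e^(- alpha / (beta - alpha))].  Beyond [n1] slabs of constant width [e / x]
   cost only [O(x)], since [beta > 1]; they do not make the increments summable, but
   under the measure weighted by all the slabs the expected maximum of the
   [n]-th links is at most a constant times
   [(N_n 2^(- n alpha))^th (e / x)^(1 - alpha th)], where [th < min (1, 1 / alpha)]
   and [beta th > 1].  This is summable, and Markov's inequality loses a factor
   [1 / 2] only.  The total cost
   [e^(- alpha) |ln e|^(1 - beta)
     + e^(- alpha) (\sum_(n0 < n <= n1) n^(- beta / (1 + alpha)))^(1 + alpha) + x]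
   is of the announced order. *)

(** * A kernel that is a mixture of cosines *)

(** Besides [0 <= k <= 1], three demands fix the kernel: a nonnegative Fourier density, so that
    inequalities between cosines integrate to inequalities for [k] (the transform of an indicator
    changes sign); compact support, so that a nonzero product forces every slab constraint; a finite
    moment of order [alpha] of the density for every [alpha < 2], so that [1 - E k (r Y)] is
    [O(r^alpha)]. The triangle kernel, of density of order [u^-2], fails the last one for
    [alpha >= 1]; the cubic B-spline has order [u^-4]. Slabs alone cannot control the chain in all
    regimes. With [g = beta / (1 + alpha)], Holder's inequality bounds [\sum n^(- g)] by [(\sum n^(-
    beta) a_n^(- alpha))^(1 / (1 + alpha)) * (\sum a_n)^(alpha / (1 + alpha))]. For
    [beta <= 1 + alpha] the left side diverges, so slabs of summable widths [a_n] would have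
    infinite total cost; hence the second mechanism, expected maxima, beyond [n1]. It asks for
    [1 / beta < th < min (1, 1 / alpha)], which is possible exactly when [beta > max (1, alpha)]. *)

Section trig_bounds.
Context {R : realType}.
Implicit Types t y : R.

Lemma one_sub_cosE y : 1 - cos y = 2 * sin (y / 2) ^+ 2 :> R.
Proof.
have -> : cos y = cos ((y / 2) *+ 2) by congr cos; rewrite mulr2n -splitr.
rewrite cos_mulr2n cos2sin2; ring.
Qed.

(** Both [sin t <= t] and the cubic bound on [t - sin t] come from this mean value identity; the
    second feeds [1 - cos c <= c^2 / 2], a consequence of the first, back into it. *)
Lemma id_sub_sin_mvt t : 0 <= t ->
  exists2 c : R, 0 <= c <= t & t - sin t = (1 - cos c) * t.
Proof.
move=> t0; have df (x : R^o) : is_derive x 1 (fun z : R => z - sin z) (1 - cos x).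
  by apply: is_deriveB.
have [|c] := @MVT_segment R (fun x => x - sin x) (fun x => 1 - cos x) 0 t t0
  (fun x _ => df x).
  apply: derivable_within_continuous => x _.
  by case: (df x).
by rewrite in_itv/= sin0 !subr0 => c0 h; exists c.
Qed.

Lemma sin_le_id t : 0 <= t -> sin t <= t.
Proof.
move=> t0; have [c _ h] := id_sub_sin_mvt t0.
by rewrite -subr_ge0 h mulr_ge0 // subr_ge0 cos_le1.
Qed.

Lemma normr_sin_le t : `|sin t| <= `|t|.
Proof.
wlog t0 : t / 0 <= t.
  move=> H; have [/H//|/ltW t0] := leP 0 t.
  by rewrite -normrN -[leRHS]normrN -sinN; apply: H; rewrite oppr_ge0.
have [t1|t1] := leP 1 t.
  by apply: le_trans (sin_max _) _; rewrite ger0_norm.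
rewrite [leRHS]ger0_norm// ger0_norm ?sin_le_id//.
have [->|tn0] := eqVneq t 0; first by rewrite sin0.
by apply/ltW/sin2_gt0; rewrite lt_neqAle eq_sym tn0 t0/=; lra.
Qed.

Lemma one_sub_cos_le y : 1 - cos y <= y ^+ 2 / 2.
Proof.
rewrite one_sub_cosE.
have : sin (y / 2) ^+ 2 <= (y / 2) ^+ 2.
  by rewrite -[leLHS]real_normK ?num_real// -[leRHS]real_normK ?num_real//
    lerXn2r ?nnegrE// normr_sin_le.
nra.
Qed.

Lemma normr_id_sub_sin_le t : `|t - sin t| <= `|t| ^+ 3.
Proof.
wlog t0 : t / 0 <= t.
  move=> H; have [/H//|/ltW t0] := leP 0 t.
  rewrite -normrN opprB -[X in _ <= X ^+ _]normrN.
  by have := H (- t); rewrite sinN opprK addrC; apply; rewrite oppr_ge0.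
have [c /andP[c0 ct] h] := id_sub_sin_mvt t0.
rewrite h normrM ger0_norm; last by rewrite subr_ge0 cos_le1.
rewrite ger0_norm// exprSr ler_wpM2r//.
apply: le_trans (one_sub_cos_le c) _.
by have : c ^+ 2 <= t ^+ 2; [rewrite lerXn2r|have := sqr_ge0 c; lra].
Qed.

(** With [t = y / 2], the difference [y^2 / 2 - (1 - cos y)] is [2 (t - sin t) (t + sin t)], which
    is at most [4 t^4]. *)
Lemma one_sub_cos_ge y : y ^+ 2 / 2 - y ^+ 4 / 4 <= 1 - cos y.
Proof.
rewrite one_sub_cosE; set t := y / 2.
have -> : y = t * 2 by rewrite /t divfK.
have h1 := normr_id_sub_sin_le t; have h2 := normr_sin_le t.
suff : `|(t - sin t) * (t + sin t)| <= 2 * `|t| ^+ 4.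
  have -> : `|t| ^+ 4 = t ^+ 4.
    by rewrite (_ : 4 = 2 * 2)%N// exprM real_normK ?num_real// -exprM.
  by move=> /ler_normlP[_]; lra.
rewrite normrM; apply: (@le_trans _ _ (`|t| ^+ 3 * (2 * `|t|))); last lra.
by apply: ler_pM => //; apply: le_trans (ler_normD _ _) _; lra.
Qed.

End trig_bounds.

(** * Scaling of Lebesgue measure and a reference integrable function *)

Section lebesgue_tools.
Context {R : realType}.
Local Notation mu := (@lebesgue_measure R).

(** Since [0^-1 = 0], inversion is discontinuous at [0]; it is written through a power of the norm,
    and the factor [x] restores the sign and the value at [0]. *)
Lemma measurable_invr : measurable_fun [set: R] (GRing.inv : R -> R).
Proof.
rewrite (_ : GRing.inv = fun x : R => x * (`|x| `^ (-1)) ^+ 2).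
  apply: measurable_funM => //; apply: measurable_funX.
  by apply: (measurableT_comp (measurable_powR (-1))); exact: normr_measurable.
apply/funext => x; rewrite powR_inv1// exprVn real_normK ?num_real//.
have [->|x0] := eqVneq x 0; first by rewrite invr0 mul0r.
by field.
Qed.

(** By uniqueness: the rescaled pushforward of [mu] under multiplication by [x] agrees with [mu] on
    the intervals []a, b]]. *)
Lemma lebesgue_measure_scale (x : R) (A : set R) : 0 < x -> measurable A ->
  (x%:E * mu ( *%R x @^-1` A) = mu A)%E.
Proof.
move=> x0 mA; pose k := NngNum (ltW x0).
have mx : measurable_fun setT ( *%R x : measurableTypeR R -> measurableTypeR R).
  exact: mulrl_measurable.
pose nu : {measure set (measurableTypeR R) -> \bar R} :=
  mscale k (measure_function_pushforward__canonical__measure_function_Measure mu mx).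
suff : mu A = nu A by move=> ->.
apply: lebesgue_measure_unique => //= _ [[a b]] _ <-.
rewrite /nu/= /mscale/= /pushforward.
have -> : *%R x @^-1` `]a, b]%classic = `]a / x, b / x]%classic.
  by apply/seteqP; split => z/=; rewrite !in_itv/= ltr_pdivrMr// ler_pdivlMr//
    (mulrC z).
rewrite !lebesgue_measure_itv/= !lte_fin.
rewrite ltr_pM2r ?invr_gt0//; case: ifP => _; last by rewrite mule0.
by rewrite -!EFinB -EFinM -mulrBl mulrC divfK// gt_eqF.
Qed.

Lemma ge0_integral_scale (x : R) (F : R -> \bar R) : 0 < x ->
  measurable_fun setT F -> (forall u, 0 <= F u)%E ->
  (\int[mu]_u F u = x%:E * \int[mu]_u F (x * u)%R)%E.
Proof.
move=> x0 mF F0; pose k := NngNum (ltW x0).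
have mx : measurable_fun setT ( *%R x : measurableTypeR R -> measurableTypeR R).
  exact: mulrl_measurable.
pose nu : {measure set (measurableTypeR R) -> \bar R} :=
  mscale k (measure_function_pushforward__canonical__measure_function_Measure mu mx).
transitivity (\int[nu]_u F u)%E.
  by apply: eq_measure_integral => A mA _; exact/esym/(lebesgue_measure_scale x0).
by rewrite ge0_integral_mscale//= ge0_integral_pushforward//.
Qed.

Lemma integrable_oneDsqrV :
  mu.-integrable setT (fun u : R => ((1 + u ^+ 2)^-1)%:E).
Proof.
have m1 : measurable_fun setT (fun u : R => (1 + u ^+ 2)^-1).
  exact: continuous_measurable_fun (@continuous_oneDsqrV R).
apply/integrableP; split; first exact/measurable_EFinP.
under eq_integral do rewrite gee0_abs ?lee_fin ?invr_ge0 ?addr_ge0 ?sqr_ge0//.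
rewrite (@ge0_symfun_integralT R (fun u => (1 + u ^+ 2)^-1)).
- rewrite -set_itvcy integral0y_oneDsqr//.
  by rewrite -EFinM ltry.
- by move=> u; rewrite invr_ge0 addr_ge0 ?sqr_ge0.
- exact: continuous_oneDsqrV.
- by move=> u /=; rewrite sqrrN.
Qed.

End lebesgue_tools.

(** * The cubic B-spline and its Fourier density *)

Section bump.
Context {R : realType}.
Local Notation mu := (@lebesgue_measure R).
Implicit Types x u : R.

(* Subtracting the Taylor polynomial makes [cos (x * u) / u ^+ 4] integrable; the
   fourth difference in [x] annihilates the correction. *)
Definition cos_taylor x u : R := (cos (x * u) - 1 + (x * u) ^+ 2 / 2) * (u^-1) ^+ 4.

(* [0^-1 = 0], so that [fejer_sqr 0 = 0] and not [4^-1]. *)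
Definition fejer_sqr u : R := (1 - cos u) ^+ 2 * (u^-1) ^+ 4.

Lemma measurable_cosM x : measurable_fun setT (fun u => cos (x * u)).
Proof.
by apply: measurableT_comp; [exact: continuous_measurable_fun (@continuous_cos R)
  |exact: mulrl_measurable].
Qed.

Lemma measurable_invX n : measurable_fun setT (fun u : R => (u^-1) ^+ n).
Proof. exact: measurable_funX measurable_invr. Qed.

Lemma measurable_cos_taylor x : measurable_fun setT (cos_taylor x).
Proof.
apply: measurable_funM; last exact: measurable_invX.
apply: measurable_funD.
  by apply: measurable_funB => //; exact: measurable_cosM.
apply: measurable_funM => //; apply: measurable_funX; exact: mulrl_measurable.
Qed.

Lemma measurable_fejer_sqr : measurable_fun setT fejer_sqr.
Proof.
apply: measurable_funM; last exact: measurable_invX.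
apply: measurable_funX; apply: measurable_funB => //.
exact: continuous_measurable_fun (@continuous_cos R).
Qed.

Lemma cos_taylor_ge0 x u : 0 <= cos_taylor x u.
Proof.
rewrite mulr_ge0 ?exprn_even_ge0//.
by have := one_sub_cos_le (x * u); lra.
Qed.

Lemma fejer_sqr_ge0 u : 0 <= fejer_sqr u.
Proof. by rewrite mulr_ge0// ?exprn_even_ge0// sqr_ge0. Qed.

Lemma expVr4_le u : 1 <= `|u| -> (u^-1) ^+ 4 <= 2 * (u^-1) ^+ 2 / (1 + u ^+ 2).
Proof.
move=> u1; have u2 : 1 <= u ^+ 2.
  by rewrite -real_normK ?num_real// -[leLHS](expr1n _ 2) lerXn2r ?nnegrE.
have u0 : u != 0 by rewrite -normr_gt0; lra.
rewrite ler_pdivlMr; last lra.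
have -> : (u^-1) ^+ 4 * (1 + u ^+ 2) = (u^-1) ^+ 2 * ((u^-1) ^+ 2 + 1) by field.
rewrite [leRHS]mulrC ler_wpM2l ?sqr_ge0//.
rewrite exprVn; have : (u ^+ 2)^-1 <= 1 by rewrite invf_le1; lra.
lra.
Qed.

(** For [|u| < 1] the factor [u^-4] is cancelled by the Taylor remainder, of order [(x u)^4]; for
    [|u| >= 1] the nonpositive term [cos (x u) - 1] is dropped, which leaves [x^2 / 2 * u^-2]. *)
Lemma cos_taylor_le x u :
  cos_taylor x u <= (x ^+ 4 + x ^+ 2 + 4) * (1 + u ^+ 2)^-1.
Proof.
have u2 := sqr_ge0 u; have x2 := sqr_ge0 x.
have x4 : 0 <= x ^+ 4 by rewrite exprn_even_ge0.
have [u1|u1] := leP 1 `|u|; last first.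
  have u21 : u ^+ 2 <= 1.
    by rewrite -real_normK ?num_real// -[leRHS](expr1n _ 2) lerXn2r ?nnegrE// ltW.
  have [->|u0] := eqVneq u 0.
    by rewrite /cos_taylor invr0 expr0n/= mulr0 mulr_ge0 ?invr_ge0; lra.
  rewrite ler_pdivlMr; last lra.
  have h : cos_taylor x u <= x ^+ 4 / 4.
    have -> : x ^+ 4 / 4 = ((x * u) ^+ 4 / 4) * (u^-1) ^+ 4 by field.
    rewrite ler_wpM2r ?exprn_even_ge0//.
    by have := one_sub_cos_ge (x * u); lra.
  apply: le_trans (ler_wpM2r _ h) _; first lra.
  nra.
have u0 : u != 0 by rewrite -normr_gt0; lra.
have := expVr4_le u1; set d := 1 + u ^+ 2; have d0 : 0 < d by rewrite /d; lra.
move=> h4; have u22 : (u^-1) ^+ 2 <= 1.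
  rewrite exprVn invf_le1; last by rewrite exprn_even_gt0.
  by rewrite -real_normK ?num_real// -[leLHS](expr1n _ 2) lerXn2r ?nnegrE.
have dv : 0 < d^-1 by rewrite invr_gt0.
have iu := sqr_ge0 u^-1.
have h5 : (u^-1) ^+ 4 <= 2 / d.
  by apply: le_trans h4 _; rewrite ler_pM2r ?invr_gt0//; lra.
have h6 : (u^-1) ^+ 2 <= 2 / d.
  rewrite exprVn ler_pdivlMr// mulrC ler_pdivrMr ?exprn_even_gt0// /d.
  suff : 1 <= u ^+ 2 by lra.
  by rewrite -real_normK ?num_real// -[leLHS](expr1n _ 2) lerXn2r ?nnegrE.
have -> : cos_taylor x u = (cos (x * u) - 1) * (u^-1) ^+ 4 + x ^+ 2 / 2 * (u^-1) ^+ 2.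
  by rewrite /cos_taylor; field.
have h7 : (cos (x * u) - 1) * (u^-1) ^+ 4 <= 0.
  by rewrite mulr_le0_ge0 ?exprn_even_ge0// subr_le0 cos_le1.
nra.
Qed.

(** The decay [u^-4] leaves room for a factor [1 + u^2], which dominates [|u|^alpha] for all
    [alpha < 2] at once; hence the finite moment [bump_mom]. *)
Lemma fejer_sqrM_le u :
  fejer_sqr u * (1 + u ^+ 2) <= 16 * (1 + u ^+ 2)^-1.
Proof.
have u2 := sqr_ge0 u; set d := 1 + u ^+ 2; have d0 : 0 < d by rewrite /d; lra.
have c0 := one_sub_cos_le u; have c1 := cos_geN1 u; have c2 := cos_le1 u.
have cc : (1 - cos u) ^+ 2 <= 4 by nra.
rewrite ler_pdivlMr//.
have [u1|u1] := leP 1 `|u|; last first.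
  have u21 : u ^+ 2 <= 1.
    by rewrite -real_normK ?num_real// -[leRHS](expr1n _ 2) lerXn2r ?nnegrE// ltW.
  have [->|u0] := eqVneq u 0.
    by rewrite /fejer_sqr invr0 expr0n/= mulr0 !mul0r.
  have : fejer_sqr u <= 1.
    rewrite /fejer_sqr exprVn ler_pdivrMr ?exprn_even_gt0// mul1r.
    rewrite (_ : u ^+ 4 = (u ^+ 2) ^+ 2); last by rewrite -exprM.
    by rewrite lerXn2r ?nnegrE//; lra.
  move=> f1; have := fejer_sqr_ge0 u; have : d <= 2 by rewrite /d; lra.
  nra.
have u21 : 1 <= u ^+ 2.
  by rewrite -real_normK ?num_real// -[leLHS](expr1n _ 2) lerXn2r ?nnegrE.
have u0 : u != 0 by rewrite -normr_gt0; lra.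
have -> : fejer_sqr u * d * d = (1 - cos u) ^+ 2 * ((u ^+ 2)^-1 + 1) ^+ 2.
  by rewrite /fejer_sqr /d; field.
have v1 : (u ^+ 2)^-1 <= 1 by rewrite invf_le1; lra.
have v0 : 0 <= (u ^+ 2)^-1 by rewrite invr_ge0.
have := sqr_ge0 (1 - cos u).
have : ((u ^+ 2)^-1 + 1) ^+ 2 <= 4 by nra.
have := sqr_ge0 ((u ^+ 2)^-1 + 1).
nra.
Qed.

Lemma fejer_sqr_lower u : 0 < u <= 1 -> 16^-1 <= fejer_sqr u.
Proof.
move=> /andP[u0 u1]; rewrite /fejer_sqr exprVn ler_pdivlMr ?exprn_gt0//.
have := one_sub_cos_ge u.
have u2 : u ^+ 2 <= 1 by rewrite exprn_ile1// ltW.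
have -> : u ^+ 4 = u ^+ 2 * u ^+ 2 by rewrite -exprD.
have := sqr_ge0 u => u20 h.
have : u ^+ 2 / 4 <= 1 - cos u by nra.
nra.
Qed.

Lemma integrable_cos_taylor x : mu.-integrable setT (EFin \o cos_taylor x).
Proof.
have := integrableZl measurableT (x ^+ 4 + x ^+ 2 + 4) integrable_oneDsqrV.
apply: le_integrable => //.
- by apply/measurable_EFinP; exact: measurable_cos_taylor.
- move=> u _ /=; rewrite lee_fin ger0_norm ?cos_taylor_ge0//.
  exact: le_trans (cos_taylor_le x u) (ler_norm _).
Qed.

Lemma integrable_fejer_sqrM :
  mu.-integrable setT (fun u => (fejer_sqr u * (1 + u ^+ 2))%:E).
Proof.
have := integrableZl measurableT 16 (@integrable_oneDsqrV R).
apply: le_integrable => //.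
- apply/measurable_EFinP; apply: measurable_funM; first exact: measurable_fejer_sqr.
  by apply: measurable_funD => //; exact: exprn_measurable.
- move=> u _ /=; rewrite lee_fin ger0_norm.
    exact: le_trans (fejer_sqrM_le u) (ler_norm _).
  by rewrite mulr_ge0 ?fejer_sqr_ge0// addr_ge0 ?sqr_ge0.
Qed.

Lemma integrable_fejer_sqr_dom (g : R -> R) : measurable_fun setT g ->
  (forall u, `|g u| <= 1 + u ^+ 2) ->
  mu.-integrable setT (fun u => (fejer_sqr u * g u)%:E).
Proof.
move=> mg g1; apply: le_integrable integrable_fejer_sqrM => //.
  by apply/measurable_EFinP; apply: measurable_funM => //; exact: measurable_fejer_sqr.
move=> u _ /=; rewrite lee_fin !normrM ler_wpM2l//.
by rewrite (le_trans (g1 u))// ler_norm.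
Qed.

Definition cos_taylor_int x : R := \int[mu]_u cos_taylor x u.

(** The cubes of [cubic_diff] originate here: for [x > 0], [cos_taylor x u] is
    [x^4 * cos_taylor 1 (x u)], and the substitution takes back one factor [x]. *)
Lemma cos_taylor_int_scale x : cos_taylor_int x = `|x| ^+ 3 * cos_taylor_int 1.
Proof.
wlog x0 : x / 0 <= x.
  move=> H; have [/H//|/ltW x0] := leP 0 x.
  rewrite -normrN -H ?oppr_ge0//; apply: eq_Rintegral => u _.
  by rewrite /cos_taylor !mulNr cosN sqrrN.
have [->|xn0] := eqVneq x 0.
  rewrite normr0 expr0n mul0r; rewrite /cos_taylor_int.
  under eq_Rintegral do rewrite /cos_taylor mul0r cos0 subrr add0r expr0n mul0r mul0r.
  by rewrite Rintegral_cst// mul0r.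
have xp : 0 < x by rewrite lt_neqAle eq_sym xn0.
rewrite ger0_norm// /cos_taylor_int /Rintegral.
have mh := measurable_cos_taylor 1.
suff -> : (\int[mu]_u (cos_taylor x u)%:E =
    (x ^+ 3)%:E * \int[mu]_u (cos_taylor 1 u)%:E)%E.
  by rewrite fineM//; apply: integrable_fin_num => //; exact: integrable_cos_taylor.
rewrite (@ge0_integral_scale _ x (fun u => (cos_taylor 1 u)%:E))//; last 2 first.
  exact/measurable_EFinP.
  by move=> u; rewrite lee_fin cos_taylor_ge0.
rewrite muleA -EFinM -exprSr -ge0_integralZl//; last 3 first.
  apply/measurable_EFinP; apply: (measurableT_comp mh); exact: mulrl_measurable.
  by move=> u _; rewrite lee_fin cos_taylor_ge0.
  by rewrite lee_fin exprn_even_ge0.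
apply: eq_integral => u _; rewrite -EFinM; congr EFin.
rewrite /cos_taylor !mul1r invfM exprMn.
by set v := u^-1; field.
Qed.

Lemma integrable_fejer_sqr_bounded (g : R -> R) : measurable_fun setT g ->
  (forall u, `|g u| <= 1) ->
  mu.-integrable setT (fun u => (fejer_sqr u * g u)%:E).
Proof.
move=> mg g1; apply: integrable_fejer_sqr_dom => // u.
by rewrite (le_trans (g1 u))// lerDl sqr_ge0.
Qed.

(** Multiplying [cos (x u)] by [2 - 2 cos u] is minus its second difference in [x] of step [1];
    doing so twice gives the weights [1, -4, 6, -4, 1], and [(1 - cos u)^2] is a quarter of the
    square. *)
Lemma cos_fejer_sqrE x u : fejer_sqr u * cos (x * u) =
  4^-1 * (cos_taylor (x + 2) u + cos_taylor (x - 2) u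
    + 6 * cos_taylor x u - 4 * (cos_taylor (x + 1) u + cos_taylor (x - 1) u)).
Proof.
rewrite /fejer_sqr /cos_taylor; set v := u^-1.
have e2 : cos ((x + 2) * u) + cos ((x - 2) * u) =
    2 * cos (x * u) * (2 * cos u ^+ 2 - 1).
  rewrite mulrDl mulrBl cosD cosB (_ : 2 * u = u *+ 2); last by rewrite mulr_natl.
  rewrite cos_mulr2n; ring.
have e1 : cos ((x + 1) * u) + cos ((x - 1) * u) = 2 * cos (x * u) * cos u.
  rewrite mulrDl mulrBl mul1r cosD cosB; ring.
have -> : cos ((x + 2) * u) = 2 * cos (x * u) * (2 * cos u ^+ 2 - 1) - cos ((x - 2) * u).
  by rewrite -e2 addrK.
have -> : cos ((x + 1) * u) = 2 * cos (x * u) * cos u - cos ((x - 1) * u).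
  by rewrite -e1 addrK.
by field.
Qed.

(* Fourth central difference of [`|x| ^+ 3], i.e. a cubic B-spline: its Fourier
   transform is proportional to [fejer_sqr]. *)
Definition cubic_diff x : R :=
  `|x + 2| ^+ 3 + `|x - 2| ^+ 3 + 6 * `|x| ^+ 3 - 4 * (`|x + 1| ^+ 3 + `|x - 1| ^+ 3).

Lemma Rintegral_cos_fejer_sqr x :
  \int[mu]_u (fejer_sqr u * cos (x * u)) = 4^-1 * cos_taylor_int 1 * cubic_diff x.
Proof.
have I := integrable_cos_taylor.
have ID (f g : R -> R) : mu.-integrable setT (EFin \o f) ->
    mu.-integrable setT (EFin \o g) ->
    mu.-integrable setT (EFin \o (fun u => f u + g u)).
  by move=> fi gi; exact: (integrableD measurableT fi gi).
have IB (f g : R -> R) : mu.-integrable setT (EFin \o f) ->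
    mu.-integrable setT (EFin \o g) ->
    mu.-integrable setT (EFin \o (fun u => f u - g u)).
  by move=> fi gi; exact: (integrableB measurableT fi gi).
have IZ (k : R) (f : R -> R) : mu.-integrable setT (EFin \o f) ->
    mu.-integrable setT (EFin \o (fun u => k * f u)).
  by move=> fi; exact: (integrableZl measurableT k fi).
have i2 := ID _ _ (I (x + 2)) (I (x - 2)).
have i1 := ID _ _ (I (x + 1)) (I (x - 1)).
have i0 := IZ 6 _ (I x).
under eq_Rintegral do rewrite cos_fejer_sqrE.
rewrite (RintegralZl _ measurableT (IB _ _ (ID _ _ i2 i0) (IZ 4 _ i1))).
rewrite (RintegralB measurableT (ID _ _ i2 i0) (IZ 4 _ i1)).
rewrite (RintegralD measurableT i2 i0) (RintegralD measurableT (I _) (I _)).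
rewrite (RintegralZl _ measurableT (I _)) (RintegralZl _ measurableT i1).
rewrite (RintegralD measurableT (I _) (I _)).
rewrite -!/(cos_taylor_int _) (cos_taylor_int_scale (x + 2)) (cos_taylor_int_scale x).
rewrite (cos_taylor_int_scale (x - 2)) (cos_taylor_int_scale (x + 1)).
rewrite (cos_taylor_int_scale (x - 1)) /cubic_diff.
ring.
Qed.

Lemma cubic_diff_even x : cubic_diff (- x) = cubic_diff x.
Proof.
have e (a : R) : `|- x + a| = `|x - a| by rewrite -normrN opprD opprK.
by rewrite /cubic_diff normrN !e !opprK (addrC (`|x - 2| ^+ 3)) (addrC (`|x - 1| ^+ 3)).
Qed.

Lemma cubic_diff_supp x : 2 <= `|x| -> cubic_diff x = 0.
Proof.
wlog x0 : x / 0 <= x.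
  move=> H; have [/H//|/ltW x0] := leP 0 x.
  by rewrite -normrN -cubic_diff_even; apply: H; rewrite oppr_ge0.
rewrite ger0_norm// => x2; rewrite /cubic_diff !ger0_norm; lra.
Qed.

Lemma cubic_diff_ge0 x : 0 <= cubic_diff x.
Proof.
wlog x0 : x / 0 <= x.
  move=> H; have [/H//|/ltW x0] := leP 0 x.
  by rewrite -cubic_diff_even; apply: H; rewrite oppr_ge0.
have [x2|x2] := leP 2 x; first by rewrite cubic_diff_supp// ger0_norm.
rewrite /cubic_diff (ger0_norm x0) (ger0_norm (_ : 0 <= x + 2)); last lra.
rewrite (ger0_norm (_ : 0 <= x + 1)); last lra.
rewrite (ler0_norm (_ : x - 2 <= 0)); last lra.
have [x1|x1] := leP 1 x.
  rewrite ger0_norm; last lra.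
  rewrite [leRHS](_ : _ = 2 * (2 - x) ^+ 3); last ring.
  by rewrite mulr_ge0// exprn_ge0//; lra.
rewrite ler0_norm; last lra.
rewrite [leRHS](_ : _ = 2 + 6 * ((1 - x) * (1 + x * (1 - x)))); last ring.
have h : 0 <= x * (1 - x) by rewrite mulr_ge0//; lra.
have : 0 <= (1 - x) * (1 + x * (1 - x)) by rewrite mulr_ge0//; lra.
lra.
Qed.

End bump.

Lemma integrable_normr_le d (T : measurableType d) (R : realType)
    (m : {measure set T -> \bar R}) (A : set T) (f : T -> R) (M : R) :
  measurable A -> (m A < +oo)%E -> measurable_fun A f ->
  (forall x, A x -> `|f x| <= M) -> m.-integrable A (EFin \o f).
Proof.
move=> mA mAy mf fM; apply: measurable_bounded_integrable => //.
exists M; split; first exact: num_real.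
by move=> x Mx y /fM /le_trans; apply; exact: ltW.
Qed.

(** * The normalized kernel and its mean at a stable variable *)

Section bump_kernel.
Context {R : realType}.
Local Notation mu := (@lebesgue_measure R).
Implicit Types x u : R.

Lemma fejer_sqr_int_ge (g : R -> R) (b c : R) : measurable_fun setT g ->
  (forall u, 0 <= g u <= 1) -> 0 <= b -> 0 <= c <= 1 ->
  (forall u, 0 < u <= c -> b <= g u) ->
  b * c / 16 <= \int[mu]_u (fejer_sqr u * g u).
Proof.
move=> mg g01 b0 /andP[c0 c1] gb.
have ig : mu.-integrable setT (fun u => (fejer_sqr u * g u)%:E).
  apply: integrable_fejer_sqr_bounded => // u.
  by have /andP[? ?] := g01 u; rewrite ger0_norm.
have m0 : measurable (`]0, c]%classic : set R) by [].
have mu0 : mu `]0, c]%classic = c%:E.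
  rewrite lebesgue_measure_itv/= lte_fin; case: ltP => c0'; first by rewrite oppr0 adde0.
  by congr EFin; apply/eqP; rewrite eq_le c0 c0'.
have e0 : \int[mu]_(u in `]0, c]) (b / 16) = b * c / 16.
  transitivity (b / 16 * c); last ring.
  by rewrite Rintegral_cst//; congr (_ * _); exact: (congr1 fine mu0).
rewrite -e0; apply: (@le_trans _ _ (\int[mu]_(u in `]0, c]) (fejer_sqr u * g u))).
  apply: le_Rintegral => //.
  - apply: (@integrable_normr_le _ _ _ _ _ _ `|b / 16|) => //.
    by rewrite [X in (X < _)%E]mu0 ltry.
  - exact: (integrableS measurableT).
  - move=> u /=; rewrite in_itv/= => /andP[u0 uc].
    rewrite mulrC; apply: ler_pM => //; first by apply: fejer_sqr_lower; lra.
    by apply: gb; rewrite u0.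
apply: fine_le.
- by apply: integrable_fin_num => //; exact: (integrableS measurableT).
- exact: integrable_fin_num.
- apply: ge0_subset_integral => //; first by case/integrableP : ig.
  move=> u _; rewrite lee_fin mulr_ge0 ?fejer_sqr_ge0//.
  by have /andP[] := g01 u.
Qed.

Definition fejer_mass : R := \int[mu]_u fejer_sqr u.

Lemma fejer_mass_gt0 : 0 < fejer_mass.
Proof.
have := @fejer_sqr_int_ge (fun=> 1) 1 1.
under eq_Rintegral do rewrite mulr1.
move=> h; apply: (@lt_le_trans _ _ (1 * 1 / 16)); first by rewrite mulr1 divr_gt0.
by apply: h => // *; rewrite ?ler01 ?lexx.
Qed.

Definition bump x : R := cubic_diff x / 8.

Definition bump_dens u : R := fejer_sqr u / fejer_mass.

Lemma bumpE x : bump x = \int[mu]_u (bump_dens u * cos (x * u)).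
Proof.
have m0 := fejer_mass_gt0.
have cd0 : cubic_diff (0 : R) = 8.
  rewrite /cubic_diff !add0r normr0 !normrN expr0n /= normr1 ger0_norm//; ring.
(* The integral formula at [x = 0] expresses the mass by [cos_taylor_int 1]; this yields the
   normalization [1 / 8] and, through [fejer_mass_gt0], the nonvanishing of [cos_taylor_int 1]. *)
have e : fejer_mass = 2 * cos_taylor_int 1.
  have := Rintegral_cos_fejer_sqr (0 : R); rewrite cd0.
  under eq_Rintegral do rewrite mul0r cos0 mulr1.
  by rewrite /fejer_mass => ->; field.
transitivity (\int[mu]_u (fejer_mass^-1 * (fejer_sqr u * cos (x * u)))); last first.
  by apply: eq_Rintegral => u _; rewrite /bump_dens; ring.
rewrite RintegralZl//; last first.
  apply: integrable_fejer_sqr_bounded; first exact: measurable_cosM.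
  by move=> u; exact: cos_max.
rewrite Rintegral_cos_fejer_sqr e /bump; field.
by move: m0; rewrite e; lra.
Qed.

Lemma bump_ge0 x : 0 <= bump x.
Proof. by rewrite divr_ge0// cubic_diff_ge0. Qed.

Lemma bump_supp x : 2 <= `|x| -> bump x = 0.
Proof. by move=> x2; rewrite /bump cubic_diff_supp// mul0r. Qed.

Lemma measurable_bump : measurable_fun setT bump.
Proof.
have m3 (a : R) : measurable_fun setT (fun x : R => `|x + a| ^+ 3).
  apply: measurable_funX; apply: measurableT_comp; first exact: normr_measurable.
  exact: measurable_funD.
apply: measurable_funM => //; apply: measurable_funB.
  apply: measurable_funD; first exact: measurable_funD.
  apply: measurable_funM => //; apply: measurable_funX; exact: normr_measurable.
by apply: measurable_funM => //; exact: measurable_funD.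
Qed.

Lemma bump_dens_ge0 u : 0 <= bump_dens u.
Proof. by rewrite divr_ge0 ?fejer_sqr_ge0// ltW// fejer_mass_gt0. Qed.

Lemma measurable_bump_dens : measurable_fun setT bump_dens.
Proof. by apply: measurable_funM => //; exact: measurable_fejer_sqr. Qed.

Lemma integrable_bump_dens (g : R -> R) : measurable_fun setT g ->
  (forall u, `|g u| <= 1 + u ^+ 2) ->
  mu.-integrable setT (EFin \o (fun u => bump_dens u * g u)).
Proof.
move=> mg g1; have := integrableZl measurableT fejer_mass^-1 (integrable_fejer_sqr_dom mg g1).
apply: eq_integrable => // u _ /=; rewrite -EFinM; congr EFin.
by rewrite /bump_dens; ring.
Qed.

Lemma integrable_bump_dens_bounded (g : R -> R) : measurable_fun setT g ->
  (forall u, `|g u| <= 1) ->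
  mu.-integrable setT (EFin \o (fun u => bump_dens u * g u)).
Proof.
move=> mg g1; apply: integrable_bump_dens => // u.
by rewrite (le_trans (g1 u))// lerDl sqr_ge0.
Qed.

Lemma integrable_bump_dens1 : mu.-integrable setT (EFin \o bump_dens).
Proof.
have n1 (u : R) : `|1 : R| <= 1 by rewrite normr1.
have := @integrable_bump_dens_bounded (fun=> 1) (measurable_cst _) n1.
by apply: eq_integrable => // u _ /=; rewrite mulr1.
Qed.

Lemma bump_dens_int1 : \int[mu]_u bump_dens u = 1.
Proof.
have := bumpE 0; under eq_Rintegral do rewrite mul0r cos0 mulr1.
move=> <-; rewrite /bump /cubic_diff !add0r normr0 !normrN expr0n /= normr1 ger0_norm//.
by field.
Qed.

Lemma bump_le1 x : bump x <= 1.
Proof.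
rewrite bumpE -bump_dens_int1; apply: le_Rintegral => //.
- apply: integrable_bump_dens_bounded; first exact: measurable_cosM.
  by move=> u; exact: cos_max.
- exact: integrable_bump_dens1.
- by move=> u _; rewrite ler_piMr ?bump_dens_ge0// cos_le1.
Qed.

Section stable_transform.
Variable alpha : R.
Hypotheses (a0 : 0 < alpha) (a2 : alpha < 2).

Definition bump_mom : R := \int[mu]_u (bump_dens u * `|u| `^ alpha).

(** The mean of [bump Y] for [Y] symmetric stable of scale [r], a smooth substitute for
    [P (|Y| < 2)]. *)
Definition bump_stable (r : R) : R :=
  \int[mu]_u (bump_dens u * expR (- (r `^ alpha * `|u| `^ alpha))).

Lemma measurable_norm_powR : measurable_fun setT (fun u : R => `|u| `^ alpha).
Proof. by apply: (measurableT_comp (measurable_powR alpha)); exact: normr_measurable. Qed.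

Lemma norm_powR_le u : `|u| `^ alpha <= 1 + u ^+ 2.
Proof.
have [u1|u1] := leP 1 `|u|; last first.
  have : `|u| `^ alpha <= 1 `^ alpha.
    by apply: ge0_ler_powR; rewrite ?nnegrE//; exact: ltW.
  by rewrite powR1; have := sqr_ge0 u; lra.
have : `|u| `^ alpha <= `|u| `^ 2%:R by rewrite ler_powR// ltW.
by rewrite powR_mulrn// real_normK ?num_real//; lra.
Qed.

Lemma integrable_bump_mom :
  mu.-integrable setT (EFin \o (fun u => bump_dens u * `|u| `^ alpha)).
Proof.
apply: integrable_bump_dens => [|u]; first exact: measurable_norm_powR.
by rewrite ger0_norm ?powR_ge0// norm_powR_le.
Qed.

Lemma integrable_bump_stable (r : R) :
  mu.-integrable setT (EFin \o (fun u => bump_dens u * expR (- (r `^ alpha * `|u| `^ alpha)))).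
Proof.
apply: integrable_bump_dens_bounded => [|u].
  apply: measurableT_comp => //; apply: measurableT_comp => //.
  by apply: measurable_funM => //; exact: measurable_norm_powR.
by rewrite ger0_norm ?expR_ge0// -expR0 ler_expR oppr_le0 mulr_ge0 ?powR_ge0.
Qed.

Lemma bump_mom_ge0 : 0 <= bump_mom.
Proof. by apply: Rintegral_ge0 => u _; rewrite mulr_ge0 ?powR_ge0 ?bump_dens_ge0. Qed.

(* Jensen: [exp (-x) >= exp (-m) (1 - (x - m))] with [m] the mean of [x]. *)
Lemma bump_stable_ge_exp (r : R) : expR (- (bump_mom * r `^ alpha)) <= bump_stable r.
Proof.
set m := bump_mom * r `^ alpha.
have im := integrable_bump_mom.
have i1 := integrable_bump_dens1.
have iZ (k : R) f : mu.-integrable setT (EFin \o f) ->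
    mu.-integrable setT (EFin \o (fun u => k * f u)).
  by move=> h; exact: (integrableZl measurableT k h).
have -> : expR (- m) = \int[mu]_u (expR (- m) * (1 + m) * bump_dens u
    - expR (- m) * r `^ alpha * (bump_dens u * `|u| `^ alpha)).
  rewrite (RintegralB measurableT (iZ _ _ i1) (iZ _ _ im)).
  rewrite !RintegralZl// bump_dens_int1 -/bump_mom /m; ring.
apply: le_Rintegral => //.
- exact: (integrableB measurableT (iZ _ _ i1) (iZ _ _ im)).
- exact: integrable_bump_stable.
move=> u _; set t := r `^ alpha * `|u| `^ alpha.
have -> : expR (- m) * (1 + m) * bump_dens u -
    expR (- m) * r `^ alpha * (bump_dens u * `|u| `^ alpha) =
    bump_dens u * (expR (- m) * (1 + (m - t))) by rewrite /t; ring.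
rewrite ler_wpM2l ?bump_dens_ge0//.
have -> : expR (- t) = expR (- m) * expR (m - t) by rewrite -expRD; congr expR; ring.
by rewrite ler_wpM2l ?expR_ge0// expR_ge1Dx.
Qed.

(** For large [r] the exponential bound is far too small: the true order is [1 / r], as for a
    density at [0]. The frequencies [0 < u <= 1 / r], where the exponential is at least [exp (-1)],
    already contribute that much. A slab that is narrow compared with the scale thus costs only a
    logarithm, which is what the coarsest level uses. *)
Lemma bump_stable_ge_inv : exists2 c : R, 0 < c &
  forall r : R, 1 <= r -> c / r <= bump_stable r.
Proof.
exists (expR (- 1) / 16 / fejer_mass).
  by rewrite !divr_gt0 ?expR_gt0// fejer_mass_gt0.
move=> r r1; have r0 : 0 < r by lra.
have M0 := fejer_mass_gt0.
have -> : bump_stable r = fejer_mass^-1 *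
    \int[mu]_u (fejer_sqr u * expR (- (r `^ alpha * `|u| `^ alpha))).
  rewrite -RintegralZl//; last first.
    apply: integrable_fejer_sqr_bounded => [|u].
      apply: measurableT_comp => //; apply: measurableT_comp => //.
      by apply: measurable_funM => //; exact: measurable_norm_powR.
    by rewrite ger0_norm ?expR_ge0// -expR0 ler_expR oppr_le0 mulr_ge0 ?powR_ge0.
  by apply: eq_Rintegral => u _; rewrite /bump_dens; ring.
rewrite (_ : _ / _ = fejer_mass^-1 * (expR (- 1) * r^-1 / 16)); last ring.
apply: ler_wpM2l; first by rewrite invr_ge0 ltW.
apply: fejer_sqr_int_ge.
- apply: measurableT_comp => //; apply: measurableT_comp => //.
  by apply: measurable_funM => //; exact: measurable_norm_powR.
- by move=> u; rewrite expR_ge0 -expR0 ler_expR oppr_le0 mulr_ge0 ?powR_ge0.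
- exact: expR_ge0.
- by rewrite invr_ge0 ltW//= invf_le1.
move=> u /andP[u0 ur]; have r00 := ltW r0; have u00 := ltW u0; have a00 := ltW a0.
rewrite ler_expR lerN2 -powRM// ger0_norm//.
have -> : (1 : R) = 1 `^ alpha by rewrite powR1.
rewrite ge0_ler_powR ?nnegrE ?mulr_ge0//.
by rewrite mulrC -ler_pdivlMr// div1r.
Qed.

End stable_transform.
End bump_kernel.

(** * Positive correlation of slabs *)

Section correlation.
Context {R : realType} {d : measure_display} {Omega : measurableType d}
  (P : probability Omega R).
Local Notation mu := (@lebesgue_measure R).
Implicit Types (F G H V W Y Z : Omega -> R).

Definition bmeas F := measurable_fun setT F /\ exists M, forall w, `|F w| <= M.

Lemma bmeas_integrable F : bmeas F -> P.-integrable setT (EFin \o F).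
Proof.
move=> [mF [M FM]]; apply: (@integrable_normr_le _ _ _ _ _ _ M) => //.
exact: le_lt_trans (probability_le1 P measurableT) (ltry _).
Qed.

Lemma bmeas_cst (c : R) : bmeas (fun=> c).
Proof. by split => //; exists `|c|. Qed.

Lemma bmeasD F G : bmeas F -> bmeas G -> bmeas (fun w => F w + G w).
Proof.
move=> [mF [M FM]] [mG [N GN]]; split; first exact: measurable_funD.
by exists (M + N) => w; rewrite (le_trans (ler_normD _ _))// lerD.
Qed.

Lemma bmeasM F G : bmeas F -> bmeas G -> bmeas (fun w => F w * G w).
Proof.
move=> [mF [M FM]] [mG [N GN]]; split; first exact: measurable_funM.
by exists (M * N) => w; rewrite normrM ler_pM.
Qed.

Lemma bmeasB F G : bmeas F -> bmeas G -> bmeas (fun w => F w - G w).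
Proof.
move=> [mF [M FM]] [mG [N GN]]; split; first exact: measurable_funB.
by exists (M + N) => w; rewrite (le_trans (ler_normB _ _))// lerD.
Qed.

Lemma bmeas_sum (I : Type) (s : seq I) (F : I -> Omega -> R) :
  (forall i, bmeas (F i)) -> bmeas (fun w => \sum_(i <- s) F i w).
Proof.
move=> bF; elim: s => [|i s IH].
  by rewrite (_ : (fun _ => _) = (fun=> 0)); [exact: bmeas_cst|
    apply/funext => w; rewrite big_nil].
rewrite (_ : (fun _ => _) = (fun w => F i w + \sum_(j <- s) F j w)).
  exact: bmeasD.
by apply/funext => w; rewrite big_cons.
Qed.

Lemma bmeas_cos V : measurable_fun setT V -> bmeas (fun w => cos (V w)).
Proof.
move=> mV; split; last by exists 1 => w; exact: cos_max.
by apply: measurableT_comp => //; exact: continuous_measurable_fun (@continuous_cos R).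
Qed.

Lemma bmeas_bump V : measurable_fun setT V -> bmeas (fun w => bump (V w)).
Proof.
move=> mV; split; last by exists 1 => w; rewrite ger0_norm ?bump_ge0// bump_le1.
by apply: measurableT_comp => //; exact: measurable_bump.
Qed.

Definition Ex F : R := \int[P]_w F w.

Lemma ExD F G : bmeas F -> bmeas G -> Ex (fun w => F w + G w) = Ex F + Ex G.
Proof. by move=> bF bG; rewrite /Ex RintegralD//; exact: bmeas_integrable. Qed.

Lemma ExB F G : bmeas F -> bmeas G -> Ex (fun w => F w - G w) = Ex F - Ex G.
Proof. by move=> bF bG; rewrite /Ex RintegralB//; exact: bmeas_integrable. Qed.

Lemma ExZ (c : R) F : bmeas F -> Ex (fun w => c * F w) = c * Ex F.
Proof. by move=> bF; rewrite /Ex RintegralZl//; exact: bmeas_integrable. Qed.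

Lemma Ex_sum (I : Type) (s : seq I) (F : I -> Omega -> R) :
  (forall i, bmeas (F i)) ->
  Ex (fun w => \sum_(i <- s) F i w) = \sum_(i <- s) Ex (F i).
Proof.
move=> bF; elim: s => [|i s IH].
  rewrite big_nil (_ : (fun _ => _) = (fun=> 0)) /Ex ?Rintegral_cst// ?mul0r//.
  by apply/funext => w; rewrite big_nil.
rewrite big_cons -IH -ExD//; last exact: bmeas_sum.
by congr Ex; apply/funext => w; rewrite big_cons.
Qed.

Lemma Ex_le F G : bmeas F -> bmeas G -> (forall w, F w <= G w) -> Ex F <= Ex G.
Proof.
by move=> bF bG FG; apply: le_Rintegral => //; exact: bmeas_integrable.
Qed.

Lemma Ex_ge0 F : (forall w, 0 <= F w) -> 0 <= Ex F.
Proof. by move=> F0; exact: Rintegral_ge0. Qed.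

Lemma Ex_cst (c : R) : Ex (fun=> c) = c.
Proof.
rewrite /Ex Rintegral_cst// -[RHS]mulr1; congr (_ * _).
exact: (congr1 fine (probability_setT P)).
Qed.

Lemma le_Ex_prob F (A : set Omega) : bmeas F -> measurable A ->
  (forall w, F w <= (\1_A w : R)) -> ((Ex F)%:E <= P A)%E.
Proof.
move=> bF mA FA; have PA : P A \is a fin_num by exact: fin_num_measure.
rewrite -(fineK PA) lee_fin -(setIT A) -integral_indic//.
apply: Ex_le => //; split; first exact: measurable_indic.
exists 1 => w; rewrite indicE; case: (_ \in _); rewrite ?normr1 ?normr0//.
Qed.

Lemma prob_le_Ex F (A : set Omega) : bmeas F -> measurable A ->
  (forall w, (\1_A w : R) <= F w) -> (P A <= (Ex F)%:E)%E.
Proof.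
move=> bF mA FA; have PA : P A \is a fin_num by exact: fin_num_measure.
rewrite -(fineK PA) lee_fin -(setIT A) -integral_indic//.
apply: Ex_le => //; split; first exact: measurable_indic.
exists 1 => w; rewrite indicE; case: (_ \in _); rewrite ?normr1 ?normr0//.
Qed.

Section fubini.
Variables (H Y : Omega -> R).
Hypotheses (bH : bmeas H) (mY : measurable_fun setT Y).

Let f (z : Omega * R) : \bar R := (H z.1 * (bump_dens z.2 * cos (Y z.1 * z.2)))%:E.

Let mf : measurable_fun setT f.
Proof.
apply/measurable_EFinP; apply: measurable_funM.
  by apply: measurableT_comp => //; case: bH.
apply: measurable_funM; first exact: measurableT_comp measurable_bump_dens _.
apply: measurableT_comp; first exact: continuous_measurable_fun (@continuous_cos R).
by apply: measurable_funM => //; exact: measurableT_comp.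
Qed.

Let icos (x : R) : mu.-integrable setT (EFin \o (fun u => bump_dens u * cos (x * u))).
Proof.
apply: integrable_bump_dens_bounded; first exact: measurable_cosM.
by move=> u; exact: cos_max.
Qed.

(** Fubini is justified by the majorant [M * bump_dens u], whose integral in [u] is [M], over a
    probability space. *)
Let intf : (P \x mu)%E.-integrable setT f.
Proof.
apply/integrable12ltyP => //; case: bH => mH [M HM].
have /integrableP[_ MP] := bmeas_integrable (bmeas_cst M).
apply: le_lt_trans MP; apply: ge0_le_integral => //.
- by move=> w _; exact: integral_ge0.
- apply: (measurable_fun_fubini_tonelli_F (m2 := mu) (abse \o f)) => //.
    exact: measurableT_comp.
  by move=> x; exact: abse_ge0.
move=> w _ /=; apply: (@le_trans _ _ (\int[mu]_u (M * bump_dens u)%:E)%E).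
  apply: ge0_le_integral => //.
  - apply/measurable_EFinP; apply: measurableT_comp => //.
    apply: measurable_funM => //; apply: measurable_funM.
      exact: measurable_bump_dens.
    exact: measurable_cosM.
  - apply/measurable_EFinP; apply: measurable_funM => //; exact: measurable_bump_dens.
  move=> u _; rewrite lee_fin normrM ler_pM// normrM ger0_norm ?bump_dens_ge0//.
  by rewrite ler_piMr ?bump_dens_ge0// cos_max.
have i1 := @integrable_bump_dens1 R.
rewrite -[X in (X <= _)%E]fineK; last first.
  apply: integrable_fin_num => //; exact: (integrableZl measurableT M i1).
rewrite lee_fin -/(Rintegral _ _ _) RintegralZl//.
by rewrite bump_dens_int1 mulr1 ler_norm.
Qed.

Lemma integrable_Ex_cos :
  mu.-integrable setT (EFin \o (fun u => bump_dens u * Ex (fun w => H w * cos (u * Y w)))).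
Proof.
have mG := measurable_fubini_G intf; case: bH => mH [M HM].
have GE : (EFin \o (fun u => bump_dens u * Ex (fun w => H w * cos (u * Y w)))) =
    (fun u => \int[P]_w f (w, u))%E.
  apply/funext => u /=.
  have bc : bmeas (fun w => H w * cos (u * Y w)).
    by apply: bmeasM => //; apply: bmeas_cos; exact: measurable_funM.
  rewrite EFinM /Ex /Rintegral fineK; last first.
    by apply: integrable_fin_num => //; exact: bmeas_integrable.
  rewrite -integralZl//; last exact: bmeas_integrable.
  by apply: eq_integral => w _; rewrite -EFinM (mulrC u); congr EFin; ring.
have := integrableZl measurableT M (@integrable_bump_dens1 R).
apply: le_integrable => //; first by rewrite GE; exact: mG.
move=> u _ /=; rewrite lee_fin !normrM mulrC ler_wpM2r//.
have bc : bmeas (fun w => H w * cos (u * Y w)).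
  by apply: bmeasM => //; apply: bmeas_cos; exact: measurable_funM.
rewrite /Ex (le_trans (le_normr_Rintegral measurableT (bmeas_integrable bc)))//.
rewrite (le_trans _ (ler_norm M))// -(Ex_cst M).
apply: Ex_le; [|exact: bmeas_cst|].
  split; first by apply: measurableT_comp => //; case: bc.
  by case: bc => _ [N HN]; exists N => w; rewrite normr_id.
move=> w; rewrite normrM (le_trans _ (HM w))// ler_piMr//; exact: cos_max.
Qed.

(** An expectation against [bump] is an average, with nonnegative weights, of expectations against
    cosines; each correlation inequality below is proved for cosines and integrated through this
    formula. *)
Lemma Ex_bumpE : Ex (fun w => H w * bump (Y w)) =
  \int[mu]_u (bump_dens u * Ex (fun w => H w * cos (u * Y w))).
Proof.
rewrite /Ex /Rintegral; congr fine.
transitivity (\int[P]_w \int[mu]_u f (w, u))%E.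
  apply: eq_integral => w _; rewrite bumpE EFinM /Rintegral fineK; last first.
    by apply: integrable_fin_num => //; exact: icos.
  by rewrite -integralZl//; exact: icos.
have := Fubini intf; rewrite [X in _ = X -> _]/= => ->.
apply: eq_integral => u _.
have bc : bmeas (fun w => H w * cos (u * Y w)).
  by apply: bmeasM => //; apply: bmeas_cos; exact: measurable_funM.
rewrite EFinM fineK; last first.
  by apply: integrable_fin_num => //; exact: bmeas_integrable.
rewrite -integralZl//; last exact: bmeas_integrable.
by apply: eq_integral => w _; rewrite /f/= -EFinM (mulrC u); congr EFin; ring.
Qed.

End fubini.

Variable L : set (Omega -> R).
Hypothesis Lmeas : forall V, L V -> measurable_fun setT V.
Hypothesis L0 : L (fun=> 0).
Hypothesis LD : forall V W, L V -> L W -> L (fun w => V w + W w).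
Hypothesis LZ : forall (c : R) V, L V -> L (fun w => c * V w).
Hypothesis Lcos : forall V W, L V -> L W ->
  2 * Ex (fun w => cos (V w)) * Ex (fun w => cos (W w)) <=
  Ex (fun w => cos (V w + W w)) + Ex (fun w => cos (V w - W w)).

Let LB V W : L V -> L W -> L (fun w => V w - W w).
Proof.
move=> LV LW; rewrite (_ : (fun _ => _) = (fun w => V w + -1 * W w)).
  by apply: LD => //; exact: LZ.
by apply/funext => w; rewrite mulN1r.
Qed.

Let bcos V : L V -> bmeas (fun w => cos (V w)).
Proof. by move=> /Lmeas; exact: bmeas_cos. Qed.

(* Testing against all cosines makes the invariant stable under multiplication by
   a bump, since a bump is a mixture of cosines. *)
Definition pos_corr G := bmeas G /\ forall V W, L V -> L W ->
  Ex (fun w => G w * cos (V w)) * Ex (fun w => cos (W w)) <=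
  Ex (fun w => G w * cos (V w) * cos (W w)).

Let cos_prod (x y : R) : cos x * cos y = 2^-1 * (cos (x + y) + cos (x - y)).
Proof. by rewrite cosD cosB; field. Qed.

Lemma pos_corr1 : pos_corr (fun=> 1).
Proof.
split=> [|V W LV LW]; first exact: bmeas_cst.
rewrite (_ : (fun _ => _) = (fun w => cos (V w))); last first.
  by apply/funext => w; rewrite mul1r.
rewrite [leRHS](_ : _ = 2^-1 * (Ex (fun w => cos (V w + W w)) + Ex (fun w => cos (V w - W w)))).
  have := Lcos LV LW; lra.
rewrite -ExD; [|exact/bcos/LD|exact/bcos/LB].
rewrite -ExZ; last by apply: bmeasD; [exact/bcos/LD|exact/bcos/LB].
by congr Ex; apply/funext => w; rewrite mul1r cos_prod.
Qed.

(** Expand [bump Y] in the cosines of [u * Y]. By product-to-sum, [cos V cos (u Y)] is the half-sum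
    of [cos (V + u Y)] and [cos (V - u Y)]; both arguments stay in [L], so the invariant of [G]
    applies to each with [W] unchanged. *)
Lemma pos_corr_bump G Y : pos_corr G -> L Y -> pos_corr (fun w => G w * bump (Y w)).
Proof.
move=> [bG pG] LY; have mY := Lmeas LY.
split=> [|V W LV LW]; first by apply: bmeasM => //; exact: bmeas_bump.
have LuY (u : R) : L (fun w => u * Y w) by exact: LZ.
have bGV : bmeas (fun w => G w * cos (V w)) by apply: bmeasM => //; exact: bcos.
have bGVW : bmeas (fun w => G w * cos (V w) * cos (W w)).
  by apply: bmeasM => //; exact: bcos.
rewrite (_ : (fun _ => _) = (fun w => (G w * cos (V w)) * bump (Y w))); last first.
  by apply/funext => w; ring.
rewrite [leRHS](_ : _ = Ex (fun w => (G w * cos (V w) * cos (W w)) * bump (Y w))); last first.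
  by congr Ex; apply/funext => w; ring.
rewrite !Ex_bumpE// -RintegralZr//; last exact: integrable_Ex_cos.
apply: le_Rintegral => //.
- rewrite (_ : _ \o _ = EFin \o (fun u => Ex (fun w => cos (W w)) *
    (bump_dens u * Ex (fun w => (G w * cos (V w)) * cos (u * Y w))))); last first.
    by apply/funext => u /=; congr EFin; ring.
  exact: (integrableZl measurableT _ (integrable_Ex_cos bGV mY)).
- exact: integrable_Ex_cos.
move=> u _; rewrite -mulrA ler_wpM2l ?bump_dens_ge0//.
have LVp : L (fun w => V w + u * Y w) by exact: LD.
have LVm : L (fun w => V w - u * Y w) by exact: LB.
have b1 := bcos LVp; have b2 := bcos LVm; have b3 := bcos LW.
have E1 : Ex (fun w => G w * cos (V w) * cos (u * Y w)) =
   2^-1 * (Ex (fun w => G w * cos (V w + u * Y w)) + Ex (fun w => G w * cos (V w - u * Y w))).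
  rewrite -ExD; [|exact: bmeasM..]; rewrite -ExZ; last by apply: bmeasD; exact: bmeasM.
  by congr Ex; apply/funext => w; rewrite -mulrA cos_prod; ring.
have E2 : Ex (fun w => G w * cos (V w) * cos (W w) * cos (u * Y w)) =
   2^-1 * (Ex (fun w => G w * cos (V w + u * Y w) * cos (W w)) +
           Ex (fun w => G w * cos (V w - u * Y w) * cos (W w))).
  rewrite -ExD; [|by apply: bmeasM => //; exact: bmeasM..].
  rewrite -ExZ; last by apply: bmeasD; apply: bmeasM => //; exact: bmeasM.
  congr Ex; apply/funext => w; rewrite -mulrA (mulrC (cos (W w))) mulrA -(mulrA (G w)) cos_prod.
  ring.
rewrite E1 E2 -mulrA ler_wpM2l// mulrDl lerD//; exact: pG.
Qed.

Lemma pos_corr_Ex_bump G Z : pos_corr G -> L Z ->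
  Ex G * Ex (fun w => bump (Z w)) <= Ex (fun w => G w * bump (Z w)).
Proof.
move=> [bG pG] LZ'; have mZ := Lmeas LZ'.
have b1 : bmeas (fun=> 1) by exact: bmeas_cst.
have cE : (fun w => bump (Z w)) = (fun w => (fun=> 1) w * bump (Z w)).
  by apply/funext => w; rewrite mul1r.
rewrite cE !Ex_bumpE// -RintegralZl//; last exact: integrable_Ex_cos.
apply: le_Rintegral => //.
- exact: (integrableZl measurableT _ (integrable_Ex_cos b1 mZ)).
- exact: integrable_Ex_cos.
move=> u _; rewrite mulrCA ler_wpM2l ?bump_dens_ge0//.
(* The invariant is tested at [V = 0], where the first cosine is [1]. *)
have /= := pG _ _ L0 (LZ u LZ').
have -> : (fun w => G w * cos 0) = G by apply/funext => w; rewrite cos0 mulr1.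
have -> : (fun w => 1 * cos (u * Z w)) = (fun w => cos (u * Z w)).
  by apply/funext => w; rewrite mul1r.
by have -> : (fun w => G w * cos 0 * cos (u * Z w)) = (fun w => G w * cos (u * Z w))
  by apply/funext => w; rewrite cos0 mulr1.
Qed.

End correlation.

(** * The parallelogram inequality for powers below 2 *)

Section power_inequalities.
Context {R : realType}.
Implicit Types a b x y p : R.

Lemma powR_le_tangent x p : 0 <= x -> 0 < p < 1 -> x `^ p <= p * x + (1 - p).
Proof.
move=> x0 /andP[p0 p1].
(* Young's inequality with conjugate exponents [1 / p] and [1 / (1 - p)], the second factor being
   [1]. *)
have := @conjugate_powR R (x `^ p) 1 p^-1 (1 - p)^-1 (powR_ge0 _ _) ler01.
rewrite !invr_gt0 subr_gt0 => /(_ p0 p1); rewrite !invrK => h.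
have pp : p + (1 - p) = 1 by ring.
by have := h pp; rewrite mulr1 -powRrM mulfV ?gt_eqF// powRr1// powR1 mul1r (mulrC x).
Qed.

Lemma powR_add_le x y p : 0 <= x -> 0 <= y -> 0 < p < 1 ->
  (x + y) `^ p <= x `^ p + y `^ p.
Proof.
move=> x0 y0 /andP[p0 p1]; have [s0|s0] := leP (x + y) 0.
  have -> : x + y = 0 by apply/eqP; rewrite eq_le s0 addr_ge0.
  by rewrite powR0 ?gt_eqF// addr_ge0// powR_ge0.
have part z : 0 <= z -> z <= x + y -> (x + y) `^ p * (z / (x + y)) <= z `^ p.
  move=> z0 zs; have zs0 : 0 <= z / (x + y) by rewrite divr_ge0// ltW.
  have [->|zn] := eqVneq z 0; first by rewrite mul0r mulr0 powR_ge0.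
  have {2}-> : z = (x + y) * (z / (x + y)) by rewrite mulrC divfK// gt_eqF.
  rewrite powRM// ?(ltW s0)// ler_wpM2l ?powR_ge0//.
  apply: ger1_powR; last exact: ltW.
  by rewrite ler_pdivrMr// mul1r zs andbT divr_gt0// lt_neqAle eq_sym zn.
have hx := part x x0 _; have hy := part y y0 _.
have -> : (x + y) `^ p = (x + y) `^ p * (x / (x + y)) + (x + y) `^ p * (y / (x + y)).
  by field; rewrite gt_eqF.
by rewrite lerD// (hx, hy)// (lerDl, lerDr).
Qed.

(** Midpoint concavity: the tangent line at [m = (x + y) / 2] lies above, and its values at [x] and
    [y] add up to [2 m^p]. *)
Lemma powR_mid_le x y p : 0 <= x -> 0 <= y -> 0 < p < 1 ->
  x `^ p + y `^ p <= 2 * ((x + y) / 2) `^ p.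
Proof.
move=> x0 y0 p01; have [s0|s0] := leP (x + y) 0.
  have [-> ->] : x = 0 /\ y = 0 by split; apply/eqP; rewrite eq_le; lra.
  by case/andP: p01 => p0 _; rewrite addr0 mul0r powR0 ?gt_eqF// addr0 mulr0.
have [m mE] : exists m, m = (x + y) / 2 by exists ((x + y) / 2).
rewrite -mE; have m0 : 0 < m by rewrite mE divr_gt0.
have tg z : 0 <= z -> z `^ p <= m `^ p * (p * (z / m) + (1 - p)).
  move=> z0; have {1}-> : z = m * (z / m) by rewrite mulrC divfK// gt_eqF.
  rewrite powRM ?divr_ge0 ?(ltW m0)// ler_wpM2l ?powR_ge0//.
  by apply: powR_le_tangent => //; rewrite divr_ge0// ltW.
apply: le_trans (lerD (tg x x0) (tg y y0)) _.
rewrite -mulrDr mulrC ler_wpM2r ?powR_ge0//.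
rewrite [leLHS](_ : _ = p * ((x + y) / m) + 2 * (1 - p)); last ring.
have -> : (x + y) / m = 2 by rewrite mE; field; rewrite gt_eqF.
lra.
Qed.

(** Write [|z|^p = (z^2)^(p / 2)] with [p / 2 < 1]. Concavity applies to the two squares on the
    left, whose mean is [a^2 + b^2], and subadditivity separates [a^2] from [b^2]. *)
Lemma normr_powR_parallelogram a b p : 0 < p < 2 ->
  `|a + b| `^ p + `|a - b| `^ p <= 2 * `|a| `^ p + 2 * `|b| `^ p.
Proof.
move=> /andP[p0 p2].
have sq z : `|z| `^ p = (z ^+ 2) `^ (p / 2).
  rewrite -real_normK ?num_real// -powR_mulrn// -powRrM; congr (_ `^ _).
  by rewrite mulrC divfK.
have p01 : 0 < p / 2 < 1 by apply/andP; split; lra.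
rewrite !sq; apply: le_trans (powR_mid_le _ _ p01) _; rewrite ?sqr_ge0//.
rewrite (_ : _ / 2 = a ^+ 2 + b ^+ 2); last by field.
by rewrite -mulrDr ler_wpM2l// powR_add_le// sqr_ge0.
Qed.

Lemma expRN_mid_le (x y p q : R) : p + q <= 2 * x + 2 * y ->
  2 * expR (- x) * expR (- y) <= expR (- p) + expR (- q).
Proof.
move=> h.
have h1 : expR (- x) * expR (- y) <= expR (- (p / 2)) * expR (- (q / 2)).
  by rewrite -!expRD ler_expR; lra.
have sq (z : R) : expR (- z) = expR (- (z / 2)) ^+ 2.
  by rewrite expr2 -expRD; congr expR; field.
rewrite (sq p) (sq q).
have := sqr_ge0 (expR (- (p / 2)) - expR (- (q / 2))).
by rewrite sqrrB; lra.
Qed.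

End power_inequalities.

(** * The exponent of a stable vector through its spectral measure *)

Section spectral_measure.
Context {R : realType} (n : nat) (Gamma : {finite_measure set (n.-tuple R) -> \bar R}).
Hypothesis sphere : Gamma [set s : n.-tuple R | \sum_(i < n) tnth s i ^+ 2 != 1] = 0%E.
Variable alpha : R.
Hypothesis alpha02 : 0 < alpha < 2.
Implicit Types u v : 'I_n -> R.

Definition stable_exponent u : R :=
  \int[Gamma]_s (`|\sum_(i < n) u i * tnth s i| `^ alpha).

Let measurable_lin u : measurable_fun setT (fun s : n.-tuple R => \sum_(i < n) u i * tnth s i).
Proof.
apply: measurable_sum => i; apply: measurable_funM => //; exact: measurable_tnth.
Qed.

(** On the unit sphere every coordinate is at most [1] in absolute value, so the integrand is
    bounded there; the complement is [Gamma]-null and [Gamma] is finite. *)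
Let integrable_lin u :
  Gamma.-integrable setT (EFin \o (fun s : n.-tuple R => `|\sum_(i < n) u i * tnth s i| `^ alpha)).
Proof.
have mf : measurable_fun setT
    (fun s : n.-tuple R => `|\sum_(i < n) u i * tnth s i| `^ alpha).
  apply: (measurableT_comp (measurable_powR alpha)).
  by apply: measurableT_comp => //; exact: measurable_lin.
have mN : measurable [set s : n.-tuple R | \sum_(i < n) tnth s i ^+ 2 != 1].
  rewrite (_ : [set _ | _] = (fun s : n.-tuple R => \sum_(i < n) tnth s i ^+ 2) @^-1` ~` [set 1]).
    rewrite -[X in measurable X]setTI; apply: measurable_sum => //.
      by move=> i; apply: measurable_funX; exact: measurable_tnth.
    exact: measurableC.
  by apply/seteqP; split => s /=; move/eqP.
apply/(negligible_integrable mN) => //; first exact/measurable_EFinP.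
apply: (@integrable_normr_le _ _ _ _ _ _ ((\sum_(i < n) `|u i|) `^ alpha)).
- exact: measurableD.
- apply: (@le_lt_trans _ _ (Gamma setT)); last by rewrite ltey_eq fin_num_measure.
  by apply: le_measure; rewrite ?inE//; exact: measurableD.
- exact: measurable_funTS.
move=> s [_ /= /negP]; rewrite negbK => /eqP s1.
rewrite ger0_norm ?powR_ge0// ge0_ler_powR ?nnegrE ?sumr_ge0//.
  by case/andP: alpha02 => /ltW.
rewrite (le_trans (ler_norm_sum _ _ _))// ler_sum// => i _.
rewrite normrM ler_piMr// -(@ler_pXn2r _ 2)// ?nnegrE// expr1n.
rewrite real_normK ?num_real// -s1 (bigD1 i)//=.
by rewrite lerDl sumr_ge0// => j _; exact: sqr_ge0.
Qed.

Lemma stable_exponent_parallelogram u v :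
  stable_exponent (fun i => u i + v i) + stable_exponent (fun i => u i - v i) <=
  2 * stable_exponent u + 2 * stable_exponent v.
Proof.
have iZ (k : R) f : Gamma.-integrable setT (EFin \o f) ->
    Gamma.-integrable setT (EFin \o (fun s => k * f s)).
  by move=> fi; exact: (integrableZl measurableT k fi).
have iD f g : Gamma.-integrable setT (EFin \o f) -> Gamma.-integrable setT (EFin \o g) ->
    Gamma.-integrable setT (EFin \o (fun s => f s + g s)).
  by move=> fi gi; exact: (integrableD measurableT fi gi).
have iu := integrable_lin u; have iv := integrable_lin v.
have ip := integrable_lin (fun i => u i + v i).
have im := integrable_lin (fun i => u i - v i).
rewrite /stable_exponent -(RintegralZl 2 measurableT iu) -(RintegralZl 2 measurableT iv).
rewrite -(RintegralD measurableT ip im) -(RintegralD measurableT (iZ 2 _ iu) (iZ 2 _ iv)).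
apply: le_Rintegral => //; [exact: iD|exact: (iD _ _ (iZ 2 _ iu) (iZ 2 _ iv))|move=> s _].
have lin (c : R) : \sum_(i < n) (u i + c * v i) * tnth s i =
    \sum_(i < n) u i * tnth s i + c * \sum_(i < n) v i * tnth s i.
  by rewrite mulr_sumr -big_split/=; apply: eq_bigr => i _; ring.
have := lin 1; have := lin (-1); rewrite !mulN1r !mul1r.
under eq_bigr do rewrite mulN1r.
move=> ->; under eq_bigr do rewrite mul1r.
by move=> ->; exact: normr_powR_parallelogram.
Qed.

End spectral_measure.

(** * Linear combinations of the process *)

Section stable_span.
Context {R : realType} {d : measure_display} {Omega : measurableType d}
  (P : probability Omega R) {T : Type} (X : T -> Omega -> R) (alpha : R).
Hypothesis alpha02 : 0 < alpha < 2.
Hypothesis SX : SaS_process P alpha X.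

Definition lin_comb n (t : 'I_n -> T) (v : 'I_n -> R) : Omega -> R :=
  fun w => \sum_(i < n) v i * X (t i) w.

Definition process_span : set (Omega -> R) :=
  [set V | exists n (t : 'I_n -> T) (v : 'I_n -> R), V = lin_comb t v].

Lemma measurable_process t : measurable_fun setT (X t).
Proof. by have [/(_ ord0)] := SX (fun _ : 'I_1 => t). Qed.

Lemma measurable_process_span V : process_span V -> measurable_fun setT V.
Proof.
move=> [n [t [v ->]]]; apply: measurable_sum => i.
by apply: measurable_funM => //; exact: measurable_process.
Qed.

(** A spectral measure belongs to one finite family of times, so two combinations become comparable
    once their families are concatenated and their coefficients padded with zeros. *)
Lemma process_span_common V W : process_span V -> process_span W ->
  exists n (t : 'I_n -> T) (v1 v2 : 'I_n -> R), V = lin_comb t v1 /\ W = lin_comb t v2.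
Proof.
move=> [n [t [v ->]]] [m [t' [v' ->]]].
exists (n + m)%N, (fun i => match fintype.split i with inl j => t j | inr j => t' j end),
  (fun i => match fintype.split i with inl j => v j | inr j => 0 end),
  (fun i => match fintype.split i with inl j => 0 | inr j => v' j end).
have sl (i : 'I_n)  : fintype.split (lshift m i) = inl i.
  by rewrite -[lshift m i]/(unsplit (inl i)) unsplitK.
have sr (i : 'I_m)  : fintype.split (rshift n i) = inr i.
  by rewrite -[rshift n i]/(unsplit (inr i)) unsplitK.
split; apply/funext => w; rewrite /lin_comb big_split_ord/=.
- rewrite [X in _ = _ + X]big1 ?addr0; last by move=> i _; rewrite sr mul0r.
  by apply: eq_bigr => i _; rewrite sl.
- rewrite [X in _ = X + _]big1 ?add0r; last by move=> i _; rewrite sl mul0r.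
  by apply: eq_bigr => i _; rewrite sr.
Qed.

Lemma process_span0 : process_span (fun=> 0).
Proof.
have f (i : 'I_0) : T by case: i.
by exists 0%N, f, (fun=> 0); apply/funext => w; rewrite /lin_comb big_ord0.
Qed.

Lemma lin_combD n (t : 'I_n -> T) v1 v2 w :
  lin_comb t v1 w + lin_comb t v2 w = lin_comb t (fun i => v1 i + v2 i) w.
Proof. by rewrite /lin_comb -big_split/=; apply: eq_bigr => i _; rewrite mulrDl. Qed.

Lemma lin_combB n (t : 'I_n -> T) v1 v2 w :
  lin_comb t v1 w - lin_comb t v2 w = lin_comb t (fun i => v1 i - v2 i) w.
Proof. by rewrite /lin_comb -sumrB; apply: eq_bigr => i _; rewrite mulrBl. Qed.

Lemma process_spanD V W : process_span V -> process_span W ->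
  process_span (fun w => V w + W w).
Proof.
move=> LV LW; have [n [t [v1 [v2 [-> ->]]]]] := process_span_common LV LW.
by exists n, t, (fun i => v1 i + v2 i); apply/funext => w; rewrite lin_combD.
Qed.

Lemma process_spanZ (c : R) V : process_span V -> process_span (fun w => c * V w).
Proof.
move=> [n [t [v ->]]]; exists n, t, (fun i => c * v i); apply/funext => w.
by rewrite /lin_comb mulr_sumr; apply: eq_bigr => i _; rewrite mulrA.
Qed.

Lemma process_span_sub s t : process_span (fun w => X t w - X s w).
Proof.
have L1 u : process_span (X u).
  exists 1%N, (fun=> u), (fun=> 1); apply/funext => w.
  by rewrite /lin_comb big_ord1 mul1r.
rewrite (_ : (fun _ => _) = (fun w => X t w + -1 * X s w)).
  by apply: process_spanD => //; exact: process_spanZ.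
by apply/funext => w; rewrite mulN1r.
Qed.

(* Writing [E cos V = exp (- psi V)], the exponent satisfies
   [psi (V + W) + psi (V - W) <= 2 psi V + 2 psi W] because [alpha <= 2]. *)
Lemma process_span_cos V W : process_span V -> process_span W ->
  2 * Ex P (fun w => cos (V w)) * Ex P (fun w => cos (W w)) <=
  Ex P (fun w => cos (V w + W w)) + Ex P (fun w => cos (V w - W w)).
Proof.
move=> LV LW; have [n [t [v1 [v2 [-> ->]]]]] := process_span_common LV LW.
have [_ [Gamma [sphere [_ chf]]]] := SX t.
have E v : Ex P (fun w => cos (lin_comb t v w)) = expR (- stable_exponent Gamma alpha v).
  have [h _] := chf [tuple v i | i < n].
  have e (c : 'I_n -> R) :
      \sum_(i < n) tnth [tuple v i | i < n] i * c i = \sum_(i < n) v i * c i.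
    by apply: eq_bigr => i _; rewrite tnth_mktuple.
  transitivity (fine (\int[P]_w (cos (\sum_(i < n) tnth [tuple v i | i < n] i * X (t i) w))%:E)).
    by congr fine; apply: eq_integral => w _; rewrite e.
  rewrite h/=; congr (expR (- fine _)); apply: eq_integral => s _.
  by rewrite e.
rewrite [X in _ <= Ex P X + _](_ : _ = fun w => cos (lin_comb t (fun i => v1 i + v2 i) w)).
  rewrite [X in _ <= _ + Ex P X](_ : _ = fun w => cos (lin_comb t (fun i => v1 i - v2 i) w)).
    by rewrite !E; apply: expRN_mid_le; exact: stable_exponent_parallelogram.
  by apply/funext => w; rewrite lin_combB.
by apply/funext => w; rewrite lin_combD.
Qed.

End stable_span.

(** * Products of slabs and tails of maxima *)

Section slabs.
Context {R : realType} {d : measure_display} {Omega : measurableType d}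
  (P : probability Omega R) {T : Type} (X : T -> Omega -> R) (alpha : R).
Hypothesis alpha02 : 0 < alpha < 2.
Hypothesis SX : SaS_process P alpha X.
Local Notation Ex := (Ex P).

Definition has_scale (Y : Omega -> R) (r : R) := [/\ process_span X Y, 0 <= r &
  forall u, Ex (fun w => cos (u * Y w)) = expR (- (r `^ alpha * `|u| `^ alpha))].

Let Lmeas := measurable_process_span SX.
Let L0 := process_span0 X.
Let LD := process_spanD (X := X).
Let LZ := process_spanZ (X := X).
Let Lcos := process_span_cos alpha02 SX.
Let a0 : 0 < alpha. Proof. by case/andP: alpha02. Qed.
Let a2 : alpha < 2. Proof. by case/andP: alpha02. Qed.

Lemma Ex_bump_scale Y r c : has_scale Y r -> 0 <= c ->
  Ex (fun w => bump (c * Y w)) = bump_stable alpha (r * c).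
Proof.
move=> [LY r0 EY] c0.
have -> : (fun w => bump (c * Y w)) = (fun w => (fun=> 1) w * bump ((fun w => c * Y w) w)).
  by apply/funext => w; rewrite mul1r.
rewrite Ex_bumpE; [|exact: bmeas_cst|by apply: measurable_funM => //; exact: Lmeas].
apply: eq_Rintegral => u _; congr (_ * _).
have -> : (fun w => 1 * cos (u * (c * Y w))) = (fun w => cos ((u * c) * Y w)).
  by apply/funext => w; rewrite mul1r mulrA.
by rewrite EY normrM (ger0_norm c0) !powRM//; congr (expR (- _)); ring.
Qed.

(** The factor [2 / a i] maps the slab [|Y i| < a i] onto []-2, 2[], outside which [bump]
    vanishes. *)
Definition slab_prod (I : Type) (s : seq I) (Y : I -> Omega -> R) (a : I -> R) :=
  fun w => \prod_(i <- s) bump (2 / a i * Y i w).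

Lemma slab_prod_cons I (i : I) s Y a :
  slab_prod (i :: s) Y a = fun w => slab_prod s Y a w * bump (2 / a i * Y i w).
Proof. by apply/funext => w; rewrite /slab_prod big_cons mulrC. Qed.

Lemma slab_prod01 I (s : seq I) Y a w : 0 <= slab_prod s Y a w <= 1.
Proof.
elim: s => [|i s /andP[h0 h1]]; first by rewrite /slab_prod big_nil ler01 lexx.
by rewrite slab_prod_cons mulr_ge0 ?bump_ge0//= mulr_ile1 ?bump_ge0 ?bump_le1.
Qed.

Lemma slab_prod_supp (I : eqType) (s : seq I) Y a w i : slab_prod s Y a w != 0 ->
  i \in s -> 0 < a i -> `|Y i w| < a i.
Proof.
move=> + si ai; rewrite /slab_prod prodf_seq_neq0 => /allP/(_ i si)/=.
apply: contraR; rewrite -leNgt => h; apply/eqP/bump_supp.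
by rewrite normrM ger0_norm ?divr_ge0 ?(ltW ai)// mulrAC ler_pdivlMr// ler_pM2l.
Qed.

Lemma pos_corr_slab_prod I (s : seq I) Y a (r : I -> R) :
  (forall i, has_scale (Y i) (r i)) -> pos_corr P (process_span X) (slab_prod s Y a).
Proof.
move=> hY; elim: s => [|i s IH].
  have -> : slab_prod [::] Y a = fun=> 1.
    by apply/funext => w; rewrite /slab_prod big_nil.
  exact: pos_corr1.
rewrite slab_prod_cons; apply: (pos_corr_bump Lmeas LD LZ) => //.
by apply: LZ; have [] := hY i.
Qed.

Lemma bmeas_slab_prod I (s : seq I) Y a (r : I -> R) :
  (forall i, has_scale (Y i) (r i)) -> bmeas (slab_prod s Y a).
Proof. by move=> hY; have [] := pos_corr_slab_prod s a hY. Qed.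

Lemma bmeas_bump_scale Y r c : has_scale Y r -> bmeas (fun w => bump (c * Y w)).
Proof. by move=> [LY _ _]; apply/bmeas_bump/Lmeas/LZ. Qed.

(** The Sidak step: one more slab multiplies the mean by at least its own mean. *)
Lemma Ex_slab_prod_bump I (s : seq I) Y a (r : I -> R) Z t c :
  (forall i, has_scale (Y i) (r i)) -> has_scale Z t -> 0 <= c ->
  Ex (slab_prod s Y a) * bump_stable alpha (t * c) <=
  Ex (fun w => slab_prod s Y a w * bump (c * Z w)).
Proof.
move=> hY hZ c0; rewrite -(Ex_bump_scale hZ c0).
have pc := pos_corr_slab_prod s a hY.
by apply: (pos_corr_Ex_bump Lmeas L0 LZ pc (LZ c _)); have [] := hZ.
Qed.

Lemma Ex_slab_prod_ge I (s : seq I) Y a (r q : I -> R) :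
  (forall i, has_scale (Y i) (r i)) -> (forall i, 0 < a i) ->
  (forall i, expR (- q i) <= bump_stable alpha (r i * (2 / a i))) ->
  expR (- \sum_(i <- s) q i) <= Ex (slab_prod s Y a).
Proof.
move=> hY ha hq; elim: s => [|i s IH].
  rewrite big_nil oppr0 expR0 (_ : slab_prod _ _ _ = fun=> 1) ?Ex_cst//.
  by apply/funext => w; rewrite /slab_prod big_nil.
rewrite big_cons opprD expRD slab_prod_cons mulrC.
have c0 : 0 <= 2 / a i by rewrite divr_ge0// ltW.
apply: le_trans (Ex_slab_prod_bump _ _ hY (hY i) c0).
by apply: ler_pM => //; exact: expR_ge0.
Qed.

(** Weighting by slabs does not worsen the tail bound: by positive correlation the weighted mean of
    [1 - bump] is at most the mean weight times the free mean of [1 - bump], and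
    [bump_stable_ge_exp] with [exp (- m) >= 1 - m] bounds the latter. *)
Lemma Ex_slab_prod_tail I (s : seq I) Y a (r : I -> R) Z t x :
  (forall i, has_scale (Y i) (r i)) -> has_scale Z t -> 0 < x ->
  Ex (fun w => slab_prod s Y a w * (1 - bump (2 / x * Z w))) <=
  Ex (slab_prod s Y a) * (bump_mom alpha * (2 * t / x) `^ alpha).
Proof.
move=> hY hZ x0; have c0 : 0 <= 2 / x by rewrite divr_ge0// ltW.
have bG := bmeas_slab_prod s a hY; have bZ := bmeas_bump_scale (2 / x) hZ.
have -> : (fun w => slab_prod s Y a w * (1 - bump (2 / x * Z w))) =
    (fun w => slab_prod s Y a w - slab_prod s Y a w * bump (2 / x * Z w)).
  by apply/funext => w; ring.
rewrite ExB//; last exact: bmeasM.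
have h := Ex_slab_prod_bump s a hY hZ c0.
have G0 : 0 <= Ex (slab_prod s Y a).
  by apply: Ex_ge0 => w; have /andP[] := slab_prod01 s Y a w.
have := bump_stable_ge_exp a0 a2 (t * (2 / x)).
have := expR_ge1Dx (- (bump_mom alpha * (t * (2 / x)) `^ alpha)).
rewrite (_ : t * (2 / x) = 2 * t / x); last by ring.
rewrite -(_ : t * (2 / x) = 2 * t / x); last by ring.
set m := bump_mom _ * _; set b := bump_stable _ _ => h1 h2.
have : 1 - m <= b by apply: le_trans h2.
by move: h; rewrite -/b; nra.
Qed.

(* Dyadic layer-cake: below the slab level [a], the maximum of the [|Z i|] is
   at most [sum_k a 2^-k 1{max >= a 2^-(k+1)}] up to [a 2^-m]; the probability of
   each level is bounded through [min (1, y) <= y^th]. *)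
Variables (Z : nat -> Omega -> R) (t : nat -> R).
Hypothesis hZ : forall i, has_scale (Z i) (t i).

(** A majorant of the indicator that some [|Z i|], [i < N], is at least [x], built from bumps so
    that [Ex_slab_prod_tail] applies to each summand; the cap at [1] is what permits the
    interpolation by the power [th]. *)
Definition level_bump (N : nat) (x : R) : Omega -> R :=
  fun w => Num.min 1 (\sum_(i <- iota 0 N) (1 - bump (2 / x * Z i w))).

Lemma level_bump01 N x w : 0 <= level_bump N x w <= 1.
Proof.
rewrite /level_bump ge_min lexx/= andbT le_min ler01/= sumr_ge0// => i _.
by rewrite subr_ge0 bump_le1.
Qed.

Lemma bmeas_level_bump N x : bmeas (level_bump N x).
Proof.
split; last first.
  exists 1 => w; have /andP[h0 h1] := level_bump01 N x w.
  by rewrite ger0_norm.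
apply: measurable_minr => //.
have [] // : bmeas (fun w => \sum_(i <- iota 0 N) (1 - bump (2 / x * Z i w))).
apply: bmeas_sum => i; apply: bmeasB; first exact: bmeas_cst.
exact: bmeas_bump_scale (hZ i).
Qed.

Lemma level_bump1 N x w i : 0 < x -> (i < N)%N -> x <= `|Z i w| -> level_bump N x w = 1.
Proof.
move=> x0 iN xZ; apply/eqP; rewrite eq_le; have /andP[_ ->] /= := level_bump01 N x w.
rewrite /level_bump le_min lexx/=.
have iI : i \in iota 0 N by rewrite mem_iota.
rewrite (bigD1_seq i)//= ?iota_uniq// bump_supp ?subr0 ?lerDl ?sumr_ge0//.
  by move=> j _; rewrite subr_ge0 bump_le1.
by rewrite normrM ger0_norm ?divr_ge0 ?(ltW x0)// mulrAC ler_pdivlMr// ler_pM2l.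
Qed.

Lemma Ex_level_bump I (s : seq I) Y a (r : I -> R) N (tt x th : R) :
  (forall i, has_scale (Y i) (r i)) -> (forall i, (i < N)%N -> t i <= tt) ->
  0 < x -> 0 <= tt -> 0 <= th <= 1 ->
  Ex (fun w => slab_prod s Y a w * level_bump N x w) <=
  Ex (slab_prod s Y a) * (N%:R * (bump_mom alpha * (2 * tt / x) `^ alpha)) `^ th.
Proof.
move=> hY ttN x0 tt0 /andP[th0 th1].
have bG := bmeas_slab_prod s a hY; have bL := bmeas_level_bump N x.
have G01 := slab_prod01 s Y a.
have G0 : 0 <= Ex (slab_prod s Y a).
  by apply: Ex_ge0 => w; have /andP[] := G01 w.
set y := N%:R * _.
have M0 := bump_mom_ge0 alpha.
have y0 : 0 <= y by rewrite !mulr_ge0// powR_ge0.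
have b1 : Ex (fun w => slab_prod s Y a w * level_bump N x w) <= Ex (slab_prod s Y a).
  apply: Ex_le => //; first exact: bmeasM.
  move=> w; have /andP[? ?] := G01 w; have /andP[? ?] := level_bump01 N x w.
  by rewrite ler_piMr.
have by_ : Ex (fun w => slab_prod s Y a w * level_bump N x w) <= Ex (slab_prod s Y a) * y.
  have bb i : bmeas (fun w => slab_prod s Y a w * (1 - bump (2 / x * Z i w))).
    apply: bmeasM => //; apply: bmeasB; first exact: bmeas_cst.
    exact: bmeas_bump_scale (hZ i).
  apply: (@le_trans _ _ (Ex (fun w => \sum_(i <- iota 0 N)
      (slab_prod s Y a w * (1 - bump (2 / x * Z i w)))))).
    apply: Ex_le; [exact: bmeasM|exact: bmeas_sum|move=> w].
    rewrite -mulr_sumr; apply: ler_wpM2l; first by have /andP[] := G01 w.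
    by rewrite /level_bump ge_min lexx orbT.
  rewrite Ex_sum// /y mulrCA -{2}(size_iota 0 N) -sum1_size natr_sum mulr_suml.
  rewrite big_seq [leRHS]big_seq; apply: ler_sum => i; rewrite mem_iota add0n => /andP[_ iN].
  rewrite mul1r; apply: le_trans (Ex_slab_prod_tail s a hY (hZ i) x0) _.
  have t0 : 0 <= t i by have [] := hZ i.
  rewrite ler_wpM2l// ler_wpM2l//; apply: ge0_ler_powR; first exact: ltW.
  - by rewrite nnegrE divr_ge0 ?mulr_ge0// ltW.
  - by rewrite nnegrE divr_ge0 ?mulr_ge0// ltW.
  - by rewrite ler_pM2r ?invr_gt0// ler_pM2l// ttN.
have [y1|y1] := leP 1 y.
  apply: le_trans b1 _; rewrite ler_peMr//.
  have -> : (1 : R) = 1 `^ th by rewrite powR1.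
  by apply: ge0_ler_powR; rewrite ?nnegrE.
apply: le_trans by_ _; rewrite ler_wpM2l//.
have [->|yn0] := eqVneq y 0; first exact: powR_ge0.
by apply: ger1_powR => //; rewrite lt_neqAle eq_sym yn0 y0 ltW.
Qed.

Definition dyadic_bound (m N : nat) (a : R) : Omega -> R := fun w =>
  a / 2 ^+ m + \sum_(k <- iota 0 m) a / 2 ^+ k * level_bump N (a / 2 ^+ k.+1) w.

Lemma dyadic_boundS m N a w : dyadic_bound m.+1 N a w =
  dyadic_bound m N a w - a / 2 ^+ m + a / 2 ^+ m.+1
    + a / 2 ^+ m * level_bump N (a / 2 ^+ m.+1) w.
Proof.
have it : iota 0 m.+1 = iota 0 m ++ [:: m] by rewrite -addn1 iotaD.
rewrite /dyadic_bound it big_cat/= big_seq1; ring.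
Qed.

Lemma dyadic_bound_ge0 m N a w : 0 <= a -> 0 <= dyadic_bound m N a w.
Proof.
move=> a0'; rewrite addr_ge0 ?divr_ge0 ?exprn_ge0// sumr_ge0// => k _.
by rewrite mulr_ge0 ?divr_ge0 ?exprn_ge0//; have /andP[] := level_bump01 N (a / 2 ^+ k.+1) w.
Qed.

Lemma le_dyadic_bound m N a w i : 0 < a -> (i < N)%N -> `|Z i w| <= a ->
  `|Z i w| <= dyadic_bound m N a w.
Proof.
move=> a0' iN Za; elim: m => [|m IH].
  by rewrite /dyadic_bound/= big_nil addr0 expr0 divr1.
have am : 0 < a / 2 ^+ m by rewrite divr_gt0 ?exprn_gt0.
have am1 : 0 < a / 2 ^+ m.+1 by rewrite divr_gt0 ?exprn_gt0.
rewrite dyadic_boundS.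
(* Above the half level, the new summand [a / 2^m] makes up for the lost remainder; below it, the
   remainder [a / 2^(m + 1)] alone suffices. *)
have [h|h] := leP (a / 2 ^+ m.+1) `|Z i w|.
  by rewrite (level_bump1 am1 iN h) mulr1; lra.
have /andP[l0 _] := level_bump01 N (a / 2 ^+ m.+1) w.
have := mulr_ge0 (ltW am) l0.
have : 0 <= dyadic_bound m N a w - a / 2 ^+ m.
  rewrite /dyadic_bound addrAC subrr add0r sumr_ge0// => k _.
  rewrite mulr_ge0 ?divr_ge0 ?exprn_ge0 ?(ltW a0')//.
  by have /andP[] := level_bump01 N (a / 2 ^+ k.+1) w.
lra.
Qed.

Lemma bmeas_dyadic_bound m N a : bmeas (dyadic_bound m N a).
Proof.
apply: bmeasD; first exact: bmeas_cst.
by apply: bmeas_sum => k; apply: bmeasM; [exact: bmeas_cst|exact: bmeas_level_bump].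
Qed.

Lemma geometric_sum_le (q : R) m : 0 <= q < 1 ->
  \sum_(k <- iota 0 m) q ^+ k <= (1 - q)^-1.
Proof.
move=> /andP[q0 q1].
have e : (1 - q) * \sum_(k <- iota 0 m) q ^+ k = 1 - q ^+ m.
  elim: m => [|m IH]; first by rewrite big_nil expr0 mulr0 subrr.
  by rewrite -[in LHS]addn1 iotaD big_cat/= big_seq1 add0n mulrDr IH exprS; ring.
rewrite -[leRHS]mul1r ler_pdivlMr ?subr_gt0// mulrC e.
by rewrite gerBl exprn_ge0.
Qed.

(** The layers form a geometric series of ratio [2^(alpha th - 1)], whence the denominator. The base
    [4] is the [2] of the factor [2 / x] times the [2] of the halved level [a / 2^(k + 1)]. *)
Definition dyadic_cst (th : R) : R :=
  bump_mom alpha `^ th * 4 `^ (alpha * th) / (1 - 2 `^ (alpha * th - 1)).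

Lemma dyadic_term (N k : nat) (a tt th : R) : 0 < a -> 0 <= tt ->
  a / 2 ^+ k * (N%:R * (bump_mom alpha * (2 * tt / (a / 2 ^+ k.+1)) `^ alpha)) `^ th =
  bump_mom alpha `^ th * 4 `^ (alpha * th) * (N%:R * tt `^ alpha) `^ th *
    a `^ (1 - alpha * th) * (2 `^ (alpha * th - 1)) ^+ k.
Proof.
move=> a0' tt0; have M0 := bump_mom_ge0 alpha.
have av0 : 0 <= a^-1 by rewrite invr_ge0 ltW.
have p2 : 0 <= (2 : R) ^+ k by rewrite exprn_ge0.
have -> : 2 * tt / (a / 2 ^+ k.+1) = 4 * tt * 2 ^+ k * a^-1.
  by rewrite exprS; field; rewrite expf_neq0//= gt_eqF.
rewrite !powRM ?mulr_ge0 ?powR_ge0// -!powRrM.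
have -> : a `^ (1 - alpha * th) = a * (a^-1) `^ (alpha * th).
  rewrite powRB; last by rewrite (gt_eqF a0') implybT.
  rewrite powRr1 ?(ltW a0')// -(powR_inv1 (ltW a0')) -powRrM mulN1r powRN//.
have -> : (2 : R) `^ (alpha * th - 1) ^+ k = (2 ^+ k) `^ (alpha * th) / 2 ^+ k.
  rewrite powRB; last by rewrite pnatr_eq0 implybT.
  rewrite powRr1// exprMn exprVn -!powR_mulrn ?powR_ge0//.
  by rewrite -!powRrM (mulrC k%:R).
by ring.
Qed.

Lemma Ex_dyadic_bound I (s : seq I) Y c (r : I -> R) (m N : nat) (a tt th : R) :
  (forall i, has_scale (Y i) (r i)) -> (forall i, t i <= tt) ->
  0 < a -> 0 <= tt -> 0 <= th <= 1 -> alpha * th < 1 ->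
  Ex (fun w => slab_prod s Y c w * dyadic_bound m N a w) <= Ex (slab_prod s Y c) *
    (a / 2 ^+ m + dyadic_cst th * (N%:R * tt `^ alpha) `^ th * a `^ (1 - alpha * th)).
Proof.
move=> hY ttN a0' tt0 th01 ath.
have bG := bmeas_slab_prod s c hY.
have G0 : 0 <= Ex (slab_prod s Y c).
  by apply: Ex_ge0 => w; have /andP[] := slab_prod01 s Y c w.
have bL k : bmeas (fun w => a / 2 ^+ k * (slab_prod s Y c w * level_bump N (a / 2 ^+ k.+1) w)).
  by apply: bmeasM; [exact: bmeas_cst|apply: bmeasM => //; exact: bmeas_level_bump].
have -> : (fun w => slab_prod s Y c w * dyadic_bound m N a w) = (fun w =>
    a / 2 ^+ m * slab_prod s Y c w +
    \sum_(k <- iota 0 m) a / 2 ^+ k * (slab_prod s Y c w * level_bump N (a / 2 ^+ k.+1) w)).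
  apply/funext => w; rewrite /dyadic_bound mulrDr mulr_sumr; congr (_ + _); first ring.
  by apply: eq_bigr => k _; ring.
rewrite ExD; [|by apply: bmeasM => //; exact: bmeas_cst|exact: bmeas_sum].
rewrite ExZ// Ex_sum// mulrDr lerD//; first by rewrite mulrC.
set q := (2 : R) `^ (alpha * th - 1).
have q01 : 0 <= q < 1.
  rewrite powR_ge0 /q (_ : alpha * th - 1 = - (1 - alpha * th)); last ring.
  rewrite powRN invf_lt1 ?powR_gt0//=.
  by rewrite /powR gt_eqF// expR_gt1 mulr_gt0 ?ln_gt0 ?subr_gt0 ?ltr1n.
set C0 := bump_mom alpha `^ th * 4 `^ (alpha * th) * (N%:R * tt `^ alpha) `^ th *
    a `^ (1 - alpha * th).
have C00 : 0 <= C0 by rewrite !mulr_ge0 ?powR_ge0.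
apply: (@le_trans _ _ (Ex (slab_prod s Y c) * (C0 * \sum_(k <- iota 0 m) q ^+ k))).
  rewrite mulr_sumr mulr_sumr; apply: ler_sum => k _.
  have x0 : 0 < a / 2 ^+ k.+1 by rewrite divr_gt0// exprn_gt0.
  rewrite ExZ; last by apply: bmeasM => //; exact: bmeas_level_bump.
  rewrite /C0 /q -dyadic_term// mulrCA ler_wpM2l ?divr_ge0 ?exprn_ge0 ?(ltW a0')//.
  exact: Ex_level_bump.
rewrite ler_wpM2l//; apply: le_trans (ler_wpM2l C00 (geometric_sum_le m q01)) _.
by rewrite /C0 /dyadic_cst -/q; lra.
Qed.

End slabs.

(** * Chaining *)

Section chaining.
Context {R : realType} {d : measure_display} {Omega : measurableType d}
  (P : probability Omega R) {T : Type} (X : T -> Omega -> R) (alpha : R).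
Hypothesis alpha02 : 0 < alpha < 2.
Hypothesis SX : SaS_process P alpha X.
Local Notation Ex := (Ex P).

Variables (Z : nat -> nat -> Omega -> R) (t : nat -> nat -> R) (N : nat -> nat).
Variables (tt A q : nat -> R) (th b : R) (J1 : nat).
Hypothesis hZ : forall j i, has_scale P X alpha (Z j i) (t j i).
Hypothesis ht : forall j i, t j i <= tt j.
Hypothesis A0 : forall j, 0 < A j.
Hypothesis hq : forall j i, expR (- q j) <= bump_stable alpha (t j i * (2 / A j)).
Hypotheses (th01 : 0 <= th <= 1) (ath : alpha * th < 1) (b0 : 0 < b).
Hypothesis hsum : forall J, \sum_(J1 <= j < J)
  dyadic_cst alpha th * ((N j)%:R * tt j `^ alpha) `^ th * A j `^ (1 - alpha * th) <= b / 4.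

Definition level_max j w : R := \big[Num.max/0]_(i <- iota 0 (N j)) `|Z j i w|.

(** Below [J1] the slab widths themselves will be summed; from [J1] on the slabs only cap the
    layer-cake, and the sum of the maxima is constrained separately. *)
Definition chain_event J : set Omega :=
  [set w | (forall j i, (j < J)%N -> (i < N j)%N -> `|Z j i w| <= A j) /\
           \sum_(J1 <= j < J) level_max j w <= b].

Let mZ j i : measurable_fun setT (Z j i).
Proof. by have [LZ _ _] := hZ j i; exact: (measurable_process_span SX). Qed.

Let measurable_level_max j : measurable_fun setT (level_max j).
Proof.
rewrite /level_max; elim: (iota 0 (N j)) => [|i s IH].
  rewrite (_ : (fun _ => _) = fun=> 0)//; apply/funext => w.
  by rewrite big_nil.
rewrite (_ : (fun _ => _) = (fun w => Num.max `|Z j i w| (\big[Num.max/0]_(k <- s) `|Z j k w|))).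
  by apply: measurable_maxr => //; exact: measurableT_comp.
by apply/funext => w; rewrite big_cons.
Qed.

Lemma level_max_ge j i w : (i < N j)%N -> `|Z j i w| <= level_max j w.
Proof. by move=> iN; apply: (le_bigmax_seq 0 i predT (fun k => `|Z j k w|)); rewrite // mem_iota. Qed.

Lemma level_max_ge0 j w : 0 <= level_max j w.
Proof. by rewrite /level_max bigmax_ge_id. Qed.

Lemma measurable_chain_event J : measurable (chain_event J).
Proof.
rewrite (_ : chain_event J = (\bigcap_j \bigcap_i
    [set w | (j < J)%N -> (i < N j)%N -> `|Z j i w| <= A j]) `&`
    [set w | \sum_(J1 <= j < J) level_max j w <= b]); last first.
  by apply/seteqP; split => w [h1 h2]; split => // j; [move=> _ i _|move=> i]; exact: h1.
apply: measurableI.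
  apply: bigcapT_measurable => j; apply: bigcapT_measurable => i.
  have [jJ|jJ] := boolP (j < J)%N; last first.
    by rewrite (_ : [set _ | _] = setT)//; apply/seteqP; split.
  have [iN|iN] := boolP (i < N j)%N; last first.
    by rewrite (_ : [set _ | _] = setT)//; apply/seteqP; split.
  rewrite (_ : [set _ | _] = [set w | `|Z j i w| <= A j]); last first.
    by apply/seteqP; split => w /= h //; exact: h.
  rewrite -[X in measurable X]setTI; apply: measurable_fun_le => //.
  exact: measurableT_comp.
rewrite -[X in measurable X]setTI; apply: measurable_fun_le => //.
exact: measurable_sum.
Qed.

(** Markov's inequality for the weight [G], the product of all slabs. [G * (1 - S / b)] is at most
    the indicator of the event, since off it either [G = 0] or [S >= b]; its mean is at least half
    that of [G], because [E (G S) <= b / 2 * E G]. *)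
Lemma chain_event_prob J :
  ((expR (- \sum_(0 <= j < J) (N j)%:R * q j) / 2)%:E <= P (chain_event J))%E.
Proof.
pose s := [seq (j, i) | j <- iota 0 J, i <- iota 0 (N j)].
pose Y (l : nat * nat) := Z l.1 l.2.
pose a (l : nat * nat) := A l.1.
have hY l : has_scale P X alpha (Y l) (t l.1 l.2) by exact: hZ.
set G := slab_prod s Y a.
have G01 w : 0 <= G w <= 1 by exact: slab_prod01.
have bG : bmeas G by exact: (bmeas_slab_prod alpha02 SX s a hY).
have EG : expR (- \sum_(0 <= j < J) (N j)%:R * q j) <= Ex G.
  have := Ex_slab_prod_ge alpha02 SX s (a := a) (q := fun l => q l.1) hY
    (fun l => A0 l.1) (fun l => hq l.1 l.2).
  rewrite big_allpairs_dep/= /index_iota subn0.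
  rewrite (eq_bigr (fun j => (N j)%:R * q j))// => j _.
  by rewrite big_const_seq count_predT size_iota iter_addr_0 mulr_natl.
have G0 : 0 <= Ex G by apply: le_trans EG; exact: expR_ge0.
have A00 j := ltW (A0 j).
(* The layer-cake is truncated where its total remainder is at most [b / 4]; with the [b / 4] of
   [hsum] this makes [b / 2]. *)
have [m hm] : exists m, (\sum_(J1 <= j < J) A j) / 2 ^+ m <= b / 4.
  pose S := \sum_(J1 <= j < J) A j.
  have S0 : 0 <= S by rewrite sumr_ge0.
  exists (Num.Def.truncn (S / (b / 4))).+1.
  rewrite ler_pdivrMr ?exprn_gt0// mulrC -ler_pdivrMr ?divr_gt0//.
  apply: le_trans (ltW (truncnS_gt _)) _.
  by rewrite -natrX ler_nat ltnW// ltn_expl.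
pose D j := dyadic_bound (Z j) m (N j) (A j).
have bD j : bmeas (D j) by exact: (bmeas_dyadic_bound SX (hZ j)).
pose S w := \sum_(J1 <= j < J) D j w.
have bS : bmeas S by exact: bmeas_sum.
have S0 w : 0 <= S w.
  by apply: sumr_ge0 => j _; exact: dyadic_bound_ge0.
have EGS : Ex (fun w => G w * S w) <= Ex G * (b / 2).
  rewrite (_ : (fun _ => _) = (fun w => \sum_(J1 <= j < J) G w * D j w)); last first.
    by apply/funext => w; rewrite mulr_sumr.
  rewrite Ex_sum; last by move=> j; exact: bmeasM.
  apply: (@le_trans _ _ (\sum_(J1 <= j < J) Ex G * (A j / 2 ^+ m +
      dyadic_cst alpha th * ((N j)%:R * tt j `^ alpha) `^ th * A j `^ (1 - alpha * th)))).
    apply: ler_sum => j _; apply: (Ex_dyadic_bound alpha02 SX (hZ j) s a m (N j) hY (ht j) (A0 j) _ th01 ath).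
    by apply: le_trans (ht j 0%N); have [] := hZ j 0%N.
  rewrite -mulr_sumr big_split/= -mulr_suml ler_wpM2l//.
  by have := hsum J; lra.
have bF : bmeas (fun w => G w * (1 - b^-1 * S w)).
  apply: bmeasM => //; apply: bmeasB; first exact: bmeas_cst.
  by apply: bmeasM => //; exact: bmeas_cst.
apply: (@le_trans _ _ (Ex (fun w => G w * (1 - b^-1 * S w)))%:E).
  rewrite lee_fin (_ : (fun _ => _) = (fun w => G w - b^-1 * (G w * S w))); last first.
    by apply/funext => w; ring.
  have bGS : bmeas (fun w => G w * S w) by exact: bmeasM.
  rewrite ExB//; last by apply: bmeasM => //; exact: bmeas_cst.
  rewrite ExZ//; have : b^-1 * Ex (fun w => G w * S w) <= Ex G / 2.
    by rewrite mulrC ler_pdivrMr//; lra.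
  lra.
apply: le_Ex_prob => //; first exact: measurable_chain_event.
move=> w; have /andP[g0 g1] := G01 w.
have bv : 0 < b^-1 by rewrite invr_gt0.
rewrite indicE; have [_|/negP wn] := boolP (w \in chain_event J).
  have -> : true%:R = 1 :> R by [].
  by have := mulr_ge0 g0 (mulr_ge0 (ltW bv) (S0 w)); lra.
have [->|Gn0] := eqVneq (G w) 0; first by rewrite mul0r.
apply: mulr_ge0_le0 => //; rewrite subr_le0 mulrC ler_pdivlMr// mul1r.
have hs j i : (j < J)%N -> (i < N j)%N -> `|Z j i w| <= A j.
  move=> jJ iN; have sji : (j, i) \in s.
    by apply/allpairsPdep; exists j, i; rewrite !mem_iota.
  exact: ltW (slab_prod_supp Gn0 sji (A0 j)).
rewrite leNgt; apply/negP => Sb; apply: wn; rewrite inE; split => //.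
apply: le_trans (ltW Sb); rewrite /S !big_nat; apply: ler_sum => j /andP[_ jJ].
rewrite /level_max big_seq; apply: bigmax_le => [|i]; first exact: dyadic_bound_ge0.
by rewrite mem_iota => /andP[_ iN]; apply: le_dyadic_bound => //; exact: hs.
Qed.

(** Continuity from above: the events decrease with [J], and the lower bound is uniform in [J]. *)
Lemma chain_event_cap (Q : R) :
  (forall J, \sum_(0 <= j < J) (N j)%:R * q j <= Q) ->
  ((expR (- Q) / 2)%:E <= P (\bigcap_J chain_event J))%E.
Proof.
move=> hQ.
have mE := measurable_chain_event.
have cvgE : P (chain_event J) @[J --> \oo] --> P (\bigcap_J chain_event J).
  apply: nonincreasing_cvg_mu => //.
  - by rewrite (le_lt_trans (probability_le1 P (mE 0%N)))// ltry.
  - exact: bigcapT_measurable.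
  move=> J J' JJ'; apply/subsetPset => w [h1 h2]; split.
    by move=> j i jJ; apply: h1; exact: leq_trans JJ'.
  (* For [J < J1] the sum of maxima is empty, and [0 <= b]. *)
  have [J1J|J1J] := leqP J1 J; last first.
    by rewrite big_geq ?(ltW b0)// ltnW.
  apply: le_trans h2; rewrite (big_cat_nat J1J JJ')/= lerDl sumr_ge0// => j _.
  exact: level_max_ge0.
have <- := cvg_lim (@ereal_hausdorff R) cvgE.
apply: lime_ge; first by apply/cvg_ex; eexists; exact: cvgE.
apply: nearW => J; apply: le_trans (chain_event_prob J).
by rewrite lee_fin ler_pM2r ?invr_gt0// ler_expR lerN2.
Qed.

End chaining.

(** * Comparison of the cost with the rate *)

Section sums_of_powers.
Context {R : realType}.
Implicit Types (p g : R) (n j J : nat).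

Lemma ln_succ_ge n : (0 < n)%N -> ln (n%:R : R) + n.+1%:R^-1 <= ln (n.+1%:R : R).
Proof.
move=> n0; have N0 : 0 < (n.+1%:R : R) by rewrite ltr0n.
have e : 1 + - n.+1%:R^-1 = n%:R / n.+1%:R :> R.
  by rewrite -[n%:R in RHS](addrK 1) natr1 mulrBl mulfV ?gt_eqF// mul1r.
have v1 : -1 < - n.+1%:R^-1 :> R by rewrite ltrN2 invf_lt1// ltr1n ltnS.
have := le_ln1Dx v1; rewrite e ln_div ?posrE ?ltr0n//.
by move: (n.+1%:R^-1) (ln n.+1%:R) (ln n%:R) => v x y; lra.
Qed.

Lemma powR_nat n p : (0 < n)%N -> (n%:R : R) `^ p = expR (p * ln n%:R).
Proof. by move=> n0; rewrite /powR pnatr_eq0 gtn_eqF. Qed.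

(** Discrete counterpart of integrating [s^(- p)] from [n] to [n + 1], deduced from
    [ln (n + 1) - ln n >= 1 / (n + 1)]. *)
Lemma powR_succ_gt1 p n : 1 < p -> (0 < n)%N ->
  (n.+1%:R : R) `^ (- p) <= (n%:R `^ (1 - p) - n.+1%:R `^ (1 - p)) / (p - 1).
Proof.
move=> p1 n0; have N0 : 0 < (n.+1%:R : R) by rewrite ltr0n.
rewrite ler_pdivlMr ?subr_gt0//.
have e1 : (n.+1%:R : R) `^ (- p) = n.+1%:R `^ (1 - p) * n.+1%:R^-1.
  rewrite -powR_inv1 ?ler0n// -powRD ?pnatr_eq0 ?implybT//; congr (_ `^ _); ring.
have h : (n.+1%:R : R) `^ (1 - p) * (1 + (p - 1) * n.+1%:R^-1) <= n%:R `^ (1 - p).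
  rewrite !powR_nat//; apply: (@le_trans _ _ (expR ((1 - p) * ln n.+1%:R + (p - 1) * n.+1%:R^-1))).
    by rewrite expRD ler_wpM2l ?expR_ge0// expR_ge1Dx.
  have := ln_succ_ge n0; rewrite ler_expR.
  move: (n.+1%:R^-1) (ln n.+1%:R) (ln n%:R) => v y z; nra.
by rewrite e1; move: h; move: (n.+1%:R^-1 : R) => v; lra.
Qed.

(** The increment of the power is at least [(1 - g) / (n + 1) * n^(1 - g)]; the factor [2] pays for
    replacing [n^(1 - g)] by [(n + 1)^(1 - g)] there. *)
Lemma powR_succ_lt1 g n : 0 < g < 1 -> (0 < n)%N ->
  (n.+1%:R : R) `^ (- g) <= 2 / (1 - g) * (n.+1%:R `^ (1 - g) - n%:R `^ (1 - g)).
Proof.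
move=> /andP[g0 g1] n0; set q := 1 - g; have q0 : 0 < q by rewrite subr_gt0.
have N0 : 0 < (n.+1%:R : R) by rewrite ltr0n.
have e1 : (n.+1%:R : R) `^ (- g) = n.+1%:R `^ q * n.+1%:R^-1.
  rewrite -powR_inv1 ?ler0n// -powRD ?pnatr_eq0 ?implybT//; congr (_ `^ _).
  by rewrite /q; ring.
set v := (n.+1%:R : R)^-1; have v0 : 0 < v by rewrite invr_gt0.
have v1 : v <= 1 by rewrite invf_le1// ler1n.
have h : (n%:R : R) `^ q * (1 + q * v) <= n.+1%:R `^ q.
  rewrite !powR_nat//; apply: (@le_trans _ _ (expR (q * ln n%:R + q * v))).
    by rewrite expRD ler_wpM2l ?expR_ge0// expR_ge1Dx.
  by rewrite ler_expR -mulrDr ler_pM2l//; exact: ln_succ_ge.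
rewrite e1 -/v mulrAC ler_pdivlMr//.
set a := n.+1%:R `^ q in h *; set c := n%:R `^ q in h *.
have c0 : 0 <= c by exact: powR_ge0.
have qv : q * v <= 1 by rewrite mulr_ile1// ?ltW// /q; lra.
have qv0 : 0 < q * v by rewrite mulr_gt0.
have : 0 <= a - c by nra.
nra.
Qed.

Lemma inv_succ_le n : (0 < n)%N -> (n.+1%:R : R) `^ (- 1) <= ln n.+1%:R - ln n%:R.
Proof. by move=> n0; rewrite powR_inv1// lerBrDr addrC; exact: ln_succ_ge. Qed.

(** The step bound at [n.+1] involves [G n], so a sum starting at [n0 + J1] telescopes from the
    predecessor; [1 < n0 + J1] keeps that predecessor positive. *)
Lemma telescope_le (F G : nat -> R) n0 J1 J : (1 < n0 + J1)%N -> (J1 <= J)%N ->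
  (forall n, (0 < n)%N -> F n.+1 <= G n.+1 - G n) ->
  \sum_(J1 <= j < J) F (n0 + j)%N <= G (n0 + J).-1 - G (n0 + J1).-1.
Proof.
move=> n01 J1J FG.
apply: (@le_trans _ _ (\sum_(J1 <= j < J) (G (n0 + j.+1).-1 - G (n0 + j).-1))).
  rewrite !big_nat; apply: ler_sum => j /andP[J1j _].
  have lt : (1 < n0 + j)%N by apply: leq_trans n01 _; rewrite leq_add2l.
  rewrite addnS/=; have := FG (n0 + j).-1.
  by rewrite prednK; [apply; rewrite -ltnS prednK//|]; exact: ltn_trans lt.
by rewrite (telescope_sumr (fun j => G (n0 + j).-1)).
Qed.

Lemma sum_powR_gt1 p n0 J1 J : 1 < p -> (1 < n0 + J1)%N ->
  \sum_(J1 <= j < J) ((n0 + j)%:R : R) `^ (- p) <= ((n0 + J1).-1%:R : R) `^ (1 - p) / (p - 1).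
Proof.
move=> p1 n01; have pp : 0 < p - 1 by rewrite subr_gt0.
have [J1J|JJ1] := leqP J1 J; last first.
  by rewrite big_geq 1?ltnW// divr_ge0 ?powR_ge0// ltW.
apply: le_trans (telescope_le (F := fun n => (n%:R : R) `^ (- p))
  (G := fun n => - ((n%:R : R) `^ (1 - p) / (p - 1))) n01 J1J _) _.
  by move=> n n0'; have := powR_succ_gt1 p1 n0'; lra.
by rewrite opprK gerDr oppr_le0 divr_ge0 ?powR_ge0// ltW.
Qed.

Lemma sum_powR_lt1 g n0 J : 0 < g < 1 -> (0 < n0)%N -> (0 < J)%N ->
  \sum_(1 <= j < J) ((n0 + j)%:R : R) `^ (- g) <=
  2 / (1 - g) * ((n0 + J).-1%:R : R) `^ (1 - g).
Proof.
move=> g01 n00 J0; have n01 : (1 < n0 + 1)%N by rewrite addn1 ltnS.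
have g1 : 0 < 1 - g by have /andP[] := g01; lra.
apply: le_trans (telescope_le (F := fun n => (n%:R : R) `^ (- g))
  (G := fun n => 2 / (1 - g) * (n%:R : R) `^ (1 - g)) n01 J0 _) _.
  by move=> n n0'; have := powR_succ_lt1 g01 n0'; lra.
by rewrite gerBl mulr_ge0 ?powR_ge0// divr_ge0// ltW.
Qed.

Lemma sum_powR_eq1 n0 J : (0 < n0)%N -> (0 < J)%N ->
  \sum_(1 <= j < J) ((n0 + j)%:R : R) `^ (- 1) <= ln ((n0 + J).-1%:R : R).
Proof.
move=> n00 J0; have n01 : (1 < n0 + 1)%N by rewrite addn1 ltnS.
apply: le_trans (telescope_le (F := fun n => (n%:R : R) `^ (- 1))
  (G := fun n => ln (n%:R : R)) n01 J0 _) _.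
  by move=> n n0'; exact: inv_succ_le.
by rewrite gerBl addn1/= ln_ge0// ler1n.
Qed.

Lemma powR_le_expR (k s : R) : 0 < k -> 0 <= s ->
  exists2 K, 0 < K & forall l, 0 < l -> l `^ s <= K * expR (k * l).
Proof.
move=> k0; rewrite le_eqVlt => /predU1P[<-|s0].
  exists 1 => // l l0; rewrite powRr0 mul1r -expR0 ler_expR.
  by rewrite mulr_ge0// ltW.
have sk : 0 < s / k by rewrite divr_gt0.
exists ((s / k) `^ s) => [|l l0]; first by rewrite powR_gt0.
have -> : expR (k * l) = (expR (k * l / s)) `^ s.
  by rewrite /powR gt_eqF ?expR_gt0// expRK; congr expR; field; rewrite gt_eqF.
rewrite -powRM ?expR_ge0 ?(ltW sk)//.
apply: ge0_ler_powR; rewrite ?nnegrE ?mulr_ge0 ?expR_ge0 ?invr_ge0 ?(ltW k0) ?(ltW sk) ?(ltW s0) ?(ltW l0)//.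
have h : k * l / s <= expR (k * l / s) by have := expR_ge1Dx (k * l / s); lra.
apply: le_trans (ler_wpM2l (ltW sk) h).
by rewrite le_eqVlt; apply/orP; left; apply/eqP; field; rewrite !gt_eqF.
Qed.

End sums_of_powers.

(** * The three regimes of the rate *)

Section small_ball_rate.
Context {R : realType}.
Variables alpha beta : R.
Hypotheses (alpha0 : 0 < alpha) (beta1 : 1 < beta) (ab : alpha < beta).

Definition rate (e : R) : R :=
  if beta < 1 + alpha then e `^ (- (1 / (beta / alpha - 1)))
  else if beta == 1 + alpha
       then e `^ (- alpha) * `|ln e| `^ (1 + alpha)
       else e `^ (- alpha) * `|ln e| `^ (- beta + 1 + alpha).

(** The solution [x] of [x^(beta - alpha) = e^(- alpha)]. This balance makes the tail cost
    [(e / x)^(- alpha) x^(1 - beta)] equal to [x] and the tail expectation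
    [(e / x)^(1 - alpha th) x^(1 - beta th)] equal to [e], the latter for every [th]. *)
Definition cutoff (e : R) : R := e `^ (- (alpha / (beta - alpha))).

Lemma powR_lnE (e s : R) : 0 < e -> e `^ s = expR (s * ln e).
Proof. by move=> e0; rewrite /powR gt_eqF. Qed.

Lemma cutoff_powR e s : 0 < e -> cutoff e `^ s = e `^ (- (alpha / (beta - alpha) * s)).
Proof. by move=> e0; rewrite /cutoff -powRrM mulNr. Qed.

Let g := beta / (1 + alpha).
Let ap := alpha / (beta - alpha).
Let W (n0 n1 : nat) : R := \sum_(1 <= j < (n1 - n0).+1) ((n0 + j)%:R : R) `^ (- g).

Let cost (e : R) (n0 n1 : nat) : R :=
  e `^ (- alpha) * `|ln e| `^ (1 - beta) + e `^ (- alpha) * W n0 n1 `^ (1 + alpha) + cutoff e.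

Let a1 : 0 < 1 + alpha. Proof. by rewrite addr_gt0. Qed.

Let ba0 : 0 < beta - alpha. Proof. by rewrite subr_gt0. Qed.

Let ap0 : 0 < ap. Proof. by rewrite divr_gt0. Qed.

Let g0 : 0 < g. Proof. by rewrite divr_gt0// (lt_trans ltr01). Qed.

Let lnl (e : R) : 0 < e < expR (- 1) -> 1 <= - ln e /\ `|ln e| = - ln e.
Proof.
move=> /andP[e0 e1]; have : ln e <= -1.
  by rewrite -[leRHS]expRK ler_ln ?posrE ?expR_gt0// ltW.
by move=> h; split; [lra|rewrite ler0_norm//; lra].
Qed.

Lemma cutoff_expR (e : R) : 0 < e -> cutoff e = expR (ap * - ln e).
Proof. by move=> e0; rewrite /cutoff powR_lnE// mulNr mulrN. Qed.

Lemma cutoff_ge1 (e : R) : 0 < e < expR (- 1) -> 1 <= cutoff e.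
Proof.
move=> he; have [l1 _] := lnl he; have /andP[e0 _] := he.
by rewrite cutoff_expR// -expR0 ler_expR mulr_ge0 ?(ltW ap0)//; lra.
Qed.

Let nn (n0 n1 : nat) : (n0 <= n1)%N -> (n0 + (n1 - n0).+1).-1 = n1.
Proof. by move=> h; rewrite addnS/= subnKC. Qed.

Let W0 (n0 n1 : nat) : 0 <= W n0 n1.
Proof. by apply: sumr_ge0 => j _; exact: powR_ge0. Qed.

Let n0p (e : R) (n0 : nat) : 0 < e < expR (- 1) -> - ln e <= n0%:R -> (0 < n0)%N.
Proof. by move=> he ln0; have [l1 _] := lnl he; rewrite -(ltr0n R); lra. Qed.

(** All terms are bounded by multiples of [x = cutoff e]. Since [e^(- alpha) = x^(beta - alpha)]
    with [beta - alpha < 1], the first term is at most [x]. As [g < 1], the sum [W] is at most a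
    multiple of [x^(1 - g)], and [(1 - g) (1 + alpha) = 1 + alpha - beta] turns the second term into
    a multiple of [x]. *)
Lemma rate_bound_lt (L : R) : 1 <= L -> beta < 1 + alpha ->
  exists2 K, 0 < K & forall e, 0 < e < expR (- 1) -> forall n0 n1 : nat, (n0 <= n1)%N -> - ln e <= n0%:R -> n1%:R <= 2 * L * cutoff e ->
  cost e n0 n1 <= K * (e `^ (- (1 / (beta / alpha - 1)))).
Proof.
move: alpha0 beta1 ab a1 ba0 ap0 g0 => alpha0' beta1' ab' a1' ba0' ap0' g0' L1.
have L0 : 0 < 2 * L by rewrite mulr_gt0//; lra.
move=> bl.
have g1 : 0 < 1 - g by rewrite subr_gt0 /g ltr_pdivrMr// mul1r.
have gg : 0 < g < 1 by rewrite g0; lra.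
pose k := 2 / (1 - g) * (2 * L) `^ (1 - g).
have k0 : 0 <= k by rewrite mulr_ge0 ?powR_ge0// divr_ge0// ltW.
exists (2 + k `^ (1 + alpha)) => [|e he n0 n1 n01 hn0 hn1].
  by have := powR_ge0 k (1 + alpha); lra.
rewrite /cost; have [l1 ->] := lnl he; have /andP[e0 _] := he; have xe1 := cutoff_ge1 he.
have xe0 : 0 <= cutoff e by lra.
rewrite (_ : 1 / (beta / alpha - 1) = ap); last by rewrite /ap; field; rewrite !gt_eqF//; lra.
rewrite -/(cutoff e).
have ea : e `^ (- alpha) = cutoff e `^ (beta - alpha).
  by rewrite cutoff_powR//; congr (_ `^ _); field; rewrite gt_eqF.
have t1 : e `^ (- alpha) * (- ln e) `^ (1 - beta) <= cutoff e.
  apply: (@le_trans _ _ (e `^ (- alpha))).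
    rewrite ler_piMr ?powR_ge0//.
    by rewrite -[leRHS](powRr0 (- ln e)) ler_powR//; lra.
  by rewrite ea -[leRHS]powRr1 ?ler_powR//; lra.
have hW : W n0 n1 <= k * cutoff e `^ (1 - g).
  have := sum_powR_lt1 (n0 := n0) (J := (n1 - n0).+1) gg (n0p he hn0) isT.
  rewrite nn// => h; apply: le_trans h _.
  have c0 : 0 <= 2 / (1 - g) by rewrite divr_ge0// ltW.
  rewrite /k -[leRHS]mulrA -(@powRM R (2 * L) (cutoff e) (1 - g) (ltW L0) xe0).
  apply: ler_wpM2l => //; apply: ge0_ler_powR; rewrite ?nnegrE ?(ltW g1) ?ler0n//.
  by rewrite mulr_ge0 ?(ltW L0).
have hWa : W n0 n1 `^ (1 + alpha) <= k `^ (1 + alpha) * cutoff e `^ (1 + alpha - beta).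
  have -> : 1 + alpha - beta = (1 - g) * (1 + alpha).
    by rewrite /g; field; rewrite gt_eqF.
  rewrite powRrM -(@powRM R k _ (1 + alpha) k0 (powR_ge0 _ _)).
  apply: ge0_ler_powR; rewrite ?nnegrE ?(ltW a1) ?W0//.
  by rewrite mulr_ge0 ?powR_ge0.
have t2 : e `^ (- alpha) * W n0 n1 `^ (1 + alpha) <= k `^ (1 + alpha) * cutoff e.
  apply: le_trans (ler_wpM2l (powR_ge0 _ _) hWa) _.
  rewrite mulrCA ea -powRD; last by apply/implyP => _; rewrite gt_eqF//; lra.
  rewrite (_ : beta - alpha + (1 + alpha - beta) = 1); last ring.
  by rewrite powRr1.
apply: le_trans (lerD (lerD t1 t2) (lexx _)) _; lra.
Qed.

(** Here [g = 1] and [cutoff e = e^(- alpha)]: [W] is a piece of the harmonic series, at most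
    [ln n1], hence at most a multiple of [- ln e]. *)
Lemma rate_bound_eq (L : R) : 1 <= L -> 1 + alpha = beta ->
  exists2 K, 0 < K & forall e, 0 < e < expR (- 1) -> forall n0 n1 : nat, (n0 <= n1)%N -> - ln e <= n0%:R -> n1%:R <= 2 * L * cutoff e ->
  cost e n0 n1 <= K * (e `^ (- alpha) * `|ln e| `^ (1 + alpha)).
Proof.
move: alpha0 beta1 ab a1 ba0 ap0 g0 => alpha0' beta1' ab' a1' ba0' ap0' g0' L1.
have L0 : 0 < 2 * L by rewrite mulr_gt0//; lra.
move=> bE.
have gE : g = 1 by rewrite /g -bE divff// gt_eqF.
have apE : ap = alpha by rewrite /ap -bE (_ : 1 + alpha - alpha = 1) ?divr1//; ring.
pose K2 := (ln (2 * L) + ap) `^ (1 + alpha).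
have lL : 0 <= ln (2 * L) by rewrite ln_ge0//; lra.
have K20 : 0 <= K2 by exact: powR_ge0.
exists (2 + K2) => [|e he n0 n1 n01 hn0 hn1]; first by lra.
rewrite /cost; have [l1 ->] := lnl he; have /andP[e0 _] := he; have xe1 := cutoff_ge1 he.
have ln0 : 0 <= - ln e by lra.
set E := e `^ (- alpha); have E0 : 0 <= E by exact: powR_ge0.
have la : 1 <= (- ln e) `^ (1 + alpha).
  by rewrite -[leLHS](powRr0 (- ln e)) ler_powR//; lra.
have t1 : E * (- ln e) `^ (1 - beta) <= E * (- ln e) `^ (1 + alpha).
  by rewrite ler_wpM2l// ler_powR//; lra.
have t3 : cutoff e <= E * (- ln e) `^ (1 + alpha).
  by rewrite /cutoff -/ap apE -/E ler_peMr.
have t2 : E * (W n0 n1) `^ (1 + alpha) <=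
    K2 * (E * (- ln e) `^ (1 + alpha)).
  rewrite mulrCA ler_wpM2l// -powRM// ?addr_ge0 ?(ltW ap0)//.
  rewrite ge0_ler_powR ?nnegrE ?(ltW a1) ?W0// ?mulr_ge0 ?addr_ge0 ?(ltW ap0)//.
  rewrite /W gE; apply: le_trans (sum_powR_eq1 (J := (n1 - n0).+1) (n0p he hn0) isT) _.
  rewrite nn//.
  have n1p : (0 < n1)%N by apply: leq_trans n01; exact: n0p he hn0.
  apply: (@le_trans _ _ (ln (2 * L * cutoff e))).
    by rewrite ler_ln ?posrE ?ltr0n// mulr_gt0//; lra.
  rewrite lnM ?posrE//; last by lra.
  rewrite /cutoff ln_powR -/ap; nra.
apply: le_trans (lerD (lerD t1 t2) t3) _; lra.
Qed.

(** As [g > 1], the sum [W] is governed by its lower end [n0 >= - ln e], and again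
    [(1 - g) (1 + alpha) = 1 + alpha - beta]. The cutoff is of smaller order: its exponent
    [alpha / (beta - alpha)] is below [alpha], and the gap absorbs any power of the logarithm. *)
Lemma rate_bound_gt (L : R) : 1 <= L -> 1 + alpha < beta ->
  exists2 K, 0 < K & forall e, 0 < e < expR (- 1) -> forall n0 n1 : nat, (n0 <= n1)%N -> - ln e <= n0%:R -> n1%:R <= 2 * L * cutoff e ->
  cost e n0 n1 <= K * (e `^ (- alpha) * `|ln e| `^ (- beta + 1 + alpha)).
Proof.
move: alpha0 beta1 ab a1 ba0 ap0 g0 => alpha0' beta1' ab' a1' ba0' ap0' g0' L1.
have L0 : 0 < 2 * L by rewrite mulr_gt0//; lra.
move=> bl.
have g1 : 1 < g by rewrite /g ltr_pdivlMr// mul1r.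
have k1 : 0 < alpha - ap by rewrite subr_gt0 /ap ltr_pdivrMr//; nra.
have s1 : 0 <= beta - 1 - alpha by lra.
have [K3 K30 hK3] := powR_le_expR k1 s1.
pose K2 := ((g - 1)^-1) `^ (1 + alpha).
have K20 : 0 <= K2 by exact: powR_ge0.
exists (1 + K2 + K3) => [|e he n0 n1 n01 hn0 hn1]; first by lra.
rewrite /cost; have [l1 ->] := lnl he; have /andP[e0 _] := he.
have lp : 0 < - ln e by lra.
set E := e `^ (- alpha); have E0 : 0 <= E by exact: powR_ge0.
have t1 : E * (- ln e) `^ (1 - beta) <= E * (- ln e) `^ (- beta + 1 + alpha).
  by rewrite ler_wpM2l// ler_powR//; lra.
have t2 : E * (W n0 n1) `^ (1 + alpha) <=
    K2 * (E * (- ln e) `^ (- beta + 1 + alpha)).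
  rewrite mulrCA ler_wpM2l//.
  have gm : 0 < (g - 1)^-1 by rewrite invr_gt0; lra.
  have -> : K2 * (- ln e) `^ (- beta + 1 + alpha) =
      ((g - 1)^-1 * (- ln e) `^ (1 - g)) `^ (1 + alpha).
    rewrite (@powRM R (g - 1)^-1 _ (1 + alpha) (ltW gm) (powR_ge0 _ _)) -powRrM.
    by congr (_ * _ `^ _); rewrite /g; field; rewrite gt_eqF.
  apply: ge0_ler_powR; rewrite ?nnegrE ?(ltW a1) ?W0//.
    by rewrite mulr_ge0 ?powR_ge0 ?(ltW gm).
  have h : (1 < n0 + 1)%N by rewrite addn1 ltnS; exact: n0p he hn0.
  apply: le_trans (sum_powR_gt1 _ g1 h) _.
  rewrite addn1/= mulrC ler_wpM2l ?(ltW gm)//.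
  rewrite (_ : 1 - g = - (g - 1)); last ring.
  rewrite !powRN lef_pV2 ?posrE ?powR_gt0// ?ltr0n ?(n0p he hn0)//.
  by rewrite ge0_ler_powR ?nnegrE ?ler0n ?(ltW lp)//; lra.
have t3 : cutoff e <= K3 * (E * (- ln e) `^ (- beta + 1 + alpha)).
  have h := hK3 _ lp.
  rewrite (_ : - beta + 1 + alpha = - (beta - 1 - alpha)); last ring.
  rewrite powRN mulrA ler_pdivlMr ?powR_gt0//.
  apply: le_trans (ler_wpM2l (powR_ge0 _ _) h) _.
  rewrite mulrCA ler_wpM2l ?(ltW K30)// /cutoff /E !powR_lnE// -expRD ler_expR -/ap.
  lra.
by apply: le_trans (lerD (lerD t1 t2) t3) _; lra.
Qed.

Lemma rate_bound (L : R) : 1 <= L -> exists2 K, 0 < K & forall e, 0 < e < expR (- 1) ->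
  forall n0 n1 : nat, (n0 <= n1)%N -> - ln e <= n0%:R -> n1%:R <= 2 * L * cutoff e ->
  e `^ (- alpha) * `|ln e| `^ (1 - beta) +
  e `^ (- alpha) * (\sum_(1 <= j < (n1 - n0).+1)
      ((n0 + j)%:R : R) `^ (- (beta / (1 + alpha)))) `^ (1 + alpha) +
  cutoff e <= K * rate e.
Proof.
move=> L1; rewrite /rate; have [bl|] := boolP (beta < 1 + alpha).
  exact: rate_bound_lt.
rewrite -leNgt le_eqVlt => /predU1P[bE|bl].
  have -> : beta == 1 + alpha by rewrite bE.
  exact: rate_bound_eq.
by rewrite gt_eqF//; exact: rate_bound_gt.
Qed.

End small_ball_rate.

(** * Separability and small balls *)

Section small_ball.
Context {R : realType} {d : measure_display} {Omega : measurableType d}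
  (P : probability Omega R) {T : Type} (X : T -> Omega -> R) (rho : T -> T -> R)
  (alpha : R).
Hypothesis alpha02 : 0 < alpha < 2.
Hypothesis SX : SaS_process P alpha X.
Hypothesis rho0 : forall s t, 0 <= rho s t.
Hypothesis chf : forall s t (u : R),
  (\int[P]_w (cos (u * (X t w - X s w)))%:E =
   (expR (- (rho t s `^ alpha * `|u| `^ alpha)))%:E)%E.

Lemma has_scale_increment s t : has_scale P X alpha (fun w => X t w - X s w) (rho t s).
Proof.
split; [exact: process_span_sub|exact: rho0|move=> u].
by rewrite /Ex /Rintegral chf.
Qed.

Lemma increment_prob_ge s t (x : R) : 0 < x ->
  (P [set w | (x <= `|X t w - X s w|)%R]
    <= (bump_mom alpha * (2 * rho t s / x) `^ alpha)%:E)%E.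
Proof.
move=> x0; have /andP[a0 a2] := alpha02.
have hZ := has_scale_increment s t.
have c0 : 0 <= 2 / x by rewrite divr_ge0// ltW.
have bb := bmeas_bump_scale SX (2 / x) hZ.
have b1 : @bmeas R d Omega (fun=> 1) by exact: bmeas_cst.
have mZ : measurable_fun setT (fun w => X t w - X s w).
  by apply: measurable_funB; exact: (measurable_process SX).
apply: (@le_trans _ _ (Ex P (fun w => 1 - bump (2 / x * (X t w - X s w))))%:E).
  apply: prob_le_Ex; first exact: bmeasB.
    rewrite -[X in measurable X]setTI; apply: measurable_fun_le => //.
    exact: measurableT_comp.
  move=> w; rewrite indicE; case: (boolP (w \in _)) => [|_]; last first.
    by rewrite subr_ge0 bump_le1.
  rewrite inE/= => h; rewrite bump_supp ?subr0//.
  by rewrite normrM ger0_norm// mulrAC ler_pdivlMr// ler_pM2l.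
rewrite lee_fin ExB// Ex_cst (Ex_bump_scale SX hZ c0).
have := bump_stable_ge_exp a0 a2 (rho t s * (2 / x)).
have := expR_ge1Dx (- (bump_mom alpha * (rho t s * (2 / x)) `^ alpha)).
rewrite (_ : rho t s * (2 / x) = 2 * rho t s / x); last by ring.
by move=> h1 h2; rewrite lerBlDr addrC -lerBlDr; apply: le_trans h2.
Qed.

Variables (t0 : T) (T0 : set T) (N0 : set Omega).
Hypotheses (cT0 : countable T0) (mN0 : measurable N0) (PN0 : P N0 = 0%E).
Hypothesis sepT0 : forall w, ~ N0 w -> forall t e delta, 0 < e -> 0 < delta ->
  exists s, T0 s /\ rho s t < e /\ `|X s w - X t w| < delta.

Variables (N : nat -> nat) (c : nat -> nat -> T) (par : nat -> nat -> nat) (eta : nat -> R).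
Hypothesis net : forall j t, exists i, (i < N j)%N /\ rho t (c j i) <= eta j.
Hypothesis eta0 : forall del, 0 < del -> exists j, eta j < del.
Hypothesis parN : forall j i, (par j i < N j)%N.

Definition link_pt j i : T := if j is k.+1 then c k (par k i) else t0.
Definition link j i : Omega -> R := fun w => X (c j i) w - X (link_pt j i) w.
Definition link_scale j i : R := rho (c j i) (link_pt j i).

(** The bad events are intersected over [j], so the intersection is at most as probable as each of
    them, and [increment_prob_ge] makes some of them as small as desired. A level depending on [w]
    suffices, because the chain bound is uniform over all net points. *)
Lemma net_limit_null t (x : R) : 0 < x -> exists B : set Omega,
  [/\ measurable B, P B = 0%E & forall w, ~ B w ->
    exists j i, (i < N j)%N /\ `|X t w - X (c j i) w| < x].
Proof.
move=> x0; have /andP[a0 a2] := alpha02.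
have [u hu] := choice (fun j => net j t).
pose Bj j := [set w | x <= `|X t w - X (c j (u j)) w|].
have mBj j : measurable (Bj j).
  rewrite -[X in measurable X]setTI; apply: measurable_fun_le => //.
  apply: measurableT_comp => //.
  by apply: measurable_funB; exact: (measurable_process SX).
exists (\bigcap_j Bj j); split; first exact: bigcapT_measurable.
- apply/eqP; rewrite eq_le measure_ge0 andbT; apply/lee_addgt0Pr => eps eps0.
  rewrite add0e; have M0 := bump_mom_ge0 alpha.
  (* Chosen so that [bump_mom * (2 del / x)^alpha <= eps]; the [+ 1] keeps the denominator
     positive. *)
  pose del := x / 2 * (eps / (bump_mom alpha + 1)) `^ alpha^-1.
  have M1 : 0 < bump_mom alpha + 1 by lra.
  have em0 : 0 < eps / (bump_mom alpha + 1) by rewrite divr_gt0.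
  have del0 : 0 < del by rewrite mulr_gt0 ?powR_gt0// divr_gt0.
  have [j hj] := eta0 del0.
  apply: (@le_trans _ _ (P (Bj j))).
    by apply: le_measure; rewrite ?inE//; [exact: bigcapT_measurable|exact: bigcap_inf].
  apply: le_trans (increment_prob_ge _ _ x0) _; rewrite lee_fin.
  have [_ hrho] := hu j.
  have h : 2 * rho t (c j (u j)) / x <= (eps / (bump_mom alpha + 1)) `^ alpha^-1.
    rewrite ler_pdivrMr//; move: hrho hj; rewrite /del.
    by set y := _ `^ _; set r := rho _ _; move=> h1 h2; lra.
  apply: (@le_trans _ _ (bump_mom alpha * ((eps / (bump_mom alpha + 1)) `^ alpha^-1) `^ alpha)).
    rewrite ler_wpM2l// ge0_ler_powR ?nnegrE ?powR_ge0 ?(ltW a0)//.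
    by rewrite divr_ge0 ?mulr_ge0 ?(ltW x0).
  rewrite -powRrM mulVf ?gt_eqF// powRr1 ?(ltW em0)//.
  by rewrite mulrA ler_pdivrMr//; nra.
- move=> w nB; apply: contrapT => h; apply: nB => j _.
  rewrite /Bj/= leNgt; apply/negP => hj; apply: h.
  by exists j, (u j); split => //; have [] := hu j.
Qed.

Lemma chain_sum_le (A : nat -> R) (b : R) (J1 : nat) w :
  (forall J, chain_event link N A b J1 J w) -> (forall j, 0 <= A j) -> 0 <= b ->
  forall j i, (i < N j)%N ->
  `|X (c j i) w - X t0 w| <= \sum_(0 <= k < J1) A k + b.
Proof.
move=> E A0 b0.
pose F k := if (k < J1)%N then A k else level_max link N k w.
have F0 k : 0 <= F k by rewrite /F; case: ifP => // _; exact: level_max_ge0.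
have linkF j i : (i < N j)%N -> `|link j i w| <= F j.
  move=> iN; rewrite /F; case: ifP => _; last exact: level_max_ge.
  by have [h _] := E j.+1; exact: h.
have step j i : (i < N j)%N -> `|X (c j i) w - X t0 w| <= \sum_(0 <= k < j.+1) F k.
  elim: j i => [|j IH] i iN; first by rewrite big_nat1; exact: (linkF 0%N i iN).
  rewrite big_nat_recr//= addrC.
  rewrite (_ : X _ w - _ = link j.+1 i w + (X (c j (par j i)) w - X t0 w)); last first.
    by rewrite /link /link_pt; ring.
  apply: le_trans (ler_normD _ _) _; apply: lerD; first exact: linkF.
  exact: IH.
move=> j i iN; apply: le_trans (step j i iN) _.
(* The range up to [J1 + j.+1] contains both the whole slab range and the chain of the given
   point. *)
apply: (@le_trans _ _ (\sum_(0 <= k < J1 + j.+1) F k)).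
  rewrite [leRHS](big_cat_nat (n := j.+1))//= ?leq_addl// lerDl.
  exact: sumr_ge0.
rewrite (big_cat_nat (n := J1))//= ?leq_addr//; apply: lerD.
  rewrite le_eqVlt; apply/orP; left; apply/eqP; rewrite !big_nat.
  by apply: eq_bigr => k /andP[_ kJ]; rewrite /F kJ.
have [_] := E (J1 + j.+1)%N; apply: le_trans.
rewrite le_eqVlt; apply/orP; left; apply/eqP; rewrite !big_nat.
by apply: eq_bigr => k /andP[kJ _]; rewrite /F ltnNge kJ.
Qed.

Lemma countable_range : exists g : nat -> T, forall t, T0 t -> exists k, g k = t.
Proof.
have /countable_injP[f finj] := cT0.
have ex k : exists t, (exists2 t', T0 t' & f t' = k) -> T0 t /\ f t = k.
  have [[t' Tt' ft']|h] := pselect (exists2 t', T0 t' & f t' = k).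
    by exists t'.
  by exists t0 => /h.
have [g hg] := choice ex; exists g => t Tt; exists (f t).
have [Tg fg] := hg (f t) (ex_intro2 _ _ t Tt erefl).
by apply: finj => //; rewrite inE.
Qed.

Lemma small_ball_of_chain (A q tt : nat -> R) (th e Q : R) (J1 : nat) :
  0 < e -> (forall j i, link_scale j i <= tt j) -> (forall j, 0 < A j) ->
  (forall j i, expR (- q j) <= bump_stable alpha (link_scale j i * (2 / A j))) ->
  0 <= th <= 1 -> alpha * th < 1 ->
  \sum_(0 <= j < J1) A j <= e / 4 ->
  (forall J, \sum_(J1 <= j < J) dyadic_cst alpha th * ((N j)%:R * tt j `^ alpha) `^ th
      * A j `^ (1 - alpha * th) <= e / 32) ->
  (forall J, \sum_(0 <= j < J) (N j)%:R * q j <= Q) ->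
  exists B : set Omega, measurable B /\
    B `<=` [set w | forall s t, `|X s w - X t w| <= e] /\
    ((expR (- (Q + 1)))%:E <= P B)%E.
Proof.
move=> e0 htt A0 hq th01 ath hA hsum hQ.
have hZ j i : has_scale P X alpha (link j i) (link_scale j i).
  exact: has_scale_increment.
have b0 : 0 < e / 8 by rewrite divr_gt0.
have hsum' J : \sum_(J1 <= j < J) dyadic_cst alpha th * ((N j)%:R * tt j `^ alpha) `^ th
    * A j `^ (1 - alpha * th) <= e / 8 / 4.
  by apply: le_trans (hsum J) _; lra.
pose E := \bigcap_J chain_event link N A (e / 8) J1 J.
have mE : measurable E.
  by apply: bigcapT_measurable => J; exact: (measurable_chain_event SX N A (e / 8) J1 hZ).
have PE : ((expR (- Q) / 2)%:E <= P E)%E.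
  exact: (chain_event_cap alpha02 SX hZ htt A0 hq th01 ath b0 hsum' hQ).
have [g hg] := countable_range.
have x0 : 0 < e / 16 by rewrite divr_gt0.
have [B hB] := choice (fun k => net_limit_null (g k) x0).
pose M := N0 `|` \bigcup_k B k.
have mB : measurable (\bigcup_k B k).
  by apply: bigcupT_measurable => k; have [] := hB k.
have mM : measurable M by exact: measurableU.
have PM : P M = 0%E.
  have PB : P (\bigcup_k B k) = 0%E.
    apply/eqP; rewrite eq_le measure_ge0 andbT.
    apply: le_trans (measure_sigma_subadditive P _ mB (fun _ h => h)) _.
      by move=> k; have [] := hB k.
    by rewrite eseries0// => k _ _; have [] := hB k.
  by rewrite /M measureU0.
exists (E `\` M); split; first exact: measurableD.
split.
  move=> w [Ew Mw]; have A00 j := ltW (A0 j).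
  have hc := chain_sum_le (fun J => Ew J I) A00 (ltW b0).
  (* The budget is [e / 4] for the slabs below [J1], [e / 8] for the maxima beyond, [e / 16] for the
     separating point and [e / 16] for its net point: [e / 2] in all, used twice for a pair [s],
     [t]. *)
  have near_t0 t : `|X t w - X t0 w| <= e / 2.
    have nN0 : ~ N0 w by move=> h; apply: Mw; left.
    have [s [Ts [_ hs]]] := sepT0 nN0 t ltr01 x0.
    have [k gk] := hg s Ts.
    have [_ _ hk] := hB k.
    have [|j [i [iN]]] := hk w; first by move=> h; apply: Mw; right; exists k.
    rewrite gk => hji; have hcj := hc j i iN.
    have -> : X t w - X t0 w = (X t w - X s w) + (X s w - X (c j i) w) +
      (X (c j i) w - X t0 w) by ring.
    apply: le_trans (ler_normD _ _) _; apply: le_trans (lerD (ler_normD _ _) (lexx _)) _.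
    by rewrite (distrC (X t w)); lra.
  move=> s t; have := near_t0 s; have := near_t0 t.
  have -> : X s w - X t w = (X s w - X t0 w) - (X t w - X t0 w) by ring.
  by move=> h1 h2; apply: le_trans (ler_normB _ _) _; lra.
have PEM : (P E <= P (E `\` M))%E.
  have /le_trans : (P E <= P ((E `\` M) `|` M))%E.
    apply: le_measure; rewrite ?inE//; last by move=> w Ew; have [] := pselect (M w); [right|left].
    by apply: measurableU => //; exact: measurableD.
  by apply; rewrite measureU0//; exact: measurableD.
(* [exp (-1) <= 1 / 2] turns Markov's factor into the [+ 1] of the exponent. *)
apply: le_trans (le_trans PE PEM); rewrite lee_fin opprD expRD.
rewrite ler_wpM2l ?expR_ge0// expRN lef_pV2 ?posrE ?expR_gt0//.
by have := expR_ge1Dx (1 : R); lra.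
Qed.

End small_ball.

(** * Dyadic nets from the covering numbers *)

Lemma ln2_gt0 {R : realType} : 0 < ln (2 : R).
Proof. by rewrite ln_gt0// ltr1n. Qed.

Lemma expr2_expR {R : realType} n : (2 : R) ^+ n = expR (n%:R * ln 2).
Proof. by rewrite mulrC -powR_mulrn// powR_lnE// mulrC. Qed.

Section nets.
Context {R : realType} {T : Type} (rho : T -> T -> R) (alpha beta C : R).
Hypothesis bnd : has_ubound [set r | exists s t, r = rho s t].
Hypothesis tb : totally_bounded_pm rho.
Hypotheses (alpha0 : 0 < alpha) (beta0 : 0 < beta) (C0 : 0 < C).
Hypothesis cov : forall e, 0 < e -> e < diam rho ->
  (covnum rho e)%:R * `|ln e| `^ beta <= C * e `^ (- alpha).
Variable t0 : T.

Lemma le_diam s t : rho s t <= diam rho.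
Proof. by apply: ub_le_sup => //; exists s, t. Qed.

Lemma covnum_covers e : 0 < e -> covers rho e (covnum rho e).
Proof.
move=> e0; rewrite /covnum; case: pselect => [h|nh]; last by case: nh; exact: tb.
by case: ex_minnP => m /asboolP.
Qed.

Lemma covers_net e m : covers rho e m ->
  exists c : nat -> T, forall t, exists i, (i < m)%N /\ rho t (c i) <= e.
Proof.
move=> [c hc]; case: m c hc => [|m] c hc; first by have [[]] := hc t0.
exists (fun i => c (inord i)) => t; have [i hi] := hc t.
by exists i; rewrite inord_val.
Qed.

Lemma dyadic_nets : exists2 C', 0 < C' & exists n0 : nat, forall n, (n0 <= n)%N ->
  exists (N : nat) (c : nat -> T),
    (forall t, exists i, (i < N)%N /\ rho t (c i) <= (2 ^+ n)^-1) /\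
    N%:R * n%:R `^ beta <= C' * (2 ^+ n) `^ alpha.
Proof.
have l2 := @ln2_gt0 R.
have [dp|dn] := ltP 0 (diam rho).
  (* [ln 2] enters through [- ln (2^-n) = n ln 2]; the starting level below makes [2^-n] smaller
     than the diameter. *)
  exists (C / ln 2 `^ beta); first by rewrite divr_gt0// powR_gt0.
  exists (Num.Def.truncn (diam rho)^-1).+1 => n hn.
  have e0 : 0 < ((2 : R) ^+ n)^-1 by rewrite invr_gt0 exprn_gt0.
  have ed : ((2 : R) ^+ n)^-1 < diam rho.
    rewrite invf_plt ?posrE ?exprn_gt0//; apply: lt_le_trans (truncnS_gt _) _.
    by rewrite -natrX ler_nat (leq_trans hn)// ltnW// ltn_expl.
  have [c hc] := covers_net (covnum_covers e0).
  exists (covnum rho (2 ^+ n)^-1), c; split => //.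
  have := cov e0 ed.
  rewrite lnV ?posrE ?exprn_gt0// normrN expr2_expR expRK ger0_norm ?mulr_ge0 ?(ltW l2)//.
  rewrite powRM ?(ltW l2)// powRN -powR_inv1 ?invr_ge0 ?expR_ge0// .
  rewrite -powR_inv1 ?expR_ge0// -!powRrM => h.
  rewrite mulrAC ler_pdivlMr ?powR_gt0// -mulrA.
  apply: le_trans h _; rewrite le_eqVlt; apply/orP; left; apply/eqP.
  by congr (_ * _ `^ _); ring.
(* Diameter at most zero: one point is a net of every radius, and the cardinality bound reduces to
   the domination of [n^beta] by [2^(n alpha)]. *)
have r0 s t : rho s t <= 0 by apply: le_trans (le_diam s t) dn.
have k0 : 0 < alpha * ln 2 by rewrite mulr_gt0.
have [K K0 hK] := powR_le_expR k0 (ltW beta0).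
exists K => //; exists 1%N => n n1; exists 1%N, (fun=> t0); split.
  by move=> t; exists 0%N; split => //; rewrite (le_trans (r0 _ _))// invr_ge0 exprn_ge0.
rewrite mul1r expr2_expR; apply: le_trans (hK n%:R _) _; first by rewrite ltr0n.
rewrite ler_wpM2l ?(ltW K0)// /powR gt_eqF ?expR_gt0// expRK ler_expR.
by rewrite le_eqVlt; apply/orP; left; apply/eqP; ring.
Qed.

End nets.

Lemma bump_stable_antitone {R : realType} (alpha r r' : R) : 0 < alpha < 2 ->
  0 <= r <= r' -> bump_stable alpha r' <= bump_stable alpha r.
Proof.
move=> /andP[a0 a2] /andP[r0 rr']; have ir := @integrable_bump_stable R alpha.
apply: (le_Rintegral measurableT (ir r') (ir r)) => u _.
rewrite ler_wpM2l ?bump_dens_ge0// ler_expR lerN2 ler_wpM2r ?powR_ge0//.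
by apply: ge0_ler_powR; rewrite ?nnegrE ?(ltW a0)// (le_trans r0).
Qed.

(** * Slab widths and their cost *)

Section slab_levels.
Context {R : realType}.
Variables (alpha beta e L Kd th C2 : R) (n0 n1 : nat) (NT : nat -> R).
Hypotheses (alpha0 : 0 < alpha) (beta1 : 1 < beta) (ab : alpha < beta) (e0 : 0 < e).
Hypotheses (L1 : 1 <= L) (th0 : 0 <= th) (ath : alpha * th < 1) (bth : 1 < beta * th).
Hypotheses (C20 : 0 <= C2) (x1 : 1 <= cutoff alpha beta e).
Hypotheses (n00 : (0 < n0)%N) (n01 : (n0 <= n1)%N) (Ln1 : L * cutoff alpha beta e <= n1%:R).
Hypothesis hNT : forall j, (0 < j)%N -> 0 <= NT j <= C2 * ((n0 + j)%:R) `^ (- beta).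

Let x := cutoff alpha beta e.
Let g := beta / (1 + alpha).
Let J1 := (n1 - n0).+1.

Definition slab_weight : R := \sum_(1 <= j < J1) ((n0 + j)%:R : R) `^ (- g).

(* Up to [n1], the weights [n^-g], [g = beta / (1 + alpha)], minimize the total cost
   [\sum_n n^-beta a_n^-alpha] of slabs [a_n] of prescribed sum. *)
Definition slab_level (j : nat) : R :=
  if j == 0%N then e / 8
  else if (j < J1)%N then e / 8 * (((n0 + j)%:R : R) `^ (- g) / slab_weight) else e / x.

Let x0 : 0 < x. Proof. exact: lt_le_trans ltr01 x1. Qed.

Let n0j (j : nat) : 0 < ((n0 + j)%:R : R).
Proof. by rewrite ltr0n addn_gt0 n00. Qed.

Lemma slab_weight_ge0 : 0 <= slab_weight.
Proof. by apply: sumr_ge0 => j _; exact: powR_ge0. Qed.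

Lemma slab_weight_gt0 j : (0 < j)%N -> (j < J1)%N -> 0 < slab_weight.
Proof.
move=> j0 jJ; apply: lt_le_trans (_ : ((n0 + j)%:R : R) `^ (- g) <= _).
  by rewrite powR_gt0.
have jI : j \in index_iota 1 J1 by rewrite mem_index_iota j0.
by rewrite /slab_weight (bigD1_seq j)//= ?iota_uniq// lerDl sumr_ge0.
Qed.

Lemma slab_level_gt0 j : 0 < slab_level j.
Proof.
rewrite /slab_level; case: ifPn => [_|j0]; first by rewrite divr_gt0.
case: ifPn => [jJ|_]; last by rewrite divr_gt0.
rewrite mulr_gt0 ?divr_gt0 ?powR_gt0//.
by apply: (@slab_weight_gt0 j) => //; rewrite lt0n.
Qed.

Lemma slab_level_sum : \sum_(0 <= j < J1) slab_level j <= e / 4.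
Proof.
rewrite big_ltn//.
have -> : \sum_(1 <= j < J1) slab_level j = e / 8 * (slab_weight / slab_weight).
  rewrite {1}/slab_weight mulr_suml mulr_sumr !big_nat; apply: eq_bigr => j /andP[j0 jJ].
  by rewrite /slab_level gtn_eqF// jJ.
have e8 : 0 <= e / 8 by rewrite divr_ge0// ltW.
have : e / 8 * (slab_weight / slab_weight) <= e / 8.
  (* When [n1 = n0] the weight is an empty sum, and the convention [0 / 0 = 0] applies. *)
  rewrite ler_piMr//; have [->|W0] := eqVneq slab_weight 0; first by rewrite mul0r.
  by rewrite divff.
rewrite /slab_level eqxx; lra.
Qed.

Let tailJ1 j : (J1 <= j)%N -> slab_level j = e / x.
Proof.
by move=> J1j; rewrite /slab_level gtn_eqF ?(leq_trans _ J1j)// ltnNge J1j.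
Qed.

Let n0J1 : (n0 + J1).-1 = n1.
Proof. by rewrite addnS/= subnKC. Qed.

Let n0J11 : (1 < n0 + J1)%N.
Proof. by rewrite addnS ltnS ltn_addr. Qed.

Lemma n1_powR_le (p : R) : 1 < p -> ((n1%:R : R) `^ (1 - p)) <= L `^ (1 - p) * x `^ (1 - p).
Proof.
move=> p1; have L0 : 0 <= L by exact: le_trans ler01 L1.
rewrite -(powRM (1 - p) L0 (ltW x0)) (_ : 1 - p = - (p - 1)); last ring.
have Lx0 : 0 < L * x by rewrite mulr_gt0// (lt_le_trans ltr01).
rewrite !powRN lef_pV2 ?posrE ?powR_gt0// ?(lt_le_trans Lx0)//.
by apply: ge0_ler_powR; rewrite ?nnegrE ?subr_ge0 ?(ltW p1) ?(ltW Lx0).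
Qed.

Let xE s : x `^ s = expR (- (alpha / (beta - alpha) * s * ln e)).
Proof. by rewrite /x cutoff_powR// powR_lnE// mulNr. Qed.

Let ex_powR s : (e / x) `^ s = expR (s * (1 + alpha / (beta - alpha)) * ln e).
Proof.
rewrite powRM ?invr_ge0 ?(ltW e0) ?(ltW x0)// -powR_inv1 ?(ltW x0)// -powRrM xE.
by rewrite powR_lnE// -expRD; congr expR; ring.
Qed.

Let ba0 : beta - alpha != 0. Proof. by rewrite gt_eqF// subr_gt0. Qed.

Lemma slab_tail_budget : `|Kd| * C2 `^ th / (beta * th - 1) * L `^ (1 - beta * th) <= 32^-1 ->
  forall J, \sum_(J1 <= j < J) Kd * NT j `^ th * slab_level j `^ (1 - alpha * th) <= e / 32.
Proof.
move=> hL J; have b1 : 0 < beta * th - 1 by rewrite subr_gt0.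
pose c := `|Kd| * C2 `^ th * (e / x) `^ (1 - alpha * th).
have c0 : 0 <= c by rewrite !mulr_ge0 ?powR_ge0.
apply: (@le_trans _ _ (\sum_(J1 <= j < J) c * ((n0 + j)%:R : R) `^ (- (beta * th)))).
  rewrite !big_nat; apply: ler_sum => j /andP[J1j _]; rewrite tailJ1//.
  have /andP[h0 h1] : 0 <= NT j <= C2 * ((n0 + j)%:R) `^ (- beta).
    by apply: hNT; exact: leq_trans J1j.
  rewrite /c [leRHS]mulrAC ler_wpM2r ?powR_ge0// -[leRHS]mulrA.
  apply: (@le_trans _ _ (`|Kd| * NT j `^ th)).
    by rewrite ler_wpM2r ?powR_ge0// ler_norm.
  rewrite ler_wpM2l// -mulNr powRrM -powRM ?powR_ge0//.
  by apply: ge0_ler_powR; rewrite ?nnegrE ?mulr_ge0 ?powR_ge0.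
rewrite -mulr_sumr; apply: le_trans (ler_wpM2l c0 (sum_powR_gt1 J bth n0J11)) _.
rewrite n0J1.
apply: (@le_trans _ _ (c * (L `^ (1 - beta * th) * x `^ (1 - beta * th) / (beta * th - 1)))).
  by rewrite ler_wpM2l// ler_pM2r ?invr_gt0// n1_powR_le.
(* Exact by the equation defining [x]; the remaining constant is made small by the power of [L]. *)
have ee : (e / x) `^ (1 - alpha * th) * x `^ (1 - beta * th) = e.
  rewrite ex_powR xE -expRD -[RHS](@lnK R e) ?posrE//; congr expR.
  by field.
rewrite (_ : c * _ = `|Kd| * C2 `^ th / (beta * th - 1) * L `^ (1 - beta * th) *
    ((e / x) `^ (1 - alpha * th) * x `^ (1 - beta * th))); last first.
  by rewrite /c; field; rewrite gt_eqF.
by rewrite ee mulrC ler_wpM2l ?(ltW e0).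
Qed.

Lemma slab_cost_main : \sum_(1 <= j < J1) NT j * slab_level j `^ (- alpha) <=
  C2 * 8 `^ alpha * (e `^ (- alpha) * slab_weight `^ (1 + alpha)).
Proof.
have e8 : 0 <= e / 8 by rewrite divr_ge0// ltW.
have a1 : 1 + alpha != 0 by rewrite gt_eqF// addr_gt0.
apply: (@le_trans _ _ (\sum_(1 <= j < J1) C2 * (e / 8) `^ (- alpha) *
    slab_weight `^ alpha * ((n0 + j)%:R : R) `^ (- g))).
  rewrite !big_nat; apply: ler_sum => j /andP[j0 jJ].
  have /andP[h0 h1] := hNT j0.
  have W0 := slab_weight_gt0 j0 jJ; have Wi : 0 <= slab_weight^-1 by rewrite invr_ge0 ltW.
  rewrite /slab_level gtn_eqF// jJ.
  rewrite (powRM _ e8) ?mulr_ge0 ?powR_ge0// (powRM _ (powR_ge0 _ _) Wi).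
  rewrite -powRrM -(powR_inv1 (ltW W0)) -powRrM (_ : -1 * - alpha = alpha); last ring.
  apply: le_trans (ler_wpM2r _ h1) _; first by rewrite !mulr_ge0 ?powR_ge0.
  rewrite le_eqVlt; apply/orP; left; apply/eqP.
  (* Because [beta - g * alpha = g], the costs for these widths are again proportional to the
     weights, and they sum to a multiple of [slab_weight]. *)
  have -> : ((n0 + j)%:R : R) `^ (- g) =
      (n0 + j)%:R `^ (- beta) * (n0 + j)%:R `^ (- g * - alpha).
    rewrite -powRD; last by apply/implyP => _; rewrite gt_eqF.
    by congr (_ `^ _); rewrite /g; field.
  ring.
rewrite -mulr_sumr -/slab_weight.
have [->|W0] := eqVneq slab_weight 0.
  by rewrite mulr0 !mulr_ge0 ?powR_ge0.
have -> : slab_weight `^ (1 + alpha) = slab_weight * slab_weight `^ alpha.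
  by rewrite powRD ?powRr1 ?slab_weight_ge0// W0 implybT.
have -> : (e / 8) `^ (- alpha) = e `^ (- alpha) * 8 `^ alpha.
  rewrite powRM ?(ltW e0)// -(@powR_inv1 _ 8)// -powRrM; congr (_ * _ `^ _); ring.
by rewrite le_eqVlt; apply/orP; left; apply/eqP; ring.
Qed.

Lemma slab_cost_tail J :
  \sum_(J1 <= j < J) NT j * slab_level j `^ (- alpha) <= C2 / (beta - 1) * x.
Proof.
have b1 : 0 < beta - 1 by rewrite subr_gt0.
pose c := C2 * (e / x) `^ (- alpha).
have c0 : 0 <= c by rewrite mulr_ge0 ?powR_ge0.
apply: (@le_trans _ _ (\sum_(J1 <= j < J) c * ((n0 + j)%:R : R) `^ (- beta))).
  rewrite !big_nat; apply: ler_sum => j /andP[J1j _]; rewrite tailJ1//.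
  have /andP[h0 h1] : 0 <= NT j <= C2 * ((n0 + j)%:R) `^ (- beta).
    by apply: hNT; exact: leq_trans J1j.
  by rewrite /c mulrAC ler_wpM2r ?powR_ge0.
rewrite -mulr_sumr; apply: le_trans (ler_wpM2l c0 (sum_powR_gt1 J beta1 n0J11)) _.
rewrite n0J1.
apply: (@le_trans _ _ (c * (x `^ (1 - beta) / (beta - 1)))).
  rewrite ler_wpM2l// ler_pM2r ?invr_gt0//; apply: le_trans (n1_powR_le beta1) _.
  rewrite ler_piMl ?powR_ge0// -[leRHS](powRr0 L) ler_powR//.
  by rewrite subr_le0 ltW.
have ee : (e / x) `^ (- alpha) * x `^ (1 - beta) = x.
  rewrite ex_powR xE -expRD -[RHS]powRr1 ?(ltW x0)// xE; congr expR.
  by field.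
rewrite (_ : c * _ = C2 / (beta - 1) * ((e / x) `^ (- alpha) * x `^ (1 - beta))).
  by rewrite ee.
by rewrite /c; field; rewrite gt_eqF.
Qed.

End slab_levels.

(** * Choice of the levels and of the factor [L] *)

Section level_choice.
Context {R : realType}.

Lemma ln2_bounds : 2^-1 <= ln (2 : R) <= 1.
Proof.
have h : -1 < - 2^-1 :> R by rewrite ltrN2; lra.
have := le_ln1Dx h; rewrite (_ : 1 + - 2^-1 = 2^-1 :> R); last by field.
rewrite lnV ?posrE// lerN2 => -> /=.
rewrite -[leRHS](@expRK R) ler_ln ?posrE ?expR_gt0//.
by have := expR_ge1Dx (1 : R); lra.
Qed.

(** [n0] is the least integer above [log_2 (1 / e)], so [2^(- n0)] lies between [e / 2] and [e]; the
    other constants come from [1 / 2 <= ln 2 <= 1] and [- ln e > 1]. *)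
Lemma finest_level (e : R) : 0 < e < expR (- 1) -> exists n0 : nat,
  [/\ - ln e <= n0%:R, n0%:R <= 3 * - ln e & (2 : R) ^+ n0 <= 2 / e].
Proof.
move=> /andP[e0 e1]; have /andP[l2 l21] := ln2_bounds.
have l20 := @ln2_gt0 R.
have l1 : 1 < - ln e by rewrite ltrNr -[ltRHS]expRK ltr_ln ?posrE ?expR_gt0.
have ll0 : 0 <= - ln e / ln 2 by rewrite divr_ge0 ?(ltW l20)//; lra.
exists (Num.Def.truncn (- ln e / ln 2)).+1.
have n0lt := truncnS_gt (- ln e / ln 2).
have n0le : (Num.Def.truncn (- ln e / ln 2)).+1%:R <= - ln e / ln 2 + 1.
  by rewrite -natr1 lerD2r; have /andP[] := truncn_itv ll0.
move: n0lt n0le; set n := (Num.Def.truncn (- ln e / ln 2)).+1 => n0lt n0le.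
move: l1 ll0 n0lt n0le; set l := - ln e => l1 ll0 n0lt n0le.
have lle : l <= l / ln 2 by rewrite ler_pdivlMr// ler_piMr//; lra.
have lle2 : l / ln 2 <= 2 * l by rewrite ler_pdivrMr//; nra.
split; [lra|lra|].
rewrite expr2_expR (_ : 2 / e = expR (l + ln 2)).
  by rewrite ler_expR; move: n0le; rewrite -(ler_pM2r l20) mulrDl divfK ?gt_eqF// mul1r.
by rewrite expRD lnK ?posrE// /l expRN lnK ?posrE// mulrC.
Qed.

Variables alpha beta : R.
Hypotheses (alpha0 : 0 < alpha) (ab : alpha < beta).

(** [n1] is the least integer above [L * x]. It is at least [n0] since
    [x = exp (ap * - ln e) >= ap * - ln e] for [ap = alpha / (beta - alpha)], and [ap * L >= 3]. *)
Lemma last_slab_level (L e : R) n0 : 1 <= L -> 3 <= alpha / (beta - alpha) * L ->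
  0 < e < expR (- 1) -> n0%:R <= 3 * - ln e -> exists n1 : nat,
  [/\ (n0 <= n1)%N, L * cutoff alpha beta e <= n1%:R & n1%:R <= 2 * L * cutoff alpha beta e].
Proof.
move=> L1 L3 he n0le; have x1 := cutoff_ge1 alpha0 ab he; have /andP[e0 e1] := he.
have l1 : 1 < - ln e by rewrite ltrNr -[ltRHS]expRK ltr_ln ?posrE ?expR_gt0.
have xl : alpha / (beta - alpha) * - ln e <= cutoff alpha beta e.
  rewrite cutoff_expR//; have := expR_ge1Dx (alpha / (beta - alpha) * - ln e); lra.
move: (cutoff _ _ _) (alpha / _) x1 xl L3 => x ap x1 xl L3.
have Lx0 : 0 <= L * x by rewrite mulr_ge0//; lra.
have Lx1 : 1 <= L * x by rewrite -[leLHS]mulr1; apply: ler_pM.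
have n1gt := truncnS_gt (L * x).
have n1le : (Num.Def.truncn (L * x)).+1%:R <= L * x + 1.
  by rewrite -natr1 lerD2r; have /andP[] := truncn_itv Lx0.
exists (Num.Def.truncn (L * x)).+1.
move: n1gt n1le; set n1 := (Num.Def.truncn (L * x)).+1 => n1gt n1le.
split; [|exact: ltW|lra].
rewrite -(ler_nat R); apply: le_trans (ltW n1gt); apply: le_trans n0le _.
apply: (@le_trans _ _ (L * (ap * - ln e))); last by rewrite ler_wpM2l//; lra.
by rewrite mulrA (mulrC L) ler_wpM2r//; lra.
Qed.

Lemma large_cutoff_factor (K p ap : R) : 0 <= K -> 1 < p -> 0 < ap ->
  exists L, [/\ 1 <= L, 3 <= ap * L & K * L `^ (1 - p) <= 32^-1].
Proof.
move=> K0 p1 ap0'; have pp : 0 < p - 1 by rewrite subr_gt0.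
(* Solves [(32 K + 1) L^(1 - p) = 1]; the [+ 1] covers [K = 0]. *)
pose L0 := (32 * K + 1) `^ ((p - 1)^-1).
have B0 : 0 < 32 * K + 1 by lra.
have L00 : 0 < L0 by rewrite powR_gt0.
exists (Num.max (Num.max 1 (3 / ap)) L0); split.
- by rewrite !le_max lexx.
- by rewrite mulrC -ler_pdivrMr// !le_max lexx orbT.
have LL : L0 <= Num.max (Num.max 1 (3 / ap)) L0 by rewrite le_max lexx orbT.
set L := Num.max _ _ in LL *; have Lp : 0 < L by exact: lt_le_trans LL.
rewrite (_ : 1 - p = - (p - 1)); last ring.
rewrite powRN ler_pdivrMr ?powR_gt0//.
have : 32 * K + 1 <= L `^ (p - 1).
  have -> : 32 * K + 1 = L0 `^ (p - 1).
    by rewrite -powRrM mulVf ?gt_eqF// powRr1// ltW.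
  by apply: ge0_ler_powR; rewrite ?nnegrE ?(ltW pp) ?(ltW L00) ?(ltW Lp).
by move: (L `^ _) => y; lra.
Qed.

End level_choice.

(** * The chain for a fixed [e] and its total cost *)

Section chaining_cost.
Context {R : realType} {d : measure_display} {Omega : measurableType d}
  (P : probability Omega R) {T : Type} (X : T -> Omega -> R) (rho : T -> T -> R)
  (alpha beta : R).
Hypothesis alpha02 : 0 < alpha < 2.
Hypotheses (beta1 : 1 < beta) (ab : alpha < beta).
Hypothesis SX : SaS_process P alpha X.
Hypothesis rho0 : forall s t, 0 <= rho s t.
Hypothesis chf : forall s t (u : R),
  (\int[P]_w (cos (u * (X t w - X s w)))%:E =
   (expR (- (rho t s `^ alpha * `|u| `^ alpha)))%:E)%E.
Variables (t0 : T) (T0 : set T) (N0 : set Omega).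
Hypotheses (cT0 : countable T0) (mN0 : measurable N0) (PN0 : P N0 = 0%E).
Hypothesis sepT0 : forall w, ~ N0 w -> forall t e delta, 0 < e -> 0 < delta ->
  exists s, T0 s /\ rho s t < e /\ `|X s w - X t w| < delta.

Variables (C D c0 L e th : R) (card : nat -> nat) (pt : nat -> nat -> T).
Variables (parent : nat -> nat -> nat) (n0 n1 : nat).
Hypothesis hnet : forall n, (n0 <= n)%N -> forall t,
  exists i, (i < card n)%N /\ rho t (pt n i) <= (2 ^+ n)^-1.
Hypothesis hcard : forall n, (n0 <= n)%N ->
  (card n)%:R * n%:R `^ beta <= C * (2 ^+ n) `^ alpha.
Hypothesis hparent : forall n, (n0 <= n)%N -> forall i,
  (parent n i < card n)%N /\ rho (pt n.+1 i) (pt n (parent n i)) <= (2 ^+ n)^-1.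
Hypotheses (rhoD : forall s t, rho s t <= D) (D1 : 1 <= D) (C0 : 0 <= C).
Hypotheses (c00 : 0 < c0) (c01 : c0 <= 1).
Hypothesis hc0 : forall r, 1 <= r -> c0 / r <= bump_stable alpha r.
Hypotheses (th01 : 0 <= th <= 1) (ath : alpha * th < 1) (bth : 1 < beta * th).
Hypotheses (he : 0 < e < expR (- 1)) (L1 : 1 <= L).
Hypotheses (n0l : - ln e <= n0%:R) (n0e : (2 : R) ^+ n0 <= 2 / e) (n01 : (n0 <= n1)%N).
Hypothesis Ln1 : L * cutoff alpha beta e <= n1%:R.

Let C2 := C * 2 `^ alpha.
Hypothesis hL : `|dyadic_cst alpha th| * C2 `^ th / (beta * th - 1) *
  L `^ (1 - beta * th) <= 32^-1.

Let M := bump_mom alpha.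
Let lK := ln (16 * D / c0).
Let N j := card (n0 + j).
Let c j := pt (n0 + j)%N.
Let par j := parent (n0 + j)%N.
Let eta j : R := (2 ^+ (n0 + j))^-1.
(** A link of level [j.+1] ends at a parent within the radius of the next coarser net, which is
    twice [eta j.+1]; at level [0] it ends at [t0], and its scale is bounded by [D]. *)
Let tt j : R := if j is 0%N then D else 2 * eta j.
Let A := slab_level alpha beta e n0 n1.
(** Level [0] is charged by [bump_stable_ge_inv], since [D / e] is large; its scale ratio is
    [D * 2 / (e / 8) = 16 D / e], whence the [16] in [lK]. The finer levels are charged by
    [bump_stable_ge_exp]. *)
Let q j : R := if j is 0%N then lK - ln e else M * (2 * tt j / A j) `^ alpha.
Let NT j : R := (N j)%:R * tt j `^ alpha.

Let a0 : 0 < alpha. Proof. by case/andP: alpha02. Qed.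
Let a2 : alpha < 2. Proof. by case/andP: alpha02. Qed.
Let e0 : 0 < e. Proof. by case/andP: he. Qed.
Let M0 : 0 <= M. Proof. exact: bump_mom_ge0. Qed.
Let C20 : 0 <= C2. Proof. by rewrite mulr_ge0 ?powR_ge0. Qed.
Let beta0 : 0 < beta. Proof. exact: lt_trans beta1. Qed.
Let x1 := cutoff_ge1 a0 ab he.
Let D0 : 0 < D. Proof. exact: lt_le_trans D1. Qed.

Let l1 : 1 < - ln e.
Proof. by rewrite ltrNr -[ltRHS]expRK ltr_ln ?posrE ?expR_gt0//; case/andP: he. Qed.

Let n00 : (0 < n0)%N.
Proof. by rewrite -(ltr0n R); apply: lt_le_trans n0l; apply: lt_trans l1. Qed.

Let n0j j : (n0 <= n0 + j)%N. Proof. exact: leq_addr. Qed.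

Let lK0 : 0 <= lK.
Proof.
rewrite ln_ge0// ler_pdivlMr// mul1r (le_trans c01)// (le_trans D1)//.
by rewrite ler_peMl ?(ltW D0)// ler1n.
Qed.

Let A0 j : 0 < A j. Proof. exact: slab_level_gt0. Qed.

Let hNT j : (0 < j)%N -> 0 <= NT j <= C2 * ((n0 + j)%:R) `^ (- beta).
Proof.
case: j => // j _; rewrite /NT mulr_ge0 ?powR_ge0//=.
have hN := hcard (n0j j.+1).
have p0 : 0 < (2 : R) ^+ (n0 + j.+1) by rewrite exprn_gt0.
have pa0 : 0 < ((2 : R) ^+ (n0 + j.+1)) `^ alpha by rewrite powR_gt0.
have q0 : 0 < ((n0 + j.+1)%:R : R) `^ beta by rewrite powR_gt0// ltr0n addn_gt0 n00.
have -> : (2 * eta j.+1) `^ alpha = 2 `^ alpha / (2 ^+ (n0 + j.+1)) `^ alpha.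
  rewrite (@powRM R 2) ?invr_ge0 ?(ltW p0)// /eta.
  by rewrite -(powR_inv1 (ltW p0)) -powRrM mulN1r powRN.
rewrite powRN ler_pdivlMr// mulrA mulrAC ler_pdivrMr// /C2.
rewrite -[leLHS]mulrA [leLHS]mulrCA -[leRHS]mulrA [leRHS]mulrCA.
by rewrite ler_wpM2l ?powR_ge0.
Qed.

Let htt j i : link_scale rho t0 c par j i <= tt j.
Proof.
case: j => [|j]; first exact: rhoD.
rewrite /link_scale /= /c /tt /eta addnS exprS invfM mulrA mulfV// mul1r.
by have [] := hparent (n0j j) i.
Qed.

Let ls0 j i : 0 <= link_scale rho t0 c par j i. Proof. exact: rho0. Qed.

Let hq j i : expR (- q j) <= bump_stable alpha (link_scale rho t0 c par j i * (2 / A j)).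
Proof.
have Aj := A0 j; have lsj := ls0 j i.
case: j Aj lsj => [|j] Aj lsj; last first.
  apply: le_trans (bump_stable_ge_exp a0 a2 _); rewrite ler_expR lerN2 ler_wpM2l//.
  apply: ge0_ler_powR; rewrite ?nnegrE ?(ltW a0)//.
  - by rewrite mulr_ge0// divr_ge0// ltW.
  - by rewrite divr_ge0 ?(ltW Aj)// mulr_ge0// (le_trans lsj).
  - by rewrite mulrCA mulrA ler_pM2r ?invr_gt0// ler_pM2l.
have Dr : link_scale rho t0 c par 0 i * (2 / A 0%N) <= 16 * D / e.
  have -> : 16 * D / e = D * (2 / A 0%N).
    by rewrite /A /slab_level/=; field; rewrite gt_eqF.
  by apply: ler_wpM2r; [rewrite divr_ge0// ltW|exact: rhoD].
apply: le_trans (bump_stable_antitone alpha02 _); last first.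
  by apply/andP; split; [|exact: Dr]; rewrite mulr_ge0// divr_ge0// ltW.
have e1 : e <= 1.
  case/andP: he => _ /ltW /le_trans; apply.
  by rewrite -expR0 ler_expR oppr_le0.
apply: le_trans (hc0 _).
  rewrite /q opprB expRD lnK ?posrE// /lK expRN lnK ?posrE ?divr_gt0 ?mulr_gt0//.
  by rewrite !invf_div mulrCA mulrA.
rewrite ler_pdivlMr// mul1r (le_trans e1)// (le_trans D1)// ler_peMl ?(ltW D0)//.
by rewrite ler1n.
Qed.

Let Nq j : (0 < j)%N -> (N j)%:R * q j = M * 2 `^ alpha * (NT j * A j `^ (- alpha)).
Proof.
case: j => // j _; rewrite /q /NT.
have t0' : 0 <= tt j.+1 by rewrite mulr_ge0// invr_ge0 exprn_ge0.
have Aj := A0 j.+1; have Ai : 0 <= (A j.+1)^-1 by rewrite invr_ge0 ltW.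
rewrite (powRM _ (mulr_ge0 (ler0n R 2) t0') Ai) (powRM _ (ler0n R 2) t0').
rewrite -(powR_inv1 (ltW Aj)) -powRrM mulN1r; ring.
Qed.

Let Nq_ge0 j : 0 <= (N j)%:R * q j.
Proof.
rewrite mulr_ge0//; case: j => [|j]; last by rewrite /q mulr_ge0 ?powR_ge0.
by rewrite /q addr_ge0//; apply: le_trans (ltW l1).
Qed.

Definition coarse_cst : R := C * 2 `^ alpha * (lK + 1).

(** At radius of order [e] there are at most a multiple of [e^(- alpha) |ln e|^(- beta)] points,
    each costing at most a multiple of [|ln e|]. *)
Let coarse_cost : (N 0%N)%:R * q 0%N <=
  coarse_cst * (e `^ (- alpha) * `|ln e| `^ (1 - beta)).
Proof.
have hN := hcard (n0j 0%N).
have l0 : 0 < - ln e by exact: lt_trans l1.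
have lb : 0 < (- ln e) `^ beta by rewrite powR_gt0.
have h1 : (N 0%N)%:R * (- ln e) `^ beta <= C * 2 `^ alpha * e `^ (- alpha).
  apply: (@le_trans _ _ ((N 0%N)%:R * n0%:R `^ beta)).
    by rewrite ler_wpM2l//; apply: ge0_ler_powR; rewrite ?nnegrE ?(ltW beta0) ?(ltW l0).
  rewrite /N; move: hN; rewrite addn0 => hN; apply: le_trans hN _.
  rewrite -mulrA ler_wpM2l//.
  have -> : 2 `^ alpha * e `^ (- alpha) = (2 / e) `^ alpha.
    by rewrite powRM ?invr_ge0 ?(ltW e0)// -(powR_inv1 (ltW e0)) -powRrM mulN1r.
  by apply: ge0_ler_powR; rewrite ?nnegrE ?(ltW a0) ?exprn_ge0// divr_ge0 ?(ltW e0).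
have h2 : q 0%N <= (lK + 1) * - ln e.
  rewrite /q mulrDl mul1r lerD2r; apply: ler_peMr => //; exact: ltW.
have -> : `|ln e| = - ln e by rewrite ler0_norm// -oppr_ge0 ltW.
rewrite powRB; last by apply/implyP => _; rewrite gt_eqF.
rewrite powRr1 ?(ltW l0)//.
apply: le_trans (ler_wpM2l (ler0n _ _) h2) _.
have h3 : (N 0%N)%:R <= C * 2 `^ alpha * e `^ (- alpha) / (- ln e) `^ beta.
  by rewrite ler_pdivlMr.
have k0 : 0 <= (lK + 1) * - ln e by rewrite mulr_ge0 ?(ltW l0)// addr_ge0.
apply: le_trans (ler_wpM2r k0 h3) _.
by rewrite /coarse_cst le_eqVlt; apply/orP; left; apply/eqP; ring.
Qed.

Let cost_le J : \sum_(0 <= j < J) (N j)%:R * q j <=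
  coarse_cst * (e `^ (- alpha) * `|ln e| `^ (1 - beta)) +
  M * 2 `^ alpha * (C2 * 8 `^ alpha) *
    (e `^ (- alpha) * slab_weight alpha beta n0 n1 `^ (1 + alpha)) +
  M * 2 `^ alpha * (C2 / (beta - 1)) * cutoff alpha beta e.
Proof.
have k0 : 0 <= M * 2 `^ alpha by rewrite mulr_ge0 ?powR_ge0.
(* The sum of nonnegative terms is lengthened so as to contain all levels up to [n1]. *)
apply: (@le_trans _ _ (\sum_(0 <= j < (n1 - n0).+1 + J) (N j)%:R * q j)).
  by rewrite [leRHS](@big_cat_nat _ _ _ J)//= ?leq_addl// lerDl sumr_ge0.
rewrite (@big_cat_nat _ _ _ (n1 - n0).+1)//= ?leq_addr// big_ltn//.
apply: lerD; first apply: lerD => //.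
  have h := @slab_cost_main _ alpha beta e C2 n0 n1 NT a0 e0 C20 n00 hNT.
  rewrite -mulrA; apply: le_trans (ler_wpM2l k0 h).
  rewrite mulr_sumr !big_nat le_eqVlt; apply/orP; left; apply/eqP.
  by apply: eq_bigr => j /andP[j0 _]; rewrite Nq.
have h := slab_cost_tail beta1 ab e0 L1 C20 x1 n00 n01 Ln1 hNT ((n1 - n0).+1 + J).
rewrite -mulrA; apply: le_trans (ler_wpM2l k0 h).
rewrite mulr_sumr !big_nat le_eqVlt; apply/orP; left; apply/eqP.
by apply: eq_bigr => j /andP[j0 _]; rewrite Nq//; exact: leq_trans j0.
Qed.

Lemma small_ball_chaining : exists B : set Omega, measurable B /\
  B `<=` [set w | forall s t, `|X s w - X t w| <= e] /\
  ((expR (- (coarse_cst * (e `^ (- alpha) * `|ln e| `^ (1 - beta)) +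
    M * 2 `^ alpha * (C2 * 8 `^ alpha) *
      (e `^ (- alpha) * slab_weight alpha beta n0 n1 `^ (1 + alpha)) +
    M * 2 `^ alpha * (C2 / (beta - 1)) * cutoff alpha beta e + 1)))%:E <= P B)%E.
Proof.
have hn j t : exists i, (i < N j)%N /\ rho t (c j i) <= eta j by exact: hnet.
have heta (del : R) : 0 < del -> exists j, eta j < del.
  move=> del0; exists (Num.Def.truncn del^-1).+1.
  rewrite /eta invf_plt ?posrE ?exprn_gt0//; apply: lt_le_trans (truncnS_gt _) _.
  rewrite -natrX ler_nat; apply: leq_trans (ltnW (ltn_expl _ (isT : (1 < 2)%N))) _.
  by rewrite leq_exp2l// leq_addl.
have hpar j i : (par j i < N j)%N by have [] := hparent (n0j j) i.
have th0 : 0 <= th by case/andP: th01.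
exact: (small_ball_of_chain alpha02 SX rho0 chf cT0 mN0 PN0 sepT0 hn heta hpar
  e0 htt A0 hq th01 ath (slab_level_sum alpha beta n0 n1 e0)
  (slab_tail_budget ab e0 L1 th0 bth C20 x1 n00 n01 Ln1 hNT hL) cost_le).
Qed.

End chaining_cost.

(** * The exponent [th] and the final choice of constants *)

Lemma chaining_exponent {R : realFieldType} (alpha beta : R) :
  0 < alpha -> Num.max 1 alpha < beta ->
  exists th, [/\ 0 <= th <= 1, alpha * th < 1 & 1 < beta * th].
Proof.
move=> a0 mb; have m1 : 1 <= Num.max 1 alpha by rewrite le_max lexx.
have ma : alpha <= Num.max 1 alpha by rewrite le_max lexx orbT.
move: (Num.max 1 alpha) mb m1 ma => m mb m1 ma.
have bm0 : 0 < beta + m by lra.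
(* [1 / th] is the midpoint of [m] and [beta], so [1 / beta < th < 1 / m]. *)
exists (2 / (beta + m)); split.
- by rewrite divr_ge0 ?(ltW bm0)//= ler_pdivrMr// mul1r; lra.
- by rewrite mulrA ltr_pdivrMr// mul1r; lra.
- by rewrite mulrA ltr_pdivlMr// mul1r; lra.
Qed.

(** The additive [1] coming from Markov's factor is absorbed by [z], which will be the cutoff. *)
Lemma sum_weighted_le {R : realFieldType} (a b c x y z : R) :
  0 <= a -> 0 <= b -> 0 <= c -> 0 <= x -> 0 <= y -> 1 <= z ->
  a * x + b * y + c * z + 1 <= (a + b + c + 1) * (x + y + z).
Proof.
move=> a0 b0 c0 x0 y0 z1; have z0 : 0 <= z by lra.
have := mulr_ge0 a0 y0; have := mulr_ge0 a0 z0.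
have := mulr_ge0 b0 x0; have := mulr_ge0 b0 z0.
have := mulr_ge0 c0 x0; have := mulr_ge0 c0 y0.
lra.
Qed.

Lemma coarse_cst_ge0 {R : realType} (alpha C D c : R) :
  0 <= C -> 1 <= D -> 0 < c <= 1 -> 0 <= coarse_cst alpha C D c.
Proof.
move=> C0 D1 /andP[c0 c1]; rewrite /coarse_cst !mulr_ge0 ?powR_ge0 ?addr_ge0//.
rewrite ln_ge0// ler_pdivlMr// mul1r (le_trans c1)// (le_trans D1)//.
by rewrite ler_peMl ?ler1n// (le_trans _ D1).
Qed.

(** For uncountable [T] the small ball event may fail to be measurable, so the bound is stated for a
    measurable subset of it. The covering hypothesis is multiplied out, which avoids dividing by
    [ln e = 0] at [e = 1]. *)
Theorem theorem6 (R : realType) (d : measure_display) (Omega : measurableType d)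
    (P : probability Omega R) (T : Type) (X : T -> Omega -> R)
    (rho : T -> T -> R) (alpha beta C : R) :
  0 < alpha -> alpha < 2 ->
  (exists t0 : T, True) ->
  SaS_process P alpha X ->
  (forall s t, 0 <= rho s t) ->
  (forall s t (u : R),
     (\int[P]_w (cos (u * (X t w - X s w)))%:E
        = (expR (- (rho t s `^ alpha * `|u| `^ alpha)))%:E)%E /\
     (\int[P]_w (sin (u * (X t w - X s w)))%:E = 0)%E) ->
  separable_process P rho X ->
  has_ubound [set r | exists s t, r = rho s t] ->
  totally_bounded_pm rho ->
  0 < C -> Num.max 1 alpha < beta ->
  (forall e, 0 < e -> e < diam rho ->
     (covnum rho e)%:R * `|ln e| `^ beta <= C * e `^ (- alpha)) ->
  exists K, 0 < K /\ exists e0, 0 < e0 /\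
    forall e, 0 < e -> e < e0 ->
      exists A : set Omega, measurable A /\
        A `<=` [set w | forall s t, `|X s w - X t w| <= e] /\
        ((expR (- K * (if beta < 1 + alpha then e `^ (- (1 / (beta / alpha - 1)))
                       else if beta == 1 + alpha
                            then e `^ (- alpha) * `|ln e| `^ (1 + alpha)
                            else e `^ (- alpha) * `|ln e| `^ (- beta + 1 + alpha))))%:E
          <= P A)%E.
Proof.
move=> a0 a2 [t0 _] SX rho0 chf0 [T0 [N0 [cT0 [mN0 [PN0 sep]]]]] bnd tb C0 mb cov.
have alpha02 : 0 < alpha < 2 by rewrite a0 a2.
have [beta1 ab] : 1 < beta /\ alpha < beta by move: mb; rewrite gt_max => /andP[].
have beta0 : 0 < beta by exact: lt_trans beta1.
have chf s t u := (chf0 s t u).1.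
have [C' /ltW C'0 [m nets]] := dyadic_nets bnd tb a0 beta0 C0 cov t0.
(* Nets exist from level [m] on; dummy values below it make the family total before the choice. *)
have exF n : exists p : nat * (nat -> T), (m <= n)%N ->
    (forall t, exists i, (i < p.1)%N /\ rho t (p.2 i) <= (2 ^+ n)^-1) /\
    p.1%:R * n%:R `^ beta <= C' * (2 ^+ n) `^ alpha.
  have [h|h] := leqP m n; last by exists (0%N, fun=> t0).
  by have [N [c hc]] := nets n h; exists (N, c).
have [F hF] := choice exF.
(* A parent is any point of net [n] that covers the given point of net [n.+1]. *)
have exG n : exists f : nat -> nat, (m <= n)%N -> forall i,
    (f i < (F n).1)%N /\ rho ((F n.+1).2 i) ((F n).2 (f i)) <= (2 ^+ n)^-1.
  have [h|h] := leqP m n; last by exists (fun=> 0%N).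
  have [hc _] := hF n h; have [f hf] := choice (fun i => hc ((F n.+1).2 i)).
  by exists f => _ i; exact: hf.
have [G hG] := choice exG.
have [th [th01 ath bth]] := chaining_exponent a0 mb.
have ap0 : 0 < alpha / (beta - alpha) by rewrite divr_gt0// subr_gt0.
have K30 : 0 <= `|dyadic_cst alpha th| * (C' * 2 `^ alpha) `^ th / (beta * th - 1).
  by rewrite !mulr_ge0 ?powR_ge0// invr_ge0 subr_ge0 ltW.
have [L [L1 L3 hL]] := large_cutoff_factor K30 bth ap0.
have [c [c00 c01 hc0]] : exists c, [/\ 0 < c, c <= 1 &
    forall r, 1 <= r -> c / r <= bump_stable alpha r].
  have [c c0 hc] := @bump_stable_ge_inv R alpha a0.
  exists (Num.min c 1); split; rewrite ?lt_min ?c0 ?ltr01 ?ge_min ?lexx ?orbT//.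
  move=> r r1; apply: le_trans (hc r r1).
  by rewrite ler_wpM2r ?invr_ge0 ?(le_trans _ r1)// ge_min lexx.
(* The maximum with [1] keeps the ratio [16 D / e] at least [1], the range of
   [bump_stable_ge_inv]. *)
have D1 : 1 <= Num.max 1 (diam rho) by rewrite le_max lexx.
have rhoD s t : rho s t <= Num.max 1 (diam rho) by rewrite le_max (le_diam bnd) orbT.
move: (Num.max 1 (diam rho)) D1 rhoD => D D1 rhoD.
have k0 : 0 <= bump_mom alpha * 2 `^ alpha by rewrite mulr_ge0 ?powR_ge0 ?bump_mom_ge0.
have [K K0 hK] := rate_bound a0 beta1 ab L1.
have A0 : 0 <= coarse_cst alpha C' D c by rewrite coarse_cst_ge0// c00.
have B0 : 0 <= bump_mom alpha * 2 `^ alpha * (C' * 2 `^ alpha * 8 `^ alpha).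
  by rewrite mulr_ge0// !mulr_ge0 ?powR_ge0.
have E0 : 0 <= bump_mom alpha * 2 `^ alpha * (C' * 2 `^ alpha / (beta - 1)).
  by rewrite mulr_ge0// !mulr_ge0 ?powR_ge0// invr_ge0 subr_ge0 ltW.
have Q0 := ltr_wpDl (addr_ge0 (addr_ge0 A0 B0) E0) (@ltr01 R).
eexists; split; first exact: mulr_gt0 Q0 K0.
(* Forces [e < exp (-1)] and [n0 >= - ln e > m + 1], so that every level of the chain has a net. *)
exists (expR (- (m%:R + 1))); split; first exact: expR_gt0.
move=> e e0 ee0.
have he : 0 < e < expR (- 1).
  by rewrite e0 (lt_le_trans ee0)// ler_expR lerN2 lerDr.
have [n0 [n0l n03 n0e]] := finest_level he.
have mn0 : (m <= n0)%N.
  rewrite -(ler_nat R) (le_trans _ n0l)// ltW// (@lt_trans _ _ (m%:R + 1)) ?ltrDl//.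
  by rewrite ltrNr -[ltRHS]expRK ltr_ln ?posrE ?expR_gt0.
have [n1 [n01 Ln1 n1L]] := last_slab_level a0 ab L1 L3 he n03.
have hnet n : (n0 <= n)%N -> forall t,
    exists i, (i < (F n).1)%N /\ rho t ((F n).2 i) <= (2 ^+ n)^-1.
  by move=> h; exact: (hF n (leq_trans mn0 h)).1.
have hcard n : (n0 <= n)%N -> (F n).1%:R * n%:R `^ beta <= C' * (2 ^+ n) `^ alpha.
  by move=> h; exact: (hF n (leq_trans mn0 h)).2.
have hpar n : (n0 <= n)%N -> forall i,
    (G n i < (F n).1)%N /\ rho ((F n.+1).2 i) ((F n).2 (G n i)) <= (2 ^+ n)^-1.
  by move=> h; exact: hG n (leq_trans mn0 h).
have [A [mA [sA PA]]] := small_ball_chaining alpha02 beta1 ab SX rho0 chf t0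
  cT0 mN0 PN0 sep hnet hcard hpar rhoD D1 C'0 c00 c01 hc0 th01 ath bth he L1
  n0l n0e n01 Ln1 hL.
exists A; split => //; split => //; apply: le_trans PA.
rewrite lee_fin ler_expR mulNr lerN2 -/(rate alpha beta e) -[leRHS]mulrA.
apply: le_trans (ler_wpM2l (ltW Q0) (hK e he n0 n1 n01 n0l n1L)).
apply: sum_weighted_le => //; rewrite ?mulr_ge0 ?powR_ge0//.
exact: cutoff_ge1.
Qed.
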